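(* Let $T>0$, $d\ge1$, and let $\sigma:\mathbb{R}\to\mathbb{R}$ be an activation function such that: (i) $\sigma$ is globally Lipschitz; (ii) the set $\mathcal{F}=\bigcup_{m\in\mathbb{Z}_+}\{x\mapsto\sum_{i=1}^m\alpha_i\sigma(w_i^Tx+\theta_i) : \alpha_i\in\mathbb{R},\, w_i\in\mathbb{R}^d,\,\theta_i\in\mathbb{R}\}$ is dense in $C(\mathbb{R}^d;\mathbb{R})$ for uniform convergence on compact sets, i.e. for every $f\in C(\mathbb{R}^d;\mathbb{R})$, every compact $\Omega\subset\mathbb{R}^d$ and every $\delta>0$ there is $g\in\mathcal{F}$ with $\sup_{x\in\Omega}|f(x)-g(x)|<\delta$. Let $\mu_0,\mu^f\in\mathcal{P}_2(\mathbb{R}^d)$ have compact supports and be absolutely continuous with respect to the Lebesgue measure. Then for every $\epsilon>0$ there exist piecewise constant functions $A^\epsilon:[0,T]\to\mathbb{R}^{d\times d}$, $W^\epsilon:[0,T]\to\mathbb{R}^{d\times d}$ and $\theta^\epsilon:[0,T]\to\mathbb{R}^d$ such that the corresponding weak solution $\mu^\epsilon$ of $$\frac{\partial\mu^\epsilon}{\partial t}+\nabla\cdot\Big(\big(A^\epsilon(t)\Sigma(W^\epsilon(t)x+\theta^\epsilon(t))\big)\mu^\epsilon\Big)=0,\qquad \mu^\epsilon(0)=\mu_0,$$ satisfies $$W_2(\mu^\epsilon_T,\mu^f)\le\epsilon.$$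
   Context: $\Sigma:\mathbb{R}^d\to\mathbb{R}^d$ is defined by applying $\sigma$ componentwise: $\Sigma(x)=[\sigma(x_1),\dots,\sigma(x_d)]^T$. $\mathbb{Z}_+$ denotes the positive integers. $\mathcal{P}_2(\mathbb{R}^d)$ is the set of Borel probability measures on $\mathbb{R}^d$ with finite second moment, and $W_2$ is the $2$-Wasserstein distance, $W_2(\mu,\nu)=\min_{\gamma\in\Gamma(\mu,\nu)}\big(\int|x-y|^2d\gamma(x,y)\big)^{1/2}$, where $\Gamma(\mu,\nu)$ is the set of probability measures on $\mathbb{R}^d\times\mathbb{R}^d$ with marginals $\mu$ and $\nu$. $C([0,T],\mathcal{P}_2(\mathbb{R}^d))$ is the set of curves $t\mapsto\mu_t$ continuous with respect to $W_2$. For a vector field $V:[0,T]\times\mathbb{R}^d\to\mathbb{R}^d$, a curve $\mu\in C([0,T],\mathcal{P}_2(\mathbb{R}^d))$ is a weak solution of $\frac{\partial\mu}{\partial t}+\nabla\cdot(V_t(x)\mu)=0$, $\mu(0)=\mu_0$, if $$\int_0^T\int_{\mathbb{R}^d}\Big(\frac{\partial\phi(t,x)}{\partial t}+\nabla\phi(t,x)\cdot V_t(x)\Big)d\mu_t(x)\,dt=-\int_{\mathbb{R}^d}\phi(0,x)\,d\mu_0(x)$$ for all compactly supported real-valued $\phi\in C^\infty([0,T)\times\mathbb{R}^d)$. A function on $[0,T]$ is piecewise constant if $[0,T]$ can be partitioned into finitely many intervals on each of which it is constant. *)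

(* Defs.v *)
From HB Require Import structures.
From mathcomp Require Import all_boot all_order all_algebra.
From mathcomp Require Import all_classical all_reals all_analysis.
From mathcomp Require Import measurable_realfun.

Set Implicit Arguments.
Unset Strict Implicit.
Unset Printing Implicit Defensive.
Import Order.TTheory GRing.Theory Num.Theory.
Import numFieldNormedType.Exports.
Local Open Scope classical_set_scope.
Local Open Scope ring_scope.

(* Points of R^d are column vectors. The topology of 'cV[R]_d is the usual    *)
(* one, but the library norm `|x| is the sup norm: the Euclidean norm is      *)
(* enorm below. The sigma-algebra is the Borel one, generated by open sets.   *)
HB.instance Definition _ (R : realType) (m n : nat) :=
  Measurable.copy 'M[R]_(m, n) (g_sigma_algebraType (@open 'M[R]_(m, n))).

Lemma open_measurable_mx (R : realType) m n (U : set 'M[R]_(m, n)) :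
  open U -> measurable U.
Proof. by move=> oU; apply: sub_sigma_algebra. Qed.

Section lebesgue_cV.
Context {R : realType}.

Lemma open_preimage_nonexpansive (T U : pseudoMetricType R) (f : T -> U)
    (O : set U) :
  (forall p q e, ball p e q -> ball (f p) e (f q)) -> open O ->
  open (f @^-1` O).
Proof.
rewrite !openE => fb oO p Op; have /nbhs_ballP[e e0 eO] := oO _ Op.
by apply/nbhs_ballP; exists e => // q /fb; exact: eO.
Qed.

Definition cons_cV n (p : R * 'cV[R]_n) : 'cV[R]_n.+1 :=
  \col_i oapp (fun j => p.2 j ord0) p.1 (unlift ord0 i).

Lemma cons_cV_ball n (p q : R * 'cV[R]_n) (e : R) :
  ball p e q -> ball (cons_cV p) e (cons_cV q).
Proof.
move=> [/= pq1 [e0 pq2]]; split=> // i j; rewrite !mxE.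
by case: unliftP => [k _|_] /=; [exact: pq2|exact: pq1].
Qed.

Definition uncons_cV n (v : 'cV[R]_n.+1) : R * 'cV[R]_n :=
  (v ord0 ord0, \col_i v (lift ord0 i) ord0).

Lemma cons_cVK n : cancel (@cons_cV n) (@uncons_cV n).
Proof.
move=> [x v]; rewrite /uncons_cV mxE unlift_none /=; congr (_, _).
by apply/matrixP => i j; rewrite !mxE liftK (ord1 j).
Qed.

Lemma uncons_cV_ball n (u v : 'cV[R]_n.+1) (e : R) :
  ball u e v -> ball (uncons_cV u) e (uncons_cV v).
Proof.
move=> [e0 uv]; split; first exact: uv.
by split=> // i j; rewrite !mxE; exact: uv.
Qed.

Lemma measurable_coord m n (i : 'I_m) (j : 'I_n) :
  measurable_fun setT (fun M : 'M[R]_(m, n) => M i j).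
Proof.
apply: (measurability _ (RGenOInfty.measurableE R)) => _ [_ [a ->] <-].
rewrite setTI; apply: open_measurable_mx.
by apply: open_comp; [move=> + _; exact: coord_continuous|exact: interval_open].
Qed.

Lemma measurable_uncons_cV n : measurable_fun setT (@uncons_cV n).
Proof.
apply/measurable_fun_pairP; split; first exact: measurable_coord.
apply: (@measurability _ _ _ _ _ _ (@open 'cV[R]_n)) => // _ [U oU <-].
rewrite setTI; apply: open_measurable_mx.
by apply: open_preimage_nonexpansive => // u v e /uncons_cV_ball[].
Qed.

Local Definition rbox n (i : rat * 'cV[rat]_n * nat) : set (R * 'cV[R]_n) :=
  ball (ratr i.1.1 : R) i.2.+1%:R^-1 `*`
  ball (map_mx ratr i.1.2 : 'cV[R]_n) i.2.+1%:R^-1.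

Lemma ball_rat (x e : R) : 0 < e -> exists q : rat, ball x e (ratr q).
Proof.
move=> e0; have /rat_in_itvoo[q] : x < x + e by rewrite ltrDl.
rewrite in_itv/= => /andP[xq qx]; exists q.
by rewrite /ball/= distrC gtr0_norm ?subr_gt0// ltrBlDl.
Qed.

Lemma open_prod_cV_measurable n (O : set (R * 'cV[R]_n)) :
  open O -> measurable O.
Proof.
move=> oO.
have -> : O = \bigcup_i (if `[< @rbox n i `<=` O >] then @rbox n i else set0).
apply/seteqP; split => [p Op|p [i _]]; last first.
  by case: asboolP => [sub|_] //; exact: sub.
  have /nbhs_ballP[e /= e0 eO] : nbhs p O by move: oO; rewrite openE; exact.
  have [k ke] : exists k : nat, k.+1%:R^-1 < e / 2.
    have [|k] := @ltr_add_invr _ 0 (e / 2); first by rewrite divr_gt0.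
    by rewrite add0r => ?; exists k.
  have k0 : 0 < k.+1%:R^-1 :> R by rewrite invr_gt0.
  have [q pq] := ball_rat p.1 k0.
  have /choice[v pv] : forall i, exists q, ball (p.2 i ord0) k.+1%:R^-1 (ratr q).
    by move=> i; exact: ball_rat.
  have pi : @rbox n (q, \col_i v i, k) p.
    split; first exact: ball_sym.
    by split=> // i j; rewrite !mxE (ord1 j); exact: ball_sym.
  exists (q, \col_i v i, k) => //; case: asboolP => // notsub; exfalso; apply: notsub.
  move=> r [/= pr1 pr2]; apply: eO; rewrite (splitr e).
  case: pi => /= pi1 pi2; split.
    apply: (@le_ball _ _ _ (k.+1%:R^-1 + k.+1%:R^-1)).
      by rewrite lerD// ltW.
    exact: (ball_triangle (ball_sym pi1)).
  apply: (@le_ball _ _ _ (k.+1%:R^-1 + k.+1%:R^-1)).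
    by rewrite lerD// ltW.
  exact: (ball_triangle (ball_sym pi2)).
apply: countable_bigcupT_measurable; first exact: countableP.
move=> i; case: asboolP => // _; apply: measurableX.
  by apply: open_measurable; exact: ball_open.
by apply: open_measurable_mx; exact: ball_open.
Qed.

Lemma measurable_cons_cV n : measurable_fun setT (@cons_cV n).
Proof.
apply: (@measurability _ _ _ _ _ _ (@open 'cV[R]_n.+1)) => //.
move=> _ [U oU <-]; rewrite setTI.
by apply: open_prod_cV_measurable; apply: open_preimage_nonexpansive => //;
  exact: cons_cV_ball.
Qed.

Definition lebesgue_cV_step n (m : {sigma_finite_measure set 'cV[R]_n -> \bar R})
    : set 'cV[R]_n.+1 -> \bar R :=
  pushforward (@lebesgue_measure R \x m)%E (@cons_cV n).

Section step.
Variables (n : nat) (m : {sigma_finite_measure set 'cV[R]_n -> \bar R}).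
Local Open Scope ereal_scope.

Let mcons (A : set 'cV[R]_n.+1) : measurable A -> measurable (@cons_cV n @^-1` A).
Proof. by move=> mA; rewrite -[X in measurable X]setTI; exact: measurable_cons_cV. Qed.

Let step0 : lebesgue_cV_step m set0 = 0.
Proof. by rewrite /lebesgue_cV_step /pushforward preimage_set0 measure0. Qed.

Let step_ge0 A : 0 <= lebesgue_cV_step m A.
Proof. by rewrite /lebesgue_cV_step /pushforward; exact: measure_ge0. Qed.

Let step_sigma_additive : semi_sigma_additive (lebesgue_cV_step m).
Proof.
move=> F mF tF mUF; rewrite /lebesgue_cV_step /pushforward preimage_bigcup.
apply: measure_semi_sigma_additive.
- by move=> k; exact: mcons.
- apply/trivIsetP => /= i j _ _ ij; rewrite -preimage_setI.
  by move/trivIsetP : tF => /(_ _ _ _ _ ij) ->//; rewrite preimage_set0.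
- by rewrite -preimage_bigcup; exact: mcons.
Qed.

HB.instance Definition _ := isMeasure.Build _ _ _ (lebesgue_cV_step m)
  step0 step_ge0 step_sigma_additive.

Let step_sigma_finite : sigma_finite setT (lebesgue_cV_step m).
Proof.
have /sigma_finiteP[F [TF ndF Foo]] := sigma_finiteT (@lebesgue_measure R).
have /sigma_finiteP[G [TG ndG Goo]] := sigma_finiteT m.
exists (fun k => @uncons_cV n @^-1` (F k `*` G k)).
  apply/seteqP; split => // v _.
  have [i _ Fi] : (\bigcup_i F i) (v ord0 ord0) by rewrite -TF.
  have [j _ Gj] : (\bigcup_i G i) (uncons_cV v).2 by rewrite -TG.
  exists (maxn i j) => //; split => /=.
  - by move: Fi; exact/subsetPset/ndF/leq_maxl.
  - by move: Gj; exact/subsetPset/ndG/leq_maxr.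
move=> k; have [mF Fk] := Foo k; have [mG Gk] := Goo k; split.
  by rewrite -[X in measurable X]setTI; apply: measurable_uncons_cV => //;
    exact: measurableX.
rewrite /lebesgue_cV_step /pushforward -comp_preimage.
rewrite (_ : _ \o _ = id); last by apply/funext => p /=; exact: cons_cVK.
by rewrite preimage_id product_measure1E// lte_mul_pinfty// ge0_fin_numE.
Qed.

HB.instance Definition _ := Measure_isSigmaFinite.Build _ _ _
  (lebesgue_cV_step m) step_sigma_finite.

End step.

(* Lebesgue measure on R^n, as an iterated product measure. *)
Fixpoint lebesgue_cV n : {sigma_finite_measure set 'cV[R]_n -> \bar R} :=
  match n with
  | 0 => \d_(0 : 'cV[R]_0)
  | n'.+1 => lebesgue_cV_step (lebesgue_cV n')
  end.

Lemma measurable_box n (A : 'I_n -> set R) : (forall i, measurable (A i)) ->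
  measurable [set v : 'cV[R]_n | forall i, A i (v i ord0)].
Proof.
move=> mA; rewrite (_ : mkset _ = \bigcap_i ((fun v : 'cV[R]_n => v i ord0) @^-1` A i)).
  apply: fin_bigcap_measurable => // i _; rewrite -[X in measurable X]setTI.
  exact: measurable_coord.
by apply/seteqP; split => v /= h i => [_|]; exact: h.
Qed.

Lemma lebesgue_cV_box n (A : 'I_n -> set R) : (forall i, measurable (A i)) ->
  lebesgue_cV n [set v | forall i, A i (v i ord0)] =
  (\prod_(i < n) lebesgue_measure (A i))%E.
Proof.
elim: n A => [|n IHn] A mA.
  by rewrite big_ord0 /= diracE mem_set// => -[].
rewrite big_ord_recl -IHn//= -product_measure1E; [|exact: mA|]; last first.
  exact: (@measurable_box n (fun i => A (lift ord0 i))).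
rewrite /lebesgue_cV_step /pushforward; congr ((_ \x _)%E _).
apply/seteqP; split => [[x v] /= h|[x v] /= [h1 h2] i].
  split; first by have := h ord0; rewrite mxE unlift_none.
  by move=> i; have := h (lift ord0 i); rewrite mxE liftK.
by rewrite mxE; case: unliftP => [j ->|->].
Qed.

End lebesgue_cV.
Arguments lebesgue_cV R n : clear implicits.

Section wasserstein.
Context {R : realType} {d : nat}.
Implicit Types mu nu : probability 'cV[R]_d R.

Definition enorm (x : 'cV[R]_d) : R := Num.sqrt (\sum_i x i ord0 ^+ 2).

Definition finite_second_moment mu : Prop :=
  (\int[mu]_x (enorm x ^+ 2)%:E < +oo)%E.

Definition measure_support mu : set 'cV[R]_d :=
  [set x | forall U, open_nbhs x U -> (0 < mu U)%E].

(* The product sigma-algebra carried by 'cV[R]_d * 'cV[R]_d is the Borel one  *)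
(* since 'cV[R]_d is second countable.                                        *)
Definition couplings mu nu : set (probability ('cV[R]_d * 'cV[R]_d)%type R) :=
  [set g | (forall A, measurable A -> g (fst @^-1` A) = mu A) /\
           (forall B, measurable B -> g (snd @^-1` B) = nu B)].

Definition W2 mu nu : \bar R :=
  ereal_inf [set ((\int[g]_z (enorm (z.1 - z.2) ^+ 2)%:E) `^ (2^-1)%R)%E
            | g in couplings mu nu].

Definition W2_continuous (T : R) (mu : R -> probability 'cV[R]_d R) : Prop :=
  forall t, t \in `[0, T] ->
    W2 (mu s) (mu t) @[s --> within `[0, T] (nbhs t)] --> 0%E.

End wasserstein.

(* C^oo: every iterated directional derivative is Frechet differentiable.     *)
Definition smooth (R : realType) (V : normedModType R) (f : V -> R) : Prop :=
  forall (vs : seq V) (x : V),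
    differentiable (foldr (fun v g => 'D_v g : V -> R) f vs) x.

Section continuity_equation.
Context {R : realType} {d : nat}.
Implicit Types (T : R) (phi : R * 'cV[R]_d -> R).

(* Compactly supported elements of C^oo([0,T) x R^d): as [0,T) x R^d has a    *)
(* boundary, smooth functions on it are restrictions of functions that are    *)
(* smooth on R x R^d. Only the restriction has to be compactly supported.     *)
Definition test_function T phi : Prop :=
  smooth phi /\
  exists K : set (R * 'cV[R]_d),
    [/\ compact K, K `<=` `[0, T[ `*` setT &
        forall t x, t \in `[0, T[ -> ~ K (t, x) -> phi (t, x) = 0].

Definition dt phi t x : R := 'D_1 (fun s => phi (s, x)) t.

Definition grad phi t x : 'cV[R]_d :=
  \col_i 'D_(delta_mx i ord0) (fun y => phi (t, y)) x.

Definition dot (u v : 'cV[R]_d) : R := (u^T *m v) ord0 ord0.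

Definition weak_solution T (V : R -> 'cV[R]_d -> 'cV[R]_d)
    (mu0 : probability 'cV[R]_d R) (mu : R -> probability 'cV[R]_d R) : Prop :=
  [/\ forall t, t \in `[0, T] -> finite_second_moment (mu t),
      W2_continuous T mu &
      forall phi, test_function T phi ->
        (\int[lebesgue_measure]_(t in `[0%R, T])
           \int[mu t]_x (dt phi t x + dot (grad phi t x) (V t x))%:E =
         - \int[mu0]_x (phi (0%R, x))%:E)%E].

End continuity_equation.

Definition piecewise_constant (R : realType) (X : Type) (T : R) (f : R -> X) :
    Prop :=
  exists (n : nat) (I : 'I_n -> interval R),
    [/\ `[0, T]%classic = \bigcup_i [set` I i],
        trivIset setT (fun i => [set` I i]) &
        forall i, exists c, forall t, t \in I i -> f t = c].

Definition shallow_networks (R : realType) (d : nat) (sigma : R -> R) :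
    set ('cV[R]_d -> R) :=
  [set g | exists (m : nat) (alpha : 'I_m -> R) (w : 'I_m -> 'cV[R]_d)
             (theta : 'I_m -> R),
     (0 < m)%N /\
     g = fun x => \sum_i alpha i * sigma (dot (w i) x + theta i)].

Definition dense_on_compacts (R : realType) (d : nat)
    (F : set ('cV[R]_d -> R)) : Prop :=
  forall (f : 'cV[R]_d -> R) (K : set 'cV[R]_d) (delta : R),
    continuous f -> compact K -> 0 < delta ->
    exists2 g, F g &
      (ereal_sup [set `|f x - g x|%:E | x in K] < delta%:E)%E.

(* Main.v *)
Require Import Defs.
From HB Require Import structures.
From mathcomp Require Import all_boot all_order all_algebra.
From mathcomp Require Import all_classical all_reals all_analysis.
From mathcomp Require Import measurable_realfun.
From mathcomp Require Import ring lra.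
Set Implicit Arguments.
Unset Strict Implicit.
Unset Printing Implicit Defensive.
Import Order.TTheory GRing.Theory Num.Theory.
Import numFieldNormedType.Exports.
Local Open Scope classical_set_scope.
Local Open Scope ring_scope.

(** All the controls used here have a single active neuron: A and W have one
nonzero entry, the field is [f (x_j) e_i] with [f s = al * sigma (w s + th)], and
its flow [x |-> x + u(t, x_j) e_i] comes from a scalar ODE. Composing many short
pieces approximates the flow of any sum of such fields, hence, by density, of
[(Z(x_0) - x_i) e_i], which drives [x_i] to [Z(x_0)]. The support of muf is cut
into small cells [C_j], and mu0 into slabs [l_j < x_0 <= u_j] of nearly the mass
of [C_j]. With Z constant on slabs, all of slab j is sent close to a point [y_j]
of [C_j]: first the coordinates other than 0, then coordinate 0, which the flow
can only move monotonically, so cells are sorted along it. Coupling each slab with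
its cell bounds W2.

The bound is required of every weak solution, hence uniqueness is needed. On a
piece of the partition, [int phi(t) dmu_t] has derivative
[int (dt phi + f(x_j) d_i phi) dmu_t] for test functions phi. Transporting psi
backwards by small Euler steps, along a smooth approximation of f with the same
Lipschitz constant, produces approximate solutions phi of the dual equation with
bounded gradients and supports; thus mu at the start of the piece determines
[int psi dmu] at its end. *)

(** * Smooth functions *)

(** Since [sigma] is merely Lipschitz, a flow need not be differentiable in x, and a test function
    carried along it need not be a test function: hence a dual equation solved only approximately,
    with a mollified field. Every command has Lipschitz constant at most 1/2 on unit time. Picard
    iteration then contracts without localization; on a piece of length tau the field, rescaled by
    1/tau, has duration times Lipschitz constant equal to 1/2, so that in the backward Euler scheme
    gradients at most double and supports stay in a fixed cube. The horizon T is no constraint: a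
    list of commands of any length fits into it once the amplitude of A is raised. Coordinate 0 is
    the label of a slab. It must stay readable while the other coordinates are set, and the law Z
    must be continuous, whence gaps between the slabs; the small mass in the gaps is moved by a
    bounded distance only. Absolute continuity enters through null hyperplanes: the distribution
    function of x_0 is continuous, so slabs of prescribed mass exist. *)

Section smooth_theory.
Context {R : realType}.

(** Coinduction principle: every iterated derivative stays in [S]. Smoothness is thus reduced to
    finding a family of differentiable functions stable under derivation. *)
Lemma smooth_coind (V : normedModType R) (S : set (V -> R)) :
  (forall f, S f -> (forall x, differentiable f x) /\ forall v, S ('D_v f)) ->
  forall f, S f -> smooth f.
Proof.
move=> HS f Sf vs x.
suff : S (foldr (fun v g => 'D_v g : V -> R) f vs) by move=> /HS[].
by elim: vs => //= v vs IH; apply: (HS _ IH).2.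
Qed.

Lemma smooth_differentiable (V : normedModType R) (f : V -> R) x :
  smooth f -> differentiable f x.
Proof. by move=> /(_ [::] x). Qed.

Lemma smooth_derive (V : normedModType R) (f : V -> R) v :
  smooth f -> smooth ('D_v f).
Proof. by move=> sf vs x; have := sf (rcons vs v) x; rewrite foldr_rcons. Qed.

Lemma smooth_continuous (V : normedModType R) (f : V -> R) :
  smooth f -> continuous f.
Proof. by move=> sf x; apply/differentiable_continuous/smooth_differentiable. Qed.

Lemma smooth_cst (V : normedModType R) (a : R) : smooth (fun _ : V => a).
Proof.
apply: (@smooth_coind _ [set f : V -> R | exists a, f = cst a]); last by exists a.
move=> f [b ->]; split=> [x|v]; first exact: differentiable_cst.
by exists 0; apply/funext => x; exact: derive_cst.
Qed.

Lemma smooth_linear (V : normedModType R) (f : {linear V -> R}) :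
  continuous f -> smooth f.
Proof.
move=> cf; apply: (@smooth_coind _ [set g : V -> R | g = f \/ smooth g]); last by left.
move=> g [->|sg]; split => [x|v].
- exact: linear_differentiable.
- right; rewrite (_ : 'D_v f = fun _ => f v); first exact: smooth_cst.
  apply/funext => x; rewrite deriveE; last exact: linear_differentiable.
  by rewrite diff_lin.
- exact: smooth_differentiable.
- by right; exact: smooth_derive.
Qed.

(* Closed under directional derivatives, so that smooth_coind makes its        *)
(* members smooth.                                                            *)
Inductive smooth_gen (V : normedModType R) : (V -> R) -> Prop :=
| SGbase f : smooth f -> smooth_gen f
| SGadd f g : smooth_gen f -> smooth_gen g -> smooth_gen (fun x => f x + g x)
| SGmul f g : smooth_gen f -> smooth_gen g -> smooth_gen (fun x => f x * g x)
| SGinv f : (forall x, f x != 0) -> smooth_gen f -> smooth_gen (fun x => (f x)^-1)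
| SGcomp (g : R -> R) f : smooth g -> smooth_gen f -> smooth_gen (fun x => g (f x))
| SGvec n (g : 'cV[R]_n -> R) (E : V -> 'cV[R]_n) : smooth g ->
    (forall i, smooth_gen (fun x => E x i ord0)) -> smooth_gen (fun x => g (E x)).

Lemma cV_sum_delta n (x : 'cV[R]_n) : x = \sum_i x i ord0 *: delta_mx i ord0.
Proof.
apply/matrixP => i j; rewrite (ord1 j) summxE (bigD1 i)//= big1.
  by rewrite addr0 !mxE !eqxx mulr1.
by move=> k ki; rewrite !mxE eq_sym (negbTE ki) mulr0.
Qed.

Lemma differentiable_cV (V : normedModType R) n (E : V -> 'cV[R]_n) x :
  (forall i, differentiable (fun x => E x i ord0) x) -> differentiable E x.
Proof.
move=> dE.
rewrite (_ : E = \sum_i (fun x => E x i ord0 *: delta_mx i ord0)); last first.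
  by apply/funext => y; rewrite fct_sumE [LHS]cV_sum_delta.
by apply: differentiable_sum => i; apply: differentiableZl.
Qed.

Lemma smooth_gen_diff (V : normedModType R) (f : V -> R) : smooth_gen f ->
  forall x, differentiable f x.
Proof.
elim => {f}.
- by move=> f sf x; exact: smooth_differentiable.
- by move=> f g _ df _ dg x; exact: differentiableD.
- by move=> f g _ df _ dg x; exact: differentiableM.
- by move=> f f0 _ df x; apply: differentiable_comp => //; exact: differentiableV.
- by move=> g f sg _ df x; apply: (@differentiable_comp _ _ _ _ f g) => //; exact: smooth_differentiable.
- move=> n g E sg _ dE x; apply: (@differentiable_comp _ _ _ _ E g) => //.
    by apply: differentiable_cV => i; exact: dE.
  exact: smooth_differentiable.
Qed.

Lemma smooth_gen_sum (V : normedModType R) n (f : 'I_n -> V -> R) :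
  (forall i, smooth_gen (f i)) -> smooth_gen (fun x => \sum_i f i x).
Proof.
elim: n f => [|n IH] f sf.
  rewrite (_ : (fun _ => _) = fun=> 0); last by apply/funext => x; rewrite big_ord0.
  exact/SGbase/smooth_cst.
rewrite (_ : (fun _ => _) = fun x => \sum_i f (widen_ord (leqnSn n) i) x + f ord_max x).
  by apply: SGadd => //; apply: IH.
by apply/funext => x; rewrite big_ord_recr.
Qed.

(** The rules of calculus express each derivative by members of the family. In the vector case the
    chain rule is written with partial derivatives, [sum_i D_v E_i * D_i g(E)], so that only scalar
    generators occur. *)
Lemma smooth_genD (V : normedModType R) (f : V -> R) : smooth_gen f ->
  forall v, smooth_gen ('D_v f).
Proof.
move=> sf v; elim: sf => {f}.
- by move=> f sf; exact/SGbase/smooth_derive.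
- move=> f g /smooth_gen_diff df Df /smooth_gen_diff dg Dg.
  rewrite (_ : 'D_v _ = fun x => 'D_v f x + 'D_v g x); first exact: SGadd.
  by apply/funext => x; rewrite deriveD//; exact: diff_derivable.
- move=> f g sf Df sg Dg.
  have df := smooth_gen_diff sf; have dg := smooth_gen_diff sg.
  rewrite (_ : 'D_v _ = fun x => f x * 'D_v g x + g x * 'D_v f x).
    by apply: SGadd; apply: SGmul.
  by apply/funext => x; rewrite deriveM//; exact: diff_derivable.
- move=> f f0 sf Df; have df := smooth_gen_diff sf.
  rewrite (_ : 'D_v _ = fun x => ((-1) * ((f x)^-1 * (f x)^-1)) * 'D_v f x).
    apply: SGmul => //; apply: SGmul; first exact/SGbase/smooth_cst.
    by apply: SGmul; apply: SGinv.
  apply/funext => x; rewrite deriveV//; last exact: diff_derivable.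
  by rewrite mulN1r -invfM expr2.
- move=> g f sg sf Df; have df := smooth_gen_diff sf.
  rewrite (_ : 'D_v _ = fun x => 'D_1 g (f x) * 'D_v f x).
    by apply: SGmul => //; exact: (SGcomp (smooth_derive (1 : R) sg) sf).
  have dg x := smooth_differentiable x sg.
  apply/funext => x; rewrite deriveE; last exact: differentiable_comp.
  rewrite (@diff_comp _ _ _ _ f g)//= deriveE// deriveE//.
  by rewrite -[X in 'd g _ X]mulr1 linearZ/= mulrC.
- move=> n g E sg sE DE; have dEi i := smooth_gen_diff (sE i).
  have dE x : differentiable E x by apply: differentiable_cV => i; exact: dEi.
  have dg x := smooth_differentiable x sg.
  rewrite (_ : 'D_v _ =
      fun x => \sum_i 'D_v (fun x => E x i ord0) x * 'D_(delta_mx i ord0) g (E x)).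
    apply: smooth_gen_sum => i; apply: SGmul => //.
    exact: (SGvec (smooth_derive _ sg) sE).
  apply/funext => x; rewrite deriveE; last exact: differentiable_comp.
  rewrite (@diff_comp _ _ _ _ E g)//=.
  rewrite [in LHS](cV_sum_delta ('d E x v)) linear_sum; apply: eq_bigr => i _.
  rewrite linearZ/= deriveE// deriveE//; congr (_ * _).
  rewrite (_ : (fun x => E x i ord0) = (fun N : 'cV[R]_n => N i ord0) \o E)//.
  rewrite (diff_comp (dE x) (differentiable_coord (E x) i ord0))/=.
  have @h : {linear 'cV[R]_n -> R}.
    by exists (fun N : 'cV[R]_n => N i ord0); do 2![eexists]; do ?[constructor];
     rewrite ?mxE// => ? *; rewrite ?mxE//; move=> ?; rewrite !mxE.
  by rewrite (@diff_lin _ _ _ h)//; exact: coord_continuous.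
Qed.

Lemma smooth_genP (V : normedModType R) (f : V -> R) : smooth_gen f -> smooth f.
Proof.
apply: smooth_coind => g sg; split; first exact: smooth_gen_diff.
exact: smooth_genD.
Qed.

Lemma smooth_add (V : normedModType R) (f g : V -> R) :
  smooth f -> smooth g -> smooth (fun x => f x + g x).
Proof. by move=> sf sg; apply: smooth_genP; apply: SGadd; exact: SGbase. Qed.

Lemma smooth_mul (V : normedModType R) (f g : V -> R) :
  smooth f -> smooth g -> smooth (fun x => f x * g x).
Proof. by move=> sf sg; apply: smooth_genP; apply: SGmul; exact: SGbase. Qed.

Lemma smooth_inv (V : normedModType R) (f : V -> R) :
  (forall x, f x != 0) -> smooth f -> smooth (fun x => (f x)^-1).
Proof. by move=> f0 sf; apply: smooth_genP; apply: SGinv => //; exact: SGbase. Qed.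

Lemma smooth_comp (V : normedModType R) (g : R -> R) (f : V -> R) :
  smooth g -> smooth f -> smooth (fun x => g (f x)).
Proof. by move=> sg sf; apply: smooth_genP; apply: SGcomp => //; exact: SGbase. Qed.

Lemma smooth_vec (V : normedModType R) n (g : 'cV[R]_n -> R) (E : V -> 'cV[R]_n) :
  smooth g -> (forall i, smooth (fun x => E x i ord0)) ->
  smooth (fun x => g (E x)).
Proof. by move=> sg sE; apply: smooth_genP; apply: SGvec => // i; exact: SGbase. Qed.

Lemma smooth_sum (V : normedModType R) n (f : 'I_n -> V -> R) :
  (forall i, smooth (f i)) -> smooth (fun x => \sum_i f i x).
Proof. by move=> sf; apply: smooth_genP; apply: smooth_gen_sum => i; exact: SGbase. Qed.

Lemma smooth_prod (V : normedModType R) n (f : 'I_n -> V -> R) :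
  (forall i, smooth (f i)) -> smooth (fun x => \prod_i f i x).
Proof.
elim: n f => [|n IH] f sf.
  rewrite (_ : (fun _ => _) = fun=> 1); first exact/smooth_cst.
  by apply/funext => x; rewrite big_ord0.
rewrite (_ : (fun _ => _) = fun x => \prod_i f (widen_ord (leqnSn n) i) x * f ord_max x).
  by apply: smooth_mul => //; apply: IH.
by apply/funext => x; rewrite big_ord_recr.
Qed.

Lemma smooth_id : smooth (id : R -> R).
Proof. by apply: (@smooth_linear _ idfun) => x; exact: cvg_id. Qed.

Lemma smooth_opp (V : normedModType R) (f : V -> R) :
  smooth f -> smooth (fun x => - f x).
Proof.
move=> sf; rewrite (_ : (fun _ => _) = fun x => -1 * f x).
  by apply: smooth_mul => //; exact: smooth_cst.
by apply/funext => x; rewrite mulN1r.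
Qed.

Lemma smooth_sub (V : normedModType R) (f g : V -> R) :
  smooth f -> smooth g -> smooth (fun x => f x - g x).
Proof. by move=> sf sg; apply: smooth_add => //; exact: smooth_opp. Qed.

Lemma derive_line (V : normedModType R) (f : V -> R) (x v : V) (g : R -> V)
    (t : R) : differentiable f x -> is_derive t 1 g v -> g t = x ->
  is_derive t 1 (f \o g) ('D_v f x).
Proof.
move=> df dg gx.
have dgt : differentiable g t by apply/derivable1_diffP; case: dg.
have dfg : differentiable f (g t) by rewrite gx.
apply: DeriveDef; first exact/derivable1_diffP/differentiable_comp.
rewrite deriveE; last exact: differentiable_comp.
rewrite diff_comp//= -[in 'd g t _]deriveE// (@derive_val _ _ _ _ _ _ _ dg).
by rewrite gx deriveE.
Qed.

End smooth_theory.

(** * Flat functions and a smooth transition from 1 to 0 *)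

Section smooth_step.
Context {R : realType}.
Implicit Types P : {poly R}.

(* With a polynomial factor the family is closed under derivation, whence      *)
(* smoothness of all its members at once.                                     *)
Definition flat_exp P (x : R) : R := if 0 < x then P.[x^-1] * expR (- x^-1) else 0.

(** With y = 1/x, the exponential series gives y^(i+2) <= (i+2)! exp(y) for each monomial; the two
    spare powers of y become x^2. The quadratic bound makes the derivative at 0 vanish. *)
Lemma flat_exp_bound P : exists2 C : R, 0 <= C & forall x, `|flat_exp P x| <= C * x ^+ 2.
Proof.
exists (\sum_(i < size P) `|P`_i| * (i.+2)`!%:R).
  by apply: sumr_ge0 => i _; rewrite mulr_ge0.
move=> x; rewrite /flat_exp; case: ifPn => x0; last first.
  rewrite normr0 mulr_ge0// ?sqr_ge0//.
  by apply: sumr_ge0 => i _; rewrite mulr_ge0.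
rewrite normrM (@ger0_norm _ (expR _)) ?expR_ge0// expRN.
rewrite ler_pdivrMr ?expR_gt0// horner_coef.
apply: (le_trans (ler_norm_sum _ _ _)).
rewrite mulr_suml mulr_suml; apply: ler_sum => i _.
rewrite normrM -!mulrA ler_wpM2l//.
have y0 : 0 < x^-1 by rewrite invr_gt0.
have := expR_ge1Dxn i.+1 (ltW y0).
rewrite normrX gtr0_norm// => h.
have : x^-1 ^+ i.+2 <= (i.+2)`!%:R * expR x^-1.
  rewrite -ler_pdivrMl ?ltr0n ?fact_gt0// mulrC.
  by apply: le_trans h; rewrite lerDr.
move=> /(ler_wpM2r (sqr_ge0 x)).
rewrite -addn2 exprD -mulrA -exprMn mulVf ?gt_eqF// expr1n mulr1 => h2.
by apply: (le_trans h2); rewrite addn2 le_eqVlt; apply/orP; left; apply/eqP; ring.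
Qed.

(** For x > 0 and y = 1/x, the x-derivative of P(y) exp(-y) is y^2 (P(y) - P'(y)) exp(-y), of the
    same form; at 0 the difference quotient is at most C |h|. *)
Lemma flat_exp_derive P (x : R) :
  is_derive x (1 : R) (flat_exp P) (flat_exp ('X^2 * (P - P^`())) x).
Proof.
have [x0|x0|->] := ltgtP x 0.
- rewrite {2}/flat_exp ltNge (ltW x0)/=.
  apply: (@near_eq_is_derive _ _ _ (cst 0)).
    near=> y; rewrite /flat_exp ltNge.
    suff -> : y <= 0 by [].
    by apply: ltW; near: y; exact: lt_nbhsl.
- rewrite {2}/flat_exp x0.
  apply: (@near_eq_is_derive _ R R (fun y : R => P.[y^-1] * expR (- y^-1))).
    near=> y; rewrite /flat_exp.
    suff -> : 0 < y by [].
    by near: y; exact: lt_nbhsr.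
  have xn0 : x != 0 by rewrite gt_eqF.
  have d1 : is_derive x (1 : R) (fun y : R => y^-1) (- x ^- 2 *: 1).
    by apply: is_deriveV.
  have d2 : is_derive x (1 : R) (horner P \o (fun y : R => y^-1)) _ :=
    is_derive1_comp (is_derive_poly P x^-1) d1.
  have d3 : is_derive x (1 : R) (fun y : R => - y^-1) _ := is_deriveN d1.
  have d4 : is_derive x (1 : R) (expR \o (fun y : R => - y^-1)) _ :=
    @is_derive1_comp _ expR (fun y : R => - y^-1) x _ _ (is_derive_expR (- x^-1)) d3.
  apply: (is_derive_eq (is_deriveM d2 d4)).
  rewrite hornerM hornerXn hornerD hornerN -exprVn /GRing.scale/=.
  ring.
- rewrite {2}/flat_exp ltxx.
  have [C C0 hC] := flat_exp_bound P.
  have f0 : flat_exp P 0 = 0 by rewrite /flat_exp ltxx.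
  suff h : (fun h : R => h^-1 *: ((flat_exp P \o shift 0) (h *: 1) - flat_exp P 0)) @ 0^'
      --> (0 : R).
    apply: DeriveDef; first by apply/cvg_ex; exists 0; exact: h.
    exact/cvg_lim.
  rewrite f0; apply/cvgr0Pnorm_le => e e0.
  near=> h.
  have hn0 : h != 0 by near: h; exact: nbhs_dnbhs_neq.
  rewrite /= subr0 addr0 scaler1 normrZ normfV ler_pdivrMl ?normr_gt0//.
  apply: (le_trans (hC h)).
  have -> : h ^+ 2 = `|h| * `|h| by rewrite -expr2 real_normK ?num_real.
  rewrite mulrCA ler_wpM2l//.
  have: `|h| <= e / (C + 1).
    by near: h; apply: dnbhs0_le; rewrite divr_gt0// ltr_wpDl.
  rewrite ler_pdivlMr ?ltr_wpDl// => hh; apply: le_trans hh.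
  by rewrite mulrC ler_wpM2l// lerDl.
Unshelve. all: by end_near. Qed.

Lemma smooth_flat_exp P : smooth (flat_exp P).
Proof.
apply: (@smooth_coind _ _ [set f : R -> R | exists P, f = flat_exp P]); last by exists P.
move=> f [Q ->]; split=> [x|v].
  by apply/derivable1_diffP; case: (flat_exp_derive Q x).
exists (v *: ('X^2 * (Q - Q^`()))); apply/funext => x.
have dQ : differentiable (flat_exp Q) x.
  by apply/derivable1_diffP; case: (flat_exp_derive Q x).
rewrite deriveE// -[X in 'd _ _ X]mulr1 [in LHS]linearZ/= -deriveE//.
rewrite (@derive_val _ _ _ _ _ _ _ (flat_exp_derive Q x)).
by rewrite /flat_exp; case: ifP => _; rewrite ?scaler0// hornerZ /GRing.scale/= mulrA.
Qed.

Definition smooth_step (x : R) : R :=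
  flat_exp 1 (1 - x) / (flat_exp 1 (1 - x) + flat_exp 1 x).

Lemma flat_exp1_ge0 x : 0 <= flat_exp 1 x.
Proof. by rewrite /flat_exp; case: ifP => // _; rewrite hornerE mul1r expR_ge0. Qed.

Lemma flat_exp1_gt0 x : 0 < x -> 0 < flat_exp 1 x.
Proof. by rewrite /flat_exp => ->; rewrite hornerE mul1r expR_gt0. Qed.

Lemma flat_exp_le0 P x : x <= 0 -> flat_exp P x = 0.
Proof. by rewrite /flat_exp ltNge => ->. Qed.

Lemma smooth_step_den x : 0 < flat_exp 1 (1 - x) + flat_exp 1 x.
Proof.
have [x0|x0] := ltP 0 x; first by rewrite ltr_wpDl ?flat_exp1_ge0 ?flat_exp1_gt0.
by rewrite ltr_pwDl ?flat_exp1_ge0 ?flat_exp1_gt0//; lra.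
Qed.

Lemma smooth_step_smooth : smooth smooth_step.
Proof.
have s1 : smooth (fun x : R => flat_exp 1 (1 - x)).
  apply: (smooth_comp (smooth_flat_exp 1)).
  by apply: smooth_sub; [exact: smooth_cst|exact: smooth_id].
apply: smooth_mul => //; apply: smooth_inv.
  by move=> x; rewrite gt_eqF// smooth_step_den.
by apply: smooth_add => //; exact: smooth_flat_exp.
Qed.

Lemma smooth_step_le0 x : x <= 0 -> smooth_step x = 1.
Proof.
move=> x0; rewrite /smooth_step (flat_exp_le0 _ x0) addr0 divff//.
by rewrite gt_eqF// flat_exp1_gt0//; lra.
Qed.

Lemma smooth_step_ge1 x : 1 <= x -> smooth_step x = 0.
Proof. by move=> x0; rewrite /smooth_step flat_exp_le0 ?mul0r//; lra. Qed.

Lemma smooth_step_ge0 x : 0 <= smooth_step x.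
Proof. by rewrite divr_ge0 ?flat_exp1_ge0// ltW// smooth_step_den. Qed.

Lemma smooth_step_le1 x : smooth_step x <= 1.
Proof. by rewrite ler_pdivrMr ?smooth_step_den// mul1r lerDl flat_exp1_ge0. Qed.

End smooth_step.

(** * Smooth approximation without loss on the Lipschitz constant *)

Section smooth_lipschitz_approx.
Context {R : realType}.
Implicit Types x s : R.

Lemma smooth_expR : smooth (expR : R -> R).
Proof.
apply: (@smooth_coind _ _ [set f : R -> R | exists a : R, f = fun x => a * expR x]); last first.
  by exists 1; apply/funext => x; rewrite mul1r.
have de x : is_derive x (1 : R) (expR : R -> R) (expR x) by exact: is_derive_expR.
move=> f [a ->]; split=> [x|v].
  by apply: differentiableM => //; apply/derivable1_diffP; case: (de x).
exists (v * a); apply/funext => x.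
have dx : differentiable (expR : R -> R) x by apply/derivable1_diffP; case: (de x).
have dax : differentiable (fun x => a * expR x) x by exact: differentiableM.
rewrite deriveE// -[X in 'd _ _ X]mulr1 [in LHS]linearZ/= -deriveE//.
rewrite deriveM//= derive_cst scaler0 addr0.
by rewrite (@derive_val _ _ _ _ _ _ _ (de x)) /GRing.scale/= mulrA.
Qed.

Definition softplus x : R := ln (1 + expR x).

Definition sigmoid x : R := (1 + expR (- x))^-1.

Lemma is_derive_softplus x : is_derive x (1 : R) softplus (sigmoid x).
Proof.
have e0 : 0 < 1 + expR x by rewrite addr_gt0// expR_gt0.
have d1 : is_derive x (1 : R) (fun y : R => 1 + expR y) (0 + expR x).
  exact: is_deriveD.
have d2 : is_derive x (1 : R) ((@ln R) \o (fun y : R => 1 + expR y)) _ :=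
  @is_derive1_comp _ (@ln R) (fun y : R => 1 + expR y) x _ _ (is_derive1_ln e0) d1.
apply: (is_derive_eq d2); rewrite /sigmoid expRN add0r.
have := expR_gt0 x; move=> ex; field.
by rewrite !gt_eqF// addrC.
Qed.

Lemma smooth_sigmoid : smooth sigmoid.
Proof.
apply: smooth_inv; first by move=> x; rewrite gt_eqF// addr_gt0// expR_gt0.
apply: smooth_add; first exact: smooth_cst.
by apply: (smooth_comp smooth_expR); apply: smooth_opp; exact: smooth_id.
Qed.

Lemma smooth_softplus : smooth softplus.
Proof.
apply: (@smooth_coind _ _ [set f : R -> R | f = softplus \/ smooth f]); last by left.
move=> f [->|sf]; last first.
  by split=> [x|v]; [exact: smooth_differentiable|right; exact: smooth_derive].
split=> [x|v]; first by apply/derivable1_diffP; case: (is_derive_softplus x).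
right; rewrite (_ : 'D_v softplus = fun x => v * sigmoid x).
  by apply: smooth_mul; [exact: smooth_cst|exact: smooth_sigmoid].
apply/funext => x.
have dx : differentiable softplus x.
  by apply/derivable1_diffP; case: (is_derive_softplus x).
rewrite deriveE// -[X in 'd _ _ X]mulr1 [in LHS]linearZ/= -deriveE//.
by rewrite (@derive_val _ _ _ _ _ _ _ (is_derive_softplus x)).
Qed.

Lemma sigmoid_ge0 x : 0 <= sigmoid x.
Proof. by rewrite invr_ge0 addr_ge0// expR_ge0. Qed.

Lemma sigmoid_le1 x : sigmoid x <= 1.
Proof. by rewrite invf_le1 ?addr_gt0 ?expR_gt0// lerDl expR_ge0. Qed.

Lemma sigmoid_nd x y : x <= y -> sigmoid x <= sigmoid y.
Proof.
move=> xy; rewrite lef_pV2 ?posrE ?addr_gt0 ?expR_gt0//.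
by rewrite lerD2l ler_expR lerN2.
Qed.

(** The difference is ln(1 + exp(-|x|)), and 0 <= ln(1 + exp y) <= exp y <= 1 for y <= 0. *)
Lemma softplus_relu x : `|softplus x - Num.max x 0| <= 1.
Proof.
have ln1 y : y <= 0 -> 0 <= ln (1 + expR y) <= (1 : R).
  move=> y0; rewrite ln_ge0/= ?lerDl ?expR_ge0//.
  apply: (@le_trans _ _ (expR y)); last by rewrite expR_le1.
  by apply: le_ln1Dx; rewrite (@lt_le_trans _ _ 0)// expR_ge0.
rewrite ler_norml; have [x0|x0] := leP x 0.
  by rewrite /softplus; have := ln1 _ x0; lra.
have -> : softplus x = x + ln (1 + expR (- x)).
  rewrite -[X in X + _](@expRK R) -lnM ?posrE ?expR_gt0 ?addr_gt0 ?expR_gt0//.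
  by rewrite mulrDr mulr1 -expRD subrr expR0 addrC.
by have := ln1 (- x); lra.
Qed.

Section approx.
Variables (f : R -> R) (L : R).
Hypothesis L0 : 0 <= L.
Hypothesis fL : forall a b, `|f a - f b| <= L * `|a - b|.
Variables (w h x0 : R).
Hypotheses (w0 : 0 < w) (h0 : 0 < h).

(* f is interpolated by ramps at equally spaced nodes, then every ramp is      *)
(* smoothed into a softplus: the derivative becomes a combination of the       *)
(* slopes of f, with nonnegative weights of total at most 1, whence the        *)
(* Lipschitz constant L survives.                                             *)
Definition pwl_node k : R := x0 + k%:R * w.
Definition pwl_slope k : R := (f (pwl_node k.+1) - f (pwl_node k)) / w.
Definition pwl_relu s : R := Num.max s 0.
Definition pwl_plus s := h * softplus (s / h).

Let pS k : pwl_node k.+1 = pwl_node k + w.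
Proof. by rewrite /pwl_node -natr1 mulrDl mul1r addrA. Qed.

Let m_le k : `|pwl_slope k| <= L.
Proof.
rewrite normrM normfV (gtr0_norm w0) ler_pdivrMr//.
by apply: (le_trans (fL _ _)); rewrite pS addrC addKr gtr0_norm.
Qed.

(** Each difference of [pwl_relu] is a ramp that rises from 0 to [w] between two nodes and stays
    there: term [k] adds the increment of [f] over one mesh interval, and past the last node these
    increments telescope. *)
Definition pwl n s : R := f x0 + \sum_(k < n) pwl_slope k * (pwl_relu (s - pwl_node k) - pwl_relu (s - pwl_node k.+1)).

Let pl_eq n s : pwl_node n <= s -> pwl n s = f (pwl_node n).
Proof.
elim: n => [|n IH] sp.
  by rewrite /pwl big_ord0 addr0 /pwl_node mul0r addr0.
rewrite /pwl big_ord_recr/= addrA -/(pwl n s) IH; last first.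
    by rewrite pS in sp; have := w0; lra.
have sp' : 0 <= s - pwl_node n by rewrite pS in sp; have := w0; lra.
rewrite /pwl_relu !max_l; [|lra|lra].
by rewrite /pwl_slope pS; field; rewrite gt_eqF.
Qed.

Let pl_close n s : x0 <= s -> s <= pwl_node n -> `|pwl n s - f s| <= 2 * L * w.
Proof.
move=> sx; elim: n => [|n IH] sp.
  have -> : s = x0 by move: sp; rewrite /pwl_node mul0r addr0 => sp; apply/eqP; rewrite eq_le sp.
  by rewrite /pwl big_ord0 addr0 subrr normr0 !mulr_ge0// ltW.
rewrite /pwl big_ord_recr/= addrA -/(pwl n s).
have [sn|sn] := leP s (pwl_node n).
  have sn' : s <= pwl_node n.+1 by rewrite pS; have := w0; lra.
  rewrite /pwl_relu !max_r; [|lra|lra].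
  by rewrite subrr mulr0 addr0 IH.
rewrite pl_eq; last exact: ltW.
rewrite /pwl_relu max_l ?max_r; [|lra..].
rewrite subr0 addrAC; apply: (le_trans (ler_normD _ _)).
rewrite (_ : 2 * L * w = L * w + L * w); last by ring.
apply: lerD.
  apply: (le_trans (fL _ _)); rewrite ler_wpM2l// distrC gtr0_norm; last lra.
  by rewrite pS in sp; lra.
rewrite normrM ler_pM//; rewrite gtr0_norm; last lra.
by rewrite pS in sp; lra.
Qed.

Definition pwl_smooth n s : R := f x0 + \sum_(k < n) pwl_slope k * (pwl_plus (s - pwl_node k) - pwl_plus (s - pwl_node k.+1)).

Let S_relu s : `|pwl_plus s - pwl_relu s| <= h.
Proof.
have -> : pwl_relu s = h * Num.max (s / h) 0.
  by rewrite maxr_pMr ?ltW// mulr0 mulrC divfK// gt_eqF.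
rewrite -mulrBr normrM (gtr0_norm h0) -[leRHS]mulr1.
by apply: ler_wpM2l; [exact: ltW|exact: softplus_relu].
Qed.

Let g_close n s : `|pwl_smooth n s - pwl n s| <= n%:R * (2 * L * h).
Proof.
rewrite /pwl_smooth /pwl opprD addrACA subrr add0r -sumrB; apply: (le_trans (ler_norm_sum _ _ _)).
rewrite mulr_natl -[X in _ *+ X](card_ord n) -sumr_const; apply: ler_sum => k _.
rewrite -mulrBr normrM (_ : 2 * L * h = L * (2 * h)); last by ring.
rewrite ler_pM//.
have := S_relu (s - pwl_node k); have := S_relu (s - pwl_node k.+1).
by rewrite !ler_norml; lra.
Qed.

Let S_smooth a : smooth (fun s => pwl_plus (s - a)).
Proof.
apply: smooth_mul; first exact: smooth_cst.
apply: (smooth_comp smooth_softplus).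
apply: smooth_mul; last exact: smooth_cst.
by apply: smooth_sub; [exact: smooth_id|exact: smooth_cst].
Qed.

Let S_derive a s : is_derive s (1 : R) (fun s => pwl_plus (s - a)) (sigmoid ((s - a) / h)).
Proof.
have d1 : is_derive s (1 : R) (fun s => (s - a) / h) h^-1.
  have -> : (fun s => (s - a) / h) = h^-1 \*: (id - cst a).
    by apply/funext => y; rewrite /= mulrC.
  have d0 : is_derive s (1 : R) (id - cst a : R -> R) (1 - 0) by exact: is_deriveB.
  apply: (is_derive_eq (is_deriveZ h^-1 d0)).
  by rewrite subr0 /GRing.scale/= mulr1.
have d2 := @is_derive1_comp _ softplus _ s _ _ (is_derive_softplus _) d1.
have -> : (fun s => pwl_plus (s - a)) = h \*: (softplus \o (fun s => (s - a) / h)) by [].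
apply: (is_derive_eq (is_deriveZ h d2)).
by rewrite /GRing.scale/= mulrCA divff ?mulr1// gt_eqF.
Qed.

Let g_smooth n : smooth (pwl_smooth n).
Proof.
apply: smooth_add; first exact: smooth_cst.
apply: smooth_sum => k; apply: smooth_mul; first exact: smooth_cst.
by apply: smooth_sub; exact: S_smooth.
Qed.

Let g_derive n s : `|'D_1 (pwl_smooth n) s| <= L.
Proof.
have dS k : is_derive s (1 : R) (fun s => pwl_slope k * (pwl_plus (s - pwl_node k) - pwl_plus (s - pwl_node k.+1)))
    (pwl_slope k * (sigmoid ((s - pwl_node k) / h) - sigmoid ((s - pwl_node k.+1) / h))).
  have d1 := S_derive (pwl_node k) s. have d2 := S_derive (pwl_node k.+1) s.
  have -> : (fun s => pwl_slope k * (pwl_plus (s - pwl_node k) - pwl_plus (s - pwl_node k.+1))) =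
    pwl_slope k \*: ((fun s => pwl_plus (s - pwl_node k)) - (fun s => pwl_plus (s - pwl_node k.+1))) by [].
  exact: is_deriveZ.
have -> : pwl_smooth n = cst (f x0) + \sum_(k < n) (fun s => pwl_slope k * (pwl_plus (s - pwl_node k) - pwl_plus (s - pwl_node k.+1))).
  by apply/funext => y; rewrite /pwl_smooth /= fctE fct_sumE.
rewrite (@derive_val _ _ _ _ _ _ _ (is_deriveD _ (is_derive_sum (fun k : 'I_n => dS k)))).
rewrite add0r; apply: (le_trans (ler_norm_sum _ _ _)).
apply: (@le_trans _ _ (\sum_(k < n) L * (sigmoid ((s - pwl_node k) / h) - sigmoid ((s - pwl_node k.+1) / h)))).
  apply: ler_sum => k _; rewrite normrM ler_pM// ger0_norm ?subr_ge0//.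
  apply: sigmoid_nd; rewrite ler_pM2r ?invr_gt0// pS; have := w0; lra.
rewrite -mulr_sumr -[leRHS]mulr1 ler_wpM2l//.
rewrite -(big_mkord xpredT (fun k => sigmoid ((s - pwl_node k) / h) - sigmoid ((s - pwl_node k.+1) / h))).
under eq_bigr do rewrite -opprB.
rewrite sumrN telescope_sumr// opprB.
by have := sigmoid_le1 ((s - pwl_node 0) / h); have := sigmoid_ge0 ((s - pwl_node n) / h); lra.
Qed.

Let g_bounded n : exists B, forall s, `|pwl_smooth n s| <= B.
Proof.
exists (`|f x0| + \sum_(k < n) `|pwl_slope k| * (w + 2 * h)) => s.
apply: (le_trans (ler_normD _ _)); rewrite lerD2l.
apply: (le_trans (ler_norm_sum _ _ _)); apply: ler_sum => k _.
rewrite normrM; apply: ler_wpM2l => //.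
have := S_relu (s - pwl_node k); have := S_relu (s - pwl_node k.+1).
have : `|pwl_relu (s - pwl_node k) - pwl_relu (s - pwl_node k.+1)| <= w.
  have := w0; rewrite /pwl_relu pS /Num.max ler_norml; do ?case: ifPn; lra.
by rewrite !ler_norml; lra.
Qed.

Lemma smooth_lipschitz_approx_aux n : exists2 g : R -> R, smooth g &
  [/\ exists B, forall s, `|g s| <= B, forall s, `|'D_1 g s| <= L &
   forall s, x0 <= s -> s <= x0 + n%:R * w ->
    `|g s - f s| <= n%:R * (2 * L * h) + 2 * L * w].
Proof.
exists (pwl_smooth n); first exact: g_smooth.
split=> [|s|s s0 s1]; [exact: g_bounded|exact: g_derive|].
rewrite -(subrKA (pwl n s)); apply: (le_trans (ler_normD _ _)).
by apply: lerD; [exact: g_close|exact: pl_close].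
Qed.

End approx.

Lemma smooth_lipschitz_approx (f : R -> R) (L : R) : 0 <= L ->
  (forall a b, `|f a - f b| <= L * `|a - b|) ->
  forall r e, 0 < e -> exists2 g : R -> R, smooth g &
  [/\ exists B, forall s, `|g s| <= B, forall s, `|'D_1 g s| <= L &
   forall s, `|s| <= r -> `|g s - f s| <= e].
Proof.
move=> L0 fL r e e0.
pose w := e / (4 * L + 1).
have w0 : 0 < w by rewrite divr_gt0//; lra.
have [n nw] : exists n : nat, 2 * r <= n%:R * w.
  exists (Num.truncn (2 * r / w)).+1; rewrite -ler_pdivrMr//.
  by rewrite ltW// truncnS_gt.
(* [h] comes after [n] because the errors of the [n] smoothed ramps add up: [n * (2 * L * h)] and
   [2 * L * w] are each at most [e / 2]. *)
pose h := e / (4 * n%:R * L + 1).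
have nL : 0 <= n%:R * L by rewrite mulr_ge0.
have h0 : 0 < h by rewrite divr_gt0//; lra.
have [g sg [gB gd gc]] := smooth_lipschitz_approx_aux L0 fL (- r) w0 h0 n.
exists g => //; split=> // s /ler_normlP[s1 s2].
apply: (le_trans (gc s _ _)); [lra|lra|].
have : h * (4 * n%:R * L + 1) = e by rewrite divfK// gt_eqF//; lra.
have : w * (4 * L + 1) = e by rewrite divfK// gt_eqF//; lra.
lra.
Qed.

End smooth_lipschitz_approx.

(** * Scalar flows *)

Section scalar_flow.
Context {R : realType}.
Local Notation mu := (@lebesgue_measure R).

Lemma continuous_itv_integrable (g : R -> R) (a b : R) : continuous g ->
  mu.-integrable `[a, b] (EFin \o g).
Proof.
move=> cg; apply: continuous_compact_integrable; first exact: segment_compact.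
exact: continuous_subspaceT.
Qed.

Definition prim (g : R -> R) (t : R) : R := \int[mu]_(r in `[0, t]) g r.

Lemma prim0 g : prim g 0 = 0.
Proof. by rewrite /prim set_itv1 Rintegral_set1. Qed.

Lemma Rintegral_itv_bound (g : R -> R) (a b M : R) : a <= b -> continuous g ->
  (forall r, a <= r <= b -> `|g r| <= M) ->
  `|\int[mu]_(r in `[a, b]) g r| <= M * (b - a).
Proof.
move=> ab cg gM.
apply: (le_trans (le_normr_Rintegral _ _)) => //; first exact: continuous_itv_integrable.
have cn : continuous (fun r => `|g r|).
  by move=> x; apply: continuous_comp; [exact: cg|exact: norm_continuous].
apply: (@le_trans _ _ (\int[mu]_(r in `[a, b]) M)).
  apply: le_Rintegral => //.
  - exact: (@continuous_itv_integrable (fun r => `|g r|)).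
  - by apply: (@continuous_itv_integrable (fun r => M)) => x; exact: cvg_cst.
have -> : \int[mu]_(r in `[a, b]) M = M * fine (mu `[a, b]) by apply: Rintegral_cst.
rewrite lebesgue_measure_itv/= lte_fin.
case: ltP => [_|ba]; first by rewrite -EFinB.
by rewrite mulr0 (_ : b = a) ?subrr ?mulr0//; apply/eqP; rewrite eq_le ab ba.
Qed.

Lemma prim_lip (g : R -> R) (a b M : R) : 0 <= a -> a <= b -> continuous g ->
  (forall r, a <= r <= b -> `|g r| <= M) -> `|prim g b - prim g a| <= M * (b - a).
Proof.
move=> a0 ab cg gM.
rewrite /prim Rintegral_itvB ?bnd_simp//; last exact: continuous_itv_integrable.
rewrite Rintegral_itv_obnd_cbnd.
  exact: Rintegral_itv_bound.
apply: integrableS (continuous_itv_integrable a b cg) => //.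
by apply: subset_itvr; rewrite bnd_simp.
Qed.

Lemma prim_sub (g1 g2 : R -> R) (t e : R) : 0 <= t -> continuous g1 -> continuous g2 ->
  (forall r, 0 <= r <= t -> `|g1 r - g2 r| <= e) ->
  `|prim g1 t - prim g2 t| <= e * t.
Proof.
move=> t0 c1 c2 ge; rewrite /prim -RintegralB//; [|exact: continuous_itv_integrable..].
rewrite -[X in e * X]subr0; apply: Rintegral_itv_bound => //.
by move=> x; apply: cvgB; [exact: c1|exact: c2].
Qed.

Lemma prim_derive (g : R -> R) (t : R) : 0 < t -> continuous g ->
  is_derive t (1 : R) (prim g) (g t).
Proof.
move=> t0 cg.
have := @continuous_FTC1 _ g (BLeft 0) t (t + 1).
rewrite ltrDl ltr01 => /(_ isT (continuous_itv_integrable _ _ cg)) /=.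
rewrite lte_fin => /(_ t0 (cg t))[d1 d2].
by apply: DeriveDef; [exact: d1|rewrite -derive1E; exact: d2].
Qed.

(** Nested intervals: [v n - 2 * M / 2 ^ n] increases, [v n + 2 * M / 2 ^ n] decreases, and the
    limit is the supremum of the lower ends. *)
Lemma geometric_limit (v : nat -> R) (M : R) :
  (forall n, `|v n.+1 - v n| <= M / 2 ^+ n) ->
  exists l, forall n, `|v n - l| <= 2 * M / 2 ^+ n.
Proof.
move=> vM.
have M0 : 0 <= M by have := vM 0; rewrite expr0 divr1; exact: le_trans.
have p0 n : 0 < (2 : R) ^+ n by rewrite exprn_gt0.
pose a n := v n - 2 * M / 2 ^+ n; pose b n := v n + 2 * M / 2 ^+ n.
have hS n : 2 * M / 2 ^+ n.+1 = M / 2 ^+ n.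
  by rewrite exprS; field; rewrite gt_eqF.
have aS n : a n <= a n.+1.
  have := vM n; rewrite /a hS ler_norml => /andP[h _].
  by move: h; set z := M / _; rewrite -[2 * M / _]mulrA -/z; lra.
have bS n : b n.+1 <= b n.
  have := vM n; rewrite /b hS ler_norml => /andP[_ h].
  by move: h; set z := M / _; rewrite -[2 * M / _]mulrA -/z; lra.
have am n m : (n <= m)%N -> a n <= a m.
  by move=> nm; apply: (@homo_leq _ a <=%O) => //; exact: le_trans.
have bm n m : (n <= m)%N -> b m <= b n.
  by move=> nm; apply: (@homo_leq _ b (fun x y => y <= x)) => // x y z; exact: ge_trans.
have ab n m : a n <= b m.
  apply: (le_trans (am _ _ (leq_maxl n m))).
  apply: (le_trans _ (bm _ _ (leq_maxr n m))).
  by rewrite lerD2l (@le_trans _ _ 0)// ?oppr_le0 divr_ge0 ?mulr_ge0// ltW.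
have hs : has_sup (range a).
  by split; [exists (a 0); exists 0|exists (b 0) => _ [n _ <-]].
exists (sup (range a)) => n.
have h1 : a n <= sup (range a) by apply: ub_le_sup; [exact: hs.2|exists n].
have h2 : sup (range a) <= b n.
  by apply: ge_sup; [exact: hs.1|move=> _ [m _ <-]].
by move: h1 h2; rewrite /a /b ler_norml; lra.
Qed.

(** Clamping freezes a flow outside of [0, 1]. The Picard iterates become globally Lipschitz in
    time, and a command will be the identity before its time slot and stationary after it. *)
Definition clamp01 (t : R) : R := Num.max 0 (Num.min t 1).

Lemma clamp01_ge0 t : 0 <= clamp01 t.
Proof. by rewrite le_max lexx. Qed.

Lemma clamp01_le1 t : clamp01 t <= 1.
Proof. by rewrite ge_max ler01 ge_min lexx orbT. Qed.

Lemma clamp01_id t : 0 <= t <= 1 -> clamp01 t = t.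
Proof. by move=> /andP[t0 t1]; rewrite /clamp01 min_l// max_r. Qed.

Lemma clamp01_nd a b : a <= b -> clamp01 a <= clamp01 b.
Proof. by rewrite /clamp01; do 2 (rewrite /Num.max /Num.min; do ?case: ifPn); lra. Qed.

Lemma clamp01_lip a b : `|clamp01 a - clamp01 b| <= `|a - b|.
Proof.
wlog ab : a b / a <= b.
  move=> H; have [/H//|/ltW/H] := leP a b.
  by rewrite distrC [leRHS]distrC.
rewrite distrC [leRHS]distrC !ger0_norm ?subr_ge0 ?clamp01_nd//.
by rewrite /clamp01 /Num.max /Num.min; do ?case: ifPn; lra.
Qed.

Lemma lipschitz_cont (v : R -> R) (K : R) :
  (forall a b, `|v a - v b| <= K * `|a - b|) -> continuous v.
Proof.
move=> vK x; apply/cvgrPdist_le => e e0.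
have K1 : 0 < `|K| + 1 by rewrite ltr_wpDl.
near=> y; apply: (le_trans (vK _ _)).
apply: (@le_trans _ _ ((`|K| + 1) * `|x - y|)).
  by rewrite ler_wpM2r// (le_trans (ler_norm K))// lerDl.
rewrite -ler_pdivlMl//; near: y.
by apply: cvgr_dist_le; [exact: cvg_id|rewrite mulr_gt0// invr_gt0].
Unshelve. all: by end_near. Qed.

Variables (f : R -> R) (L c : R).
Hypotheses (fL : forall a b, `|f a - f b| <= L * `|a - b|).
Hypotheses (L0 : 0 <= L) (L2 : L <= 2^-1) (c0 : 0 <= c) (c1 : c <= 1).

(** Approximates the displacement, not the position, of the solution starting from [s]. The
    coefficient [c] will be 1 if the coordinate being moved is also the one being read, and 0
    otherwise. *)
Fixpoint picard (n : nat) (s t : R) : R :=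
  if n is m.+1 then prim (fun r => f (s + c * picard m s r)) (clamp01 t) else 0.

Let picardS n s t : picard n.+1 s t = prim (fun r => f (s + c * picard n s r)) (clamp01 t).
Proof. by []. Qed.

(** The fixed point of [m = |f s| + m / 2], hence a bound preserved by the iteration. *)
Let M (s : R) : R := 2 * `|f s|.

Let Lc (a b : R) (x y : R) :
  `|f (a + c * x) - f (b + c * y)| <= 2^-1 * (`|a - b| + `|x - y|).
Proof.
apply: (le_trans (fL _ _)); apply: ler_pM => //.
rewrite opprD addrACA -mulrBr; apply: (le_trans (ler_normD _ _)).
by rewrite lerD2l normrM ger0_norm// ler_piMl.
Qed.

Let Lc0 s x : `|x| <= M s -> `|f (s + c * x)| <= M s.
Proof.
move=> xM; have := Lc s s x 0; rewrite mulr0 addr0 subrr normr0 add0r subr0 => h.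
have := ler_normD (f (s + c * x) - f s) (f s); rewrite subrK => h2.
by rewrite /M in xM *; have := normr_ge0 x; lra.
Qed.

Let cont (v : R -> R) s : continuous v -> continuous (fun r => f (s + c * v r)).
Proof.
move=> cv x; apply: (@continuous_comp _ _ _ (fun r => s + c * v r) f).
  by apply: cvgD; [exact: cvg_cst|apply: cvgM; [exact: cvg_cst|exact: cv]].
exact: (lipschitz_cont fL).
Qed.

Let picard_inv n s : (forall t t', `|picard n s t - picard n s t'| <= M s * `|t - t'|) /\
  (forall t, `|picard n s t| <= M s).
Proof.
have M0 : 0 <= M s by rewrite mulr_ge0.
elim: n => [|n [IH1 IH2]].
  by split=> [t t'|t] /=; rewrite ?subrr normr0 ?mulr_ge0.
have ch := @cont _ s (lipschitz_cont IH1).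
have lip t t' : `|picard n.+1 s t - picard n.+1 s t'| <= M s * `|clamp01 t - clamp01 t'|.
  wlog tt : t t' / t' <= t.
    move=> H; have [/H//|/ltW/H] := leP t' t.
    by rewrite distrC [X in _ -> _ <= _ * X]distrC.
  rewrite [X in _ <= _ * X]ger0_norm ?subr_ge0 ?clamp01_nd//=.
  apply: prim_lip => //; [exact: clamp01_ge0|exact: clamp01_nd|].
  by move=> r _; exact: Lc0.
split=> [t t'|t].
  by apply: (le_trans (lip _ _)); rewrite ler_wpM2l// clamp01_lip.
have := lip t 0; rewrite {2}/picard clamp01_id ?lexx ?ler01// prim0 !subr0.
move=> /le_trans; apply; rewrite ger0_norm ?clamp01_ge0//.
by rewrite ler_piMr// clamp01_le1.
Qed.

Let picard_cont n s : continuous (picard n s).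
Proof. exact: lipschitz_cont (picard_inv n s).1. Qed.

Let prim_sub1 (g1 g2 : R -> R) (t e : R) : continuous g1 -> continuous g2 ->
  (forall r, `|g1 r - g2 r| <= e) ->
  `|prim g1 (clamp01 t) - prim g2 (clamp01 t)| <= e.
Proof.
move=> h1 h2 he; apply: (le_trans (prim_sub _ h1 h2 (fun r _ => he r))).
  exact: clamp01_ge0.
by rewrite ler_piMr ?clamp01_le1// (le_trans _ (he 0)).
Qed.

Let picard_step n s t : `|picard n.+1 s t - picard n s t| <= M s / 2 ^+ n.
Proof.
elim: n t => [|n IH] t.
  by rewrite expr0 divr1 [picard 0 s t]/= subr0; exact: (picard_inv 1 s).2.
rewrite (picardS n.+1) (picardS n).
apply: (prim_sub1 t (@cont _ s (@picard_cont n.+1 s)) (@cont _ s (@picard_cont n s))) => r.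
apply: (le_trans (Lc _ _ _ _)); rewrite subrr normr0 add0r.
rewrite exprS invfM mulrCA ler_wpM2l ?invr_ge0//; exact: IH.
Qed.

Let picard_lip n s s' t : `|picard n s t - picard n s' t| <= `|s - s'|.
Proof.
elim: n t => [|n IH] t; first by rewrite /= subrr normr0.
rewrite (picardS n s) (picardS n s').
apply: (prim_sub1 t (@cont _ s (@picard_cont n s)) (@cont _ s' (@picard_cont n s'))) => r.
by apply: (le_trans (Lc _ _ _ _)); have := IH r; lra.
Qed.

Lemma le_geometric (a b K : R) : (forall n, a <= b + K / 2 ^+ n) -> a <= b.
Proof.
move=> h; apply/ler_addgt0Pr => e e0.
have [n ne] : exists n, K <= e * 2 ^+ n.
  exists (Num.bound (K / e)); rewrite -ler_pdivrMl// mulrC ltW//.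
  exact: upper_nthrootP.
by apply: (le_trans (h n)); rewrite lerD2l ler_pdivrMr// exprn_gt0.
Qed.

(** Everything passes to the limit of the Picard iterates. The last bound compares the flow with one
    explicit step: on unit time the field varies by at most [L] times the displacement. It makes
    composed commands add up to first order. *)
Lemma scalar_flow : exists u : R -> R -> R,
  [/\ forall s, u 0 s = 0,
      forall t t' s, `|u t s - u t' s| <= 2 * `|f s| * `|t - t'|,
      forall t s s', `|u t s - u t s'| <= `|s - s'|,
      forall t s : R, 0 < t < 1 -> is_derive t (1 : R) (u ^~ s) (f (s + c * u t s)) &
      forall s, `|u 1 s - f s| <= L * (2 * `|f s|)].
Proof.
have /choice[u0 u0P] : forall p : R * R, exists l, forall n,
    `|picard n p.2 p.1 - l| <= 2 * M p.2 / 2 ^+ n.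
  by move=> [t s]; apply: geometric_limit => n; exact: picard_step.
pose u t s := u0 (t, s).
have uP t s n : `|picard n s t - u t s| <= 2 * M s / 2 ^+ n by exact: (u0P (t, s)).
have u_lip t t' s : `|u t s - u t' s| <= 2 * `|f s| * `|t - t'|.
  apply: (@le_geometric _ _ (2 * (2 * M s))) => n.
  have := uP t s n; have := uP t' s n; have := (picard_inv n s).1 t t'.
  rewrite -[2 * (2 * M s) / _]mulrA -/(M s).
  set z := 2 * M s / _; rewrite !ler_norml; set q := M s * _; lra.
have u_cont s : continuous (u ^~ s) by apply: lipschitz_cont => a b; exact: u_lip.
have u_eq t s : u t s = prim (fun r => f (s + c * u r s)) (clamp01 t).
  apply/eqP; rewrite -subr_eq0 -normr_le0; apply: (@le_geometric _ _ (2 * (2 * M s))) => n.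
  rewrite add0r -[2 * (2 * M s) / _]mulrA.
  have h1 := uP t s n.+1.
  have h2 : `|picard n.+1 s t - prim (fun r => f (s + c * u r s)) (clamp01 t)| <= 2 * M s / 2 ^+ n.
    rewrite picardS; apply: (prim_sub1 t (@cont _ s (@picard_cont n s)) (@cont _ s (u_cont s))) => r.
    apply: (le_trans (Lc _ _ _ _)); rewrite subrr normr0 add0r.
    apply: (le_trans (ler_wpM2l _ (uP r s n))); first by rewrite invr_ge0.
    rewrite ler_piMl ?invf_le1// ?ler1n// divr_ge0 ?exprn_ge0// mulr_ge0//.
    by rewrite mulr_ge0.
  have h3 : 2 * M s / 2 ^+ n.+1 <= 2 * M s / 2 ^+ n.
    rewrite ler_wpM2l ?mulr_ge0// lef_pV2 ?posrE ?exprn_gt0//.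
    by rewrite exprS ler_peMl ?exprn_ge0// ler1n.
  move: h1 h2 h3; set p := prim _ _; set z := 2 * M s / 2 ^+ n; set z' := 2 * M s / _.
  by rewrite !ler_norml; lra.
have u0s s : u 0 s = 0 by rewrite u_eq clamp01_id ?lexx ?ler01// prim0.
exists u; split => //.
- move=> t s s'; apply: (@le_geometric _ _ (2 * M s + 2 * M s')) => n.
  have := uP t s n; have := uP t s' n; have := picard_lip n s s' t.
  rewrite (mulrDl (2 * M s) (2 * M s')); set z := 2 * M s / _; set z' := 2 * M s' / _.
  by rewrite !ler_norml; lra.
- move=> t s /andP[t0 t1].
  apply: (@near_eq_is_derive _ R R (prim (fun r => f (s + c * u r s)))).
    near=> r; rewrite u_eq clamp01_id//; apply/andP; split; apply: ltW; near: r.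
      exact: lt_nbhsr.
    exact: lt_nbhsl.
  by apply: prim_derive => //; apply: cont; exact: u_cont.
- move=> s; rewrite u_eq clamp01_id ?lexx ?ler01//.
  have fsE : prim (fun=> f s) 1 = f s.
    rewrite /prim; have -> : \int[mu]_(r in `[0, 1]) f s = f s * fine (mu `[0, 1]).
      exact: Rintegral_cst.
    by rewrite lebesgue_measure_itv/= lte_fin ltr01 -EFinB subr0 mulr1.
  rewrite -[X in `|_ - X|]fsE -[leRHS]mulr1; apply: prim_sub => //; first by apply: cont; exact: u_cont.
    by move=> x; exact: cvg_cst.
  move=> r /andP[r0 r1]; apply: (le_trans (fL _ _)).
  rewrite addrAC subrr add0r normrM (ger0_norm c0) ler_wpM2l//.
  have := u_lip r 0 s; rewrite u0s !subr0 => h.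
  apply: (@le_trans _ _ `|u r s|); first by rewrite ler_piMl.
  rewrite (ger0_norm r0) in h; apply: (le_trans h).
  by rewrite -[leRHS]mulr1; apply: ler_wpM2l => //; rewrite mulr_ge0.
Unshelve. all: by end_near. Qed.

End scalar_flow.

(** * Borel probabilities on R^d *)

Section cV_basics.
Context {R : realType}.
Local Notation cbox q r := [set x | forall i, `|x i ord0 - q i ord0| <= r].

Lemma ball_cV n (x y : 'cV[R]_n) e : 0 < e ->
  ball x e y <-> forall i, `|x i ord0 - y i ord0| < e.
Proof.
move=> e0; split=> [[_ xy] i|xy]; first exact: xy.
by split=> // i j; rewrite (ord1 j); exact: xy.
Qed.

Lemma norm_cV_le n (x : 'cV[R]_n) r : 0 <= r ->
  (forall i, `|x i ord0| <= r) -> `|x| <= r.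
Proof.
move=> r0 xr; rewrite [leLHS]mx_normrE; apply/bigmax_leP; split => // -[i j] _ /=.
by rewrite (ord1 j).
Qed.

Lemma coord_le_norm n (x : 'cV[R]_n) i : `|x i ord0| <= `|x|.
Proof.
rewrite [leRHS]mx_normrE; apply/bigmax_geP; right; by exists (i, ord0).
Qed.

Lemma compact_cube n (r : R) : compact [set x : 'cV[R]_n | forall i, `|x i ord0| <= r].
Proof.
have cA : compact [set x : 'rV[R]_n | forall i, `[- r, r]%classic (x ord0 i)].
  exact: (rV_compact (fun _ => @segment_compact R (- r) r)).
have -> : [set x : 'cV[R]_n | forall i, `|x i ord0| <= r] =
    trmx @` [set x : 'rV[R]_n | forall i, `[- r, r]%classic (x ord0 i)].
  apply/seteqP; split=> [x xr|_ [x xr <-] i].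
    exists x^T; last by rewrite trmxK.
    by move=> i; rewrite mxE /= in_itv/= -ler_norml xr.
  by rewrite mxE; have := xr i; rewrite /= in_itv/= -ler_norml.
apply: continuous_compact cA; apply: continuous_subspaceT.
apply/continuousP => A oA; apply: open_preimage_nonexpansive oA => p q e [e0 pq].
by split=> // i j; rewrite !mxE; exact: pq.
Qed.

(** Only [x] is confined to [K]: the near-covering form of compactness leaves [y] free to lie
    outside. *)
Lemma compact_uniform (T : pseudoMetricType R) (f : T -> R) (K : set T) (e : R) :
  compact K -> continuous f -> 0 < e ->
  exists2 dl, 0 < dl & forall x y, K x -> ball x dl y -> `|f x - f y| <= e.
Proof.
move=> /compact_near_coveringP cK cf e0.
have := cK R (0^'+) (fun dl x => forall y, ball x dl y -> `|f x - f y| <= e) _.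
case.
  move=> x Kx.
  have /cvgrPdist_le/(_ (e / 2)) : f y @[y --> x] --> f x by exact: cf.
  rewrite divr_gt0// => /(_ isT)/nbhs_ballP[d /= d0 dxy].
  exists (ball x (d / 2), [set r | 0 < r < d / 2]).
    split=> /=; first by apply: nbhsx_ballx; rewrite divr_gt0.
    near=> t; apply/andP; split; near: t; first exact: nbhs_right_gt.
    by apply: nbhs_right_lt; rewrite divr_gt0.
  move=> [x' r] /= [xx' /andP[r0 rd]] y x'y.
  have h1 := dxy x' (le_ball _ xx').
  have h2 : `|f x - f y| <= e / 2.
    apply: dxy; rewrite (splitr d); apply: ball_triangle xx' _.
    by apply: le_ball x'y; exact: ltW.
  have h1' : `|f x - f x'| <= e / 2 by apply: h1; rewrite ler_pdivrMr// ler_peMr ?ltW// ltr1n.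
  rewrite -(subrKA (f x)) (splitr e); apply: (le_trans (ler_normD _ _)).
  by rewrite lerD// distrC.
move=> d0 /= d00 H.
exists (d0 / 2); first by rewrite divr_gt0.
move=> x y Kx xy; apply: (H (d0 / 2) _ _ x Kx y xy) => /=.
  rewrite sub0r normrN gtr0_norm ?divr_gt0//.
  by rewrite ltr_pdivrMr// ltr_pMr// ltr1n.
by rewrite divr_gt0.
Unshelve. all: by end_near. Qed.

Lemma rational_cbox n (U : set 'cV[R]_n) x : open U -> U x ->
  exists (q : 'cV[rat]_n) (k : nat),
    [set y : 'cV[R]_n | forall i, `|y i ord0 - ratr (q i ord0)| <= k.+1%:R^-1] x /\
    [set y : 'cV[R]_n | forall i, `|y i ord0 - ratr (q i ord0)| <= k.+1%:R^-1] `<=` U.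
Proof.
move=> oU Ux; have /nbhs_ballP[e /= e0 eU] : nbhs x U by move: oU; rewrite openE; exact.
have [k ke] : exists k : nat, k.+1%:R^-1 < e / 2.
  have [|k] := @ltr_add_invr _ 0 (e / 2); first by rewrite divr_gt0.
  by rewrite add0r => ?; exists k.
have k0 : 0 < k.+1%:R^-1 :> R by rewrite invr_gt0.
have /choice[v pv] : forall i, exists q, ball (x i ord0) k.+1%:R^-1 (ratr q : R).
  by move=> i; exact: ball_rat.
exists (\col_i v i), k; split => [i|y yq] /=.
  by rewrite !mxE ltW//; exact: pv.
apply: eU; apply/ball_cV => // i; rewrite (splitr e).
rewrite -(subrKA (ratr (v i))); apply: (le_lt_trans (ler_normD _ _)).
rewrite ltr_leD//; first by apply: lt_trans ke; exact: pv.
by rewrite distrC; have := yq i; rewrite mxE => /le_trans; apply; exact: ltW.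
Qed.

Definition cV_box n (a b : 'I_n -> R) : set 'cV[R]_n :=
  [set x | forall i, a i <= x i ord0 <= b i].

Lemma measurable_cV_box n (a b : 'I_n -> R) : measurable (cV_box a b).
Proof.
rewrite (_ : cV_box a b = [set v | forall i, `[a i, b i]%classic (v i ord0)]).
  exact: (@measurable_box _ _ (fun i => `[a i, b i]%classic)).
by apply/seteqP; split=> x xab i; have := xab i; rewrite /= in_itv.
Qed.

(** An open set is the union of the countably many boxes with rational center and radius
    [1 / (k + 1)] that it contains. *)
Lemma measurable_cV_gen n : @measurable _ 'cV[R]_n =
  <<s [set A | exists a b, A = cV_box a b] >>.
Proof.
apply/seteqP; split; last first.
  apply: smallest_sub; first exact: sigma_algebra_measurable.
  by move=> _ [a [b ->]]; exact: measurable_cV_box.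
apply: smallest_sub; first exact: smallest_sigma_algebra.
move=> O oO.
pose B (i : 'cV[rat]_n * nat) := [set y : 'cV[R]_n |
  forall j, `|y j ord0 - ratr (i.1 j ord0)| <= i.2.+1%:R^-1].
have -> : O = \bigcup_i (if `[< B i `<=` O >] then B i else set0).
  apply/seteqP; split=> [x Ox|x [i _]]; last by case: asboolP => [sub|_] //; exact: sub.
  have [q [k [xB BO]]] := rational_cbox oO Ox.
  by exists (q, k) => //; case: asboolP.
apply: (@countable_bigcupT_measurable _ (g_sigma_algebraType [set A : set 'cV[R]_n | exists a b, A = cV_box a b])).
  exact: countableP.
move=> i; case: asboolP => // _; apply: sub_sigma_algebra.
exists (fun j => ratr (i.1 j ord0) - i.2.+1%:R^-1), (fun j => ratr (i.1 j ord0) + i.2.+1%:R^-1).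
by apply/seteqP; split=> x xB j; have := xB j; rewrite ler_distl.
Qed.

Lemma probability_cV_unique n (m1 m2 : probability 'cV[R]_n R) :
  (forall a b, m1 (cV_box a b) = m2 (cV_box a b)) ->
  forall A, measurable A -> m1 A = m2 A.
Proof.
move=> m12 A mA.
apply: (measure_unique [set A | exists a b, A = cV_box a b]
  (fun k => cV_box (fun _ : 'I_n => - k%:R) (fun _ => k%:R))) => //.
- exact: measurable_cV_gen.
- move=> _ _ [a [b ->]] [a' [b' ->]].
  exists (fun i => Num.max (a i) (a' i)), (fun i => Num.min (b i) (b' i)).
  apply/seteqP; split=> [x [h1 h2] i|x h].
    rewrite ge_max le_min.
    by move: (h1 i) (h2 i) => /andP[-> ->] /andP[-> ->].
  by split=> i; have := h i; rewrite ge_max le_min => /andP[/andP[? ?] /andP[? ?]]; apply/andP.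
- by move=> k; exists (fun=> - k%:R), (fun=> k%:R).
- apply/seteqP; split => // x _; exists (Num.truncn `|x|).+1 => // i.
  rewrite -ler_norml (le_trans (coord_le_norm _ _))// ltW//.
  exact: truncnS_gt.
- by move=> _ [a [b ->]]; exact: m12.
- by move=> k; rewrite (le_lt_trans (probability_le1 _ _)) ?ltry//; exact: measurable_cV_box.
Qed.

(** A point off the support has a null open neighbourhood, hence lies in a null rational box, and
    there are countably many of these. *)
Lemma measure_support_full n (m : probability 'cV[R]_n R) :
  m.-negligible (~` measure_support m).
Proof.
pose B (i : 'cV[rat]_n * nat) := [set y : 'cV[R]_n |
  forall j, `|y j ord0 - ratr (i.1 j ord0)| <= i.2.+1%:R^-1].
have mB i : measurable (B i).
  rewrite (_ : B i = cV_box (fun j => ratr (i.1 j ord0) - i.2.+1%:R^-1) (fun j => ratr (i.1 j ord0) + i.2.+1%:R^-1)).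
    exact: measurable_cV_box.
  by apply/seteqP; split=> x xB j; have := xB j; rewrite ler_distl.
apply: (@negligibleS _ _ _ _ (\bigcup_(k : nat) if unpickle k is Some i then
    if `[< m (B i) = 0%E >] then B i else set0 else set0)).
  move=> x; rewrite /measure_support/= => /existsNP[U /not_implyP[[oU Ux] /negP]].
  rewrite -leNgt => mU0.
  have [q [k [xB BU]]] := rational_cbox oU Ux.
  exists (pickle (q, k)) => //; rewrite pickleK; case: asboolP => //= -[].
  apply/eqP; rewrite eq_le measure_ge0 andbT (le_trans _ mU0)// le_measure// inE.
    exact: (mB (q, k)).
  exact: open_measurable_mx.
apply: negligible_bigcup => k.
case: (unpickle k) => [i|]; last exact: negligible_set0.
case: asboolP => [m0|_]; last exact: negligible_set0.
by apply/negligibleP.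
Qed.

(** A hyperplane is a box with one side [{c}] and the whole line for the others, so its Lebesgue
    measure is a product with a zero factor. *)
Lemma hyperplane_null n (m : probability 'cV[R]_n R) (i : 'I_n) (c : R) :
  m `<< lebesgue_cV R n -> m [set x | x i ord0 = c] = 0%E.
Proof.
move=> /null_content_dominatesP; apply.
  have := @measurable_coord R n 1 i ord0 measurableT [set c] (measurable_set1 c).
  by rewrite setTI.
pose A (j : 'I_n) := if j == i then [set c] else [set: R].
rewrite (_ : [set x | _] = [set v | forall j, A j (v j ord0)]); last first.
  apply/seteqP; split=> x /=; rewrite /A; last by move=> /(_ i); rewrite eqxx.
  by move=> xc j; case: eqP => // ->.
have mA j : measurable (A j) by rewrite /A; case: ifP.
apply: (etrans (lebesgue_cV_box mA)).
by rewrite (bigD1 i)//= {1}/A eqxx lebesgue_measure_set1 mul0e.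
Qed.

Lemma measurable_cV_continuous n (f : 'cV[R]_n -> R) : continuous f ->
  measurable_fun setT f.
Proof.
move=> cf; apply: (measurability _ (RGenOInfty.measurableE R)) => _ [_ [a ->] <-].
rewrite setTI; apply: open_measurable_mx.
by apply: open_comp; [move=> + _; exact: cf|exact: interval_open].
Qed.

Lemma measurable_cV_map n (d : measure_display) (T : measurableType d) (X : T -> 'cV[R]_n) :
  (forall i, measurable_fun setT (fun x => X x i ord0)) -> measurable_fun setT X.
Proof.
move=> mX; rewrite /measurable_fun => _ A.
rewrite measurable_cV_gen => mA; rewrite setTI.
suff : <<s [set A | exists a b, A = @cV_box n a b] >> `<=` [set A | measurable (X @^-1` A)].
  by move=> /(_ _ mA).
apply: smallest_sub.
  split => /=.
  - by rewrite preimage_set0.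
  - by move=> B mB; rewrite setTD preimage_setC; exact: measurableC.
  - by move=> F mF; rewrite preimage_bigcup; exact: bigcup_measurable.
move=> _ [a [b ->]] /=.
rewrite (_ : _ @^-1` _ = \bigcap_i ((fun x => X x i ord0) @^-1` `[a i, b i]%classic)).
  apply: fin_bigcap_measurable => // i _; rewrite -[X in measurable X]setTI.
  by apply: mX.
by apply/seteqP; split => x /= h i => [_|]; have := h i; rewrite /= in_itv//; apply.
Qed.

End cV_basics.

Definition cube {R : realType} {n : nat} (r : R) : set 'cV[R]_n :=
  [set x | forall i, `|x i ord0| <= r].

Lemma measurable_cube {R : realType} {n : nat} (r : R) : measurable (@cube R n r).
Proof.
rewrite (_ : cube r = cV_box (fun=> - r) (fun=> r)); first exact: measurable_cV_box.
by apply/seteqP; split=> x /= h k; have := h k; rewrite ler_norml.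
Qed.

Section probability_integrals.
Context {R : realType} {d : measure_display} {T : measurableType d}.
Implicit Types (m : probability T R) (f g : T -> R).

Lemma bounded_integrable m f (M : R) : measurable_fun setT f ->
  (forall x, `|f x| <= M) -> m.-integrable setT (EFin \o f).
Proof.
move=> mf fM; apply: measurable_bounded_integrable => //.
  by apply: le_lt_trans (probability_le1 m measurableT) _; exact: ltry.
by exists M; split; [exact: num_real|move=> K MK x _; exact: (le_trans (fM x) (ltW MK))].
Qed.

Lemma EFin_Rintegral m f : m.-integrable setT (EFin \o f) ->
  (\int[m]_x (f x)%:E = (\int[m]_x f x)%:E)%E.
Proof. by move=> intf; rewrite fineK//; exact: integrable_fin_num. Qed.

Lemma Rintegral_prob_bound m f (M : R) : m.-integrable setT (EFin \o f) ->
  (forall x, `|f x| <= M) -> `|\int[m]_x f x| <= M.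
Proof.
move=> intf fM; apply: (le_trans (le_normr_Rintegral _ _)) => //.
apply: (@le_trans _ _ (\int[m]_x cst M x)).
  apply: le_Rintegral => //.
    have /integrable_abse := intf; exact.
  by apply: (@bounded_integrable m (cst M) `|M|) => //.
have -> : \int[m]_x cst M x = M * fine (m setT) by exact: Rintegral_cst.
by rewrite probability_setT mulr1.
Qed.

End probability_integrals.

Section cube_vanishing.
Context {R : realType} {n : nat}.
Implicit Types (f : 'cV[R]_n -> R).

Lemma vanishing_bounded f (r : R) : continuous f ->
  (forall x, ~ cube r x -> f x = 0) -> exists2 M, 0 <= M & forall x, `|f x| <= M.
Proof.
move=> cf f0.
have cn : continuous (fun x => `|f x|).
  by move=> x; apply: continuous_comp; [exact: cf|exact: norm_continuous].
have [[x0 Cx0]|/forallNP C0] := pselect (exists x, @cube R n r x); last first.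
  by exists 0 => // x; rewrite f0 ?normr0//; exact: C0.
have [c _ cM] := compact_EVT_max (ex_intro _ x0 Cx0) (@compact_cube R n r) (continuous_subspaceT cn).
exists `|f c| => // x.
have [xC|xC] := pselect (cube r x); first by apply: cM; rewrite inE.
by rewrite f0// normr0.
Qed.

Lemma vanishing_integrable (m : probability 'cV[R]_n R) f (r : R) : continuous f ->
  (forall x, ~ cube r x -> f x = 0) -> m.-integrable setT (EFin \o f).
Proof.
move=> cf f0; have [M _ fM] := vanishing_bounded cf f0.
by apply: bounded_integrable fM; exact: measurable_cV_continuous.
Qed.

End cube_vanishing.

(** * Smooth bumps determine a probability *)

Section bump.
Context {R : realType} {d : nat}.

Definition bump1 (a b : R) (k : nat) (s : R) : R :=
  smooth_step (k%:R * (s - b)) * smooth_step (k%:R * (a - s)).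

Definition bump (a b : 'I_d -> R) (k : nat) (x : 'cV[R]_d) : R :=
  \prod_i bump1 (a i) (b i) k (x i ord0).

Lemma smooth_coord i : smooth (fun x : 'cV[R]_d => x i ord0).
Proof.
have @h : {linear 'cV[R]_d -> R}.
  by exists (fun N : 'cV[R]_d => N i ord0); do 2![eexists]; do ?[constructor];
   rewrite ?mxE// => ? *; rewrite ?mxE//; move=> ?; rewrite !mxE.
by apply: (@smooth_linear _ _ h); exact: coord_continuous.
Qed.

Lemma smooth_bump1 a b k : smooth (bump1 a b k).
Proof.
apply: smooth_mul; apply: (smooth_comp smooth_step_smooth).
  apply: smooth_mul; first exact: smooth_cst.
  by apply: smooth_sub; [exact: smooth_id|exact: smooth_cst].
apply: smooth_mul; first exact: smooth_cst.
by apply: smooth_sub; [exact: smooth_cst|exact: smooth_id].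
Qed.

Lemma smooth_bump a b k : smooth (bump a b k).
Proof.
by apply: smooth_prod => i; apply: (smooth_comp (smooth_bump1 _ _ _)); exact: smooth_coord.
Qed.

Lemma bump1_ge0 a b k s : 0 <= bump1 a b k s.
Proof. by rewrite mulr_ge0 ?smooth_step_ge0. Qed.

Lemma bump1_le1 a b k s : bump1 a b k s <= 1.
Proof. by rewrite mulr_ile1 ?smooth_step_ge0 ?smooth_step_le1. Qed.

Lemma bump_bound a b k x : `|bump a b k x| <= 1.
Proof.
rewrite ger0_norm; last by apply: prodr_ge0 => i _; exact: bump1_ge0.
rewrite -[leRHS](@expr1n _ d); apply: (@le_trans _ _ (\prod_(i < d) 1)).
  by apply: ler_prod => i _; rewrite bump1_ge0 bump1_le1.
by rewrite big1// expr1n.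
Qed.

Lemma bump_in a b k x : cV_box a b x -> bump a b k x = 1.
Proof.
move=> xab; rewrite /bump big1// => i _; have /andP[h1 h2] := xab i.
rewrite /bump1 !smooth_step_le0 ?mulr1//.
  by rewrite mulr_ge0_le0// subr_le0.
by rewrite mulr_ge0_le0// subr_le0.
Qed.

Lemma bump1_out a b k s : 1 <= k%:R * (s - b) \/ 1 <= k%:R * (a - s) -> bump1 a b k s = 0.
Proof. by rewrite /bump1; move=> [/smooth_step_ge1 ->|/smooth_step_ge1 ->]; rewrite ?mul0r ?mulr0. Qed.

Lemma bump_out a b x : ~ cV_box a b x -> \forall k \near \oo, bump a b k x = 0.
Proof.
move=> /existsNP[i /negP]; rewrite negb_and -!ltNge => xab.
have [e e0 he] : exists2 e : R, 0 < e & e <= x i ord0 - b i \/ e <= a i - x i ord0.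
  case/orP : xab => h.
    by exists (a i - x i ord0); [rewrite subr_gt0|right].
  by exists (x i ord0 - b i); [rewrite subr_gt0|left].
near=> k; rewrite /bump (bigD1 i)//= bump1_out ?mul0r//.
have ke : 1 <= k%:R * e.
  rewrite -ler_pdivrMr// mul1r; near: k; exact: nbhs_infty_ger.
by case: he => he; [left|right]; apply: (le_trans ke); apply: ler_wpM2l.
Unshelve. all: by end_near. Qed.

Lemma bump_cube a b k x r : (0 < k)%N -> (forall i, `|a i| + 1 <= r) -> (forall i, `|b i| + 1 <= r) ->
  ~ cube r x -> bump a b k x = 0.
Proof.
move=> k0 ar br /existsNP[i /negP]; rewrite -ltNge => rx.
rewrite /bump (bigD1 i)//= bump1_out ?mul0r//.
have k1 : 1 <= k%:R :> R by rewrite ler1n.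
have := ar i; have := br i; have := ler_norm (b i) => h1 h2 h3.
have h4 := ler_norm (- a i); rewrite normrN in h4.
have [x0|x0] := leP 0 (x i ord0).
  left; rewrite ger0_norm// in rx; apply: mulr_ege1 => //; lra.
right; rewrite ltr0_norm// in rx; apply: mulr_ege1 => //; lra.
Qed.

(** Steeper and steeper bumps converge pointwise to the indicator of a box; by dominated convergence
    the measures agree on boxes, a generating pi-system. *)
Lemma probability_bump_unique (m1 m2 : probability 'cV[R]_d R) :
  (forall psi r, smooth psi -> (forall x, ~ cube r x -> psi x = 0) ->
    \int[m1]_x psi x = \int[m2]_x psi x) ->
  forall A, measurable A -> m1 A = m2 A.
Proof.
move=> m12; apply: probability_cV_unique => a b.
have lim (m : probability 'cV[R]_d R) :
    (\int[m]_x (bump a b k.+1 x)%:E)%E @[k --> \oo] --> m (cV_box a b).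
  have mb := measurable_cV_box a b.
  have [] // := @dominated_convergence _ 'cV[R]_d R m setT measurableT
    (fun k x => (bump a b k.+1 x)%:E) (fun x => (\1_(cV_box a b) x)%:E) (cst 1%E).
  - by move=> k; apply/measurable_EFinP; apply: measurable_cV_continuous;
      exact/smooth_continuous/smooth_bump.
  - by apply/measurable_EFinP.
  - apply: aeW => x _; apply: cvg_near_cst.
    have [xab|xab] := pselect (cV_box a b x).
      by near=> k; rewrite bump_in// indicE mem_set.
    have := bump_out xab => h.
    rewrite indicE memNset//=; near=> k; rewrite (_ : bump _ _ _ _ = 0)//.
    near: k; have [N _ hN] := h; exists N => // k /= Nk; apply: hN => /=.
    exact: leq_trans Nk _.
  - by apply: (@bounded_integrable _ _ _ m (cst 1) 1) => // x; rewrite normr1.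
  - by apply: aeW => x k _; rewrite lee_fin bump_bound.
  by move=> _ _; rewrite integral_indic// setIT.
have h1 := lim m1; have h2 := lim m2.
suff e : (fun k => \int[m1]_x (bump a b k.+1 x)%:E)%E = (fun k => \int[m2]_x (bump a b k.+1 x)%:E)%E.
  by rewrite e in h1; exact: cvg_unique h1 h2.
apply/funext => k.
(* The index [k.+1] is positive, so every bump lives within distance 1 of the box, hence in the cube
   of radius [r]. *)
pose r := \sum_i (`|a i| + `|b i| + 1) : R.
have rP i : `|a i| + `|b i| + 1 <= r.
  by rewrite /r (bigD1 i)//= lerDl sumr_ge0// => j _; rewrite !addr_ge0.
have bv x : ~ cube r x -> bump a b k.+1 x = 0.
  apply: bump_cube => // i; apply: le_trans (rP i).
    by have := normr_ge0 (b i); lra.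
  by have := normr_ge0 (a i); lra.
have cb : continuous (bump a b k.+1) by exact/smooth_continuous/smooth_bump.
rewrite !EFin_Rintegral; [|exact: vanishing_integrable cb bv..].
by congr EFin; apply: m12 bv; exact: smooth_bump.
Unshelve. all: by end_near. Qed.

End bump.

(** * Wasserstein distance *)

Section wasserstein_lemmas.
Context {R : realType} {d : nat}.
Implicit Types (mu nu : probability 'cV[R]_d R).

Lemma compact_bounded_fun (T : topologicalType) (K : set T) (f : T -> R) :
  compact K -> continuous f -> exists2 M, 0 <= M & forall x, K x -> `|f x| <= M.
Proof.
move=> cK cf.
have cn : continuous (fun x => `|f x|).
  by move=> x; apply: continuous_comp; [exact: cf|exact: norm_continuous].
have [[x0 Kx0]|/forallNP K0] := pselect (exists x : T, K x); last first.
  by exists 0 => // x /K0.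
have [c _ cM] := compact_EVT_max (ex_intro _ x0 Kx0) cK (continuous_subspaceT cn).
by exists `|f c| => // x Kx; apply: cM; rewrite inE.
Qed.

Lemma continuous_pairl (U V : topologicalType) (s : U) :
  continuous (fun x : V => (s, x)).
Proof.
move=> x; exact: (@cvg_pair V U V (nbhs x) (nbhs s) (nbhs x) _ _ _ (fun=> s) id
  (cvg_cst _) cvg_id).
Qed.

Lemma enorm_sq (x : 'cV[R]_d) : enorm x ^+ 2 = \sum_i x i ord0 ^+ 2.
Proof. by rewrite /enorm sqr_sqrtr// sumr_ge0// => i _; exact: sqr_ge0. Qed.

Lemma enorm_sq_le (x : 'cV[R]_d) M : (forall i, `|x i ord0| <= M) ->
  enorm x ^+ 2 <= d%:R * M ^+ 2.
Proof.
move=> xM; rewrite enorm_sq -[X in X%:R](card_ord d) mulr_natl -sumr_const.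
by apply: ler_sum => i _; rewrite -real_normK ?num_real// ler_sqr ?nnegrE// (le_trans _ (xM i)).
Qed.

Lemma enorm_sq_coord (x : 'cV[R]_d) i : x i ord0 ^+ 2 <= enorm x ^+ 2.
Proof.
by rewrite enorm_sq (bigD1 i)//= lerDl sumr_ge0// => j _; exact: sqr_ge0.
Qed.

Lemma measurable_enorm_sq (e : measure_display) (T : measurableType e) (X : T -> 'cV[R]_d) :
  measurable_fun setT X -> measurable_fun setT (fun z => enorm (X z) ^+ 2).
Proof.
move=> mX; rewrite (_ : (fun _ => _) = fun z => \sum_i X z i ord0 ^+ 2); last first.
  by apply/funext => z; rewrite enorm_sq.
apply: measurable_sum => i; apply: measurable_funX.
exact: (measurableT_comp (measurable_coord i ord0) mX).
Qed.

Lemma measurable_cV_sub (e : measure_display) (T : measurableType e) (X Y : T -> 'cV[R]_d) :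
  measurable_fun setT X -> measurable_fun setT Y -> measurable_fun setT (fun z => X z - Y z).
Proof.
move=> mX mY; apply: measurable_cV_map => i.
rewrite (_ : (fun _ => _) = fun z => X z i ord0 - Y z i ord0); last first.
  by apply/funext => z; rewrite !mxE.
apply: measurable_funB.
  exact: (measurableT_comp (measurable_coord i ord0) mX).
exact: (measurableT_comp (measurable_coord i ord0) mY).
Qed.

Lemma measurable_cost : measurable_fun setT
  (fun z : 'cV[R]_d * 'cV[R]_d => enorm (z.1 - z.2) ^+ 2).
Proof. by apply: measurable_enorm_sq; apply: measurable_cV_sub. Qed.

Lemma sqrt_poweR (x : \bar R) (k : R) : 0 < k -> (0 <= x)%E ->
  (x `^ (2^-1)%R < k%:E)%E -> (x < (k ^+ 2)%:E)%E.
Proof.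
move=> k0; case: x => [x| |]//; last by rewrite poweRyr.
rewrite lee_fin poweR_EFin !lte_fin => x0; rewrite powR12_sqrt//.
by move=> h; rewrite -[x]sqr_sqrtr// ltr_sqr ?nnegrE ?sqrtr_ge0// ltW.
Qed.

Lemma W2_coupling mu nu k : 0 < k -> (W2 mu nu < k%:E)%E ->
  exists2 g, couplings mu nu g &
    (\int[g]_z (enorm (z.1 - z.2) ^+ 2)%:E < (k ^+ 2)%:E)%E.
Proof.
move=> k0 /ereal_inf_lt[_ [g cg <-] gk]; exists g => //.
by apply: sqrt_poweR => //; apply: integral_ge0 => z _; rewrite lee_fin sqr_ge0.
Qed.

Lemma coupling_W2 mu nu g (k : R) : 0 <= k -> couplings mu nu g ->
  (\int[g]_z (enorm (z.1 - z.2) ^+ 2)%:E <= (k ^+ 2)%:E)%E -> (W2 mu nu <= k%:E)%E.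
Proof.
move=> k0 cg gk; apply: (@le_trans _ _ ((\int[g]_z (enorm (z.1 - z.2) ^+ 2)%:E) `^ (2^-1)%R)%E).
  by apply: ereal_inf_lbound; exists g.
have i0 : (0 <= \int[g]_z (enorm (z.1 - z.2) ^+ 2)%:E)%E.
  by apply: integral_ge0 => z _; rewrite lee_fin sqr_ge0.
move: gk i0; case: (\int[g]_z _)%E => [x| |]//.
rewrite !lee_fin => xk x0.
by rewrite powR12_sqrt// -[k]ger0_norm// -sqrtr_sqr ler_wsqrtr.
Qed.

Lemma W2_ge0 mu nu : (0 <= W2 mu nu)%E.
Proof. by apply: le_ereal_inf_tmp => _ [g _ <-]; exact: poweR_ge0. Qed.

Lemma coupling_integral_fst mu nu g (f : 'cV[R]_d -> R) (M : R) : couplings mu nu g ->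
  measurable_fun setT f -> (forall x, `|f x| <= M) ->
  \int[g]_z f z.1 = \int[mu]_x f x.
Proof.
move=> [g1 _] mf fM.
have mf1 : measurable_fun setT (fun z : 'cV[R]_d * 'cV[R]_d => f z.1).
  exact: measurableT_comp.
rewrite /Rintegral; congr fine.
transitivity (\int[pushforward g fst]_x (f x)%:E)%E.
  rewrite integral_pushforward//; first exact/measurable_EFinP.
  exact: (@bounded_integrable _ _ _ g (fun z => f z.1) M mf1 (fun z => fM z.1)).
by apply: eq_measure_integral => A mA _; exact: g1.
Qed.

Lemma coupling_integral_snd mu nu g (f : 'cV[R]_d -> R) (M : R) : couplings mu nu g ->
  measurable_fun setT f -> (forall x, `|f x| <= M) ->
  \int[g]_z f z.2 = \int[nu]_x f x.
Proof.
move=> [_ g2] mf fM.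
have mf2 : measurable_fun setT (fun z : 'cV[R]_d * 'cV[R]_d => f z.2).
  exact: measurableT_comp.
rewrite /Rintegral; congr fine.
transitivity (\int[pushforward g snd]_x (f x)%:E)%E.
  rewrite integral_pushforward//; first exact/measurable_EFinP.
  exact: (@bounded_integrable _ _ _ g (fun z => f z.2) M mf2 (fun z => fM z.2)).
by apply: eq_measure_integral => A mA _; exact: g2.
Qed.

(* A uniformly continuous bounded observable differs at two points by at most *)
(* e plus a multiple of the squared distance; integrate against a coupling. *)
Lemma narrow_eps (T : R) (mu : R -> probability 'cV[R]_d R) (z : R * 'cV[R]_d -> R) r t e :
  W2_continuous T mu -> continuous z ->
  (forall s x, s \in `[0, T] -> ~ cube r x -> z (s, x) = 0) -> t \in `[0, T] -> 0 < e ->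
  exists2 dl, 0 < dl & forall s, s \in `[0, T] -> `|s - t| < dl ->
   `|\int[mu s]_x z (s, x) - \int[mu t]_x z (t, x)| <= e.
Proof.
move=> cmu cz z0 tT e0.
have cK : compact (`[0, T]%classic `*` @cube R d r).
  by apply: compact_setX; [exact: segment_compact|exact: compact_cube].
have e20 : 0 < e / 2 by rewrite divr_gt0.
have [dl dl0 zdl] := compact_uniform cK cz e20.
have [M M0 zM] := compact_bounded_fun cK cz.
have zM' s x : s \in `[0, T] -> `|z (s, x)| <= M.
  move=> sT; have [xr|xr] := pselect (cube r x); first exact: zM.
  by rewrite z0// normr0.
have cs s : continuous (fun x => z (s, x)).
  move=> x; apply: (@continuous_comp _ _ _ (fun x => (s, x)) z); last exact: cz.
  exact: continuous_pairl.
(* If some coordinates differ by at least [dl], the squared distance is at least [dl ^ 2], and [C]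
   times it is at least the trivial bound [2 * M]. *)
pose C := 2 * M / dl ^+ 2.
have C0 : 0 <= C by apply: divr_ge0; [apply: mulr_ge0|exact: sqr_ge0].
have zxy s x y : s \in `[0, T] -> `|s - t| < dl ->
    `|z (s, x) - z (t, y)| <= e / 2 + C * enorm (x - y) ^+ 2.
  move=> sT st.
  have C1 : 0 <= C * enorm (x - y) ^+ 2 by rewrite mulr_ge0 ?sqr_ge0.
  have [xy|] := pselect (forall i, `|x i ord0 - y i ord0| < dl).
    apply: (@le_trans _ _ (e / 2)); last by rewrite lerDl.
    have [xr|xr] := pselect (cube r x).
      apply: zdl => //; split => //=.
      exact/ball_cV.
    have [yr|yr] := pselect (cube r y).
      rewrite distrC; apply: zdl => //; split => /=; first by rewrite /ball/= distrC.
      by apply/ball_cV => // i; rewrite distrC.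
    by rewrite !z0// subrr normr0 ltW.
  move=> /existsNP[i /negP]; rewrite -leNgt => dlxy.
  apply: (@le_trans _ _ (C * enorm (x - y) ^+ 2)); last by rewrite lerDr ltW.
  apply: (le_trans (ler_normB _ _)).
  apply: (@le_trans _ _ (2 * M)).
    by rewrite mulr_natl mulr2n lerD// zM'.
  rewrite /C mulrAC ler_pdivlMr ?exprn_gt0//; apply: ler_wpM2l; first by rewrite mulr_ge0.
  apply: (le_trans _ (enorm_sq_coord _ i)); rewrite !mxE.
  by rewrite -[leRHS]real_normK ?num_real// ler_sqr ?nnegrE// ltW.
have [k k0 Ck] : exists2 k, 0 < k & C * k ^+ 2 <= e / 2.
  have h0 : 0 < e / 2 / (C + 1) by rewrite divr_gt0// ltr_wpDl.
  exists (Num.sqrt (e / 2 / (C + 1))); first by rewrite sqrtr_gt0.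
  rewrite (sqr_sqrtr (ltW h0)) mulrA ler_pdivrMr; last by rewrite ltr_wpDl.
  by rewrite mulrC; apply: ler_wpM2l; [exact: ltW|rewrite lerDl].
have [d' d'0 Wd'] : exists2 d', 0 < d' & forall s, s \in `[0, T] -> `|s - t| < d' ->
    (W2 (mu s) (mu t) < k%:E)%E.
  have /(_ [set y | (y < k%:E)%E]) := cmu t tT.
  have nk : nbhs (0%E : \bar R) [set y | (y < k%:E)%E].
    by apply: open_nbhs_nbhs; split; [exact: open_ereal_lt_ereal|rewrite /= lte_fin].
  move=> /(_ nk); rewrite near_simpl => /nbhs_ballP[d' /= d'0 Hd'].
  exists d' => // s sT st; apply: Hd' => //=.
  by rewrite /ball/= distrC.
exists (Num.min dl d') => [|s sT]; first by rewrite lt_min dl0.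
rewrite lt_min => /andP[sdl sd'].
have [g cg gk] := W2_coupling k0 (Wd' s sT sd').
have mzs s' : measurable_fun setT (fun x : 'cV[R]_d => z (s', x)).
  exact: measurable_cV_continuous.
rewrite -(coupling_integral_fst cg (mzs s) (fun x => zM' s x sT)).
rewrite -(coupling_integral_snd cg (mzs t) (fun x => zM' t x tT)).
have m1 : measurable_fun setT (fun w : 'cV[R]_d * 'cV[R]_d => z (s, w.1)).
  exact: (measurableT_comp (mzs s)).
have m2 : measurable_fun setT (fun w : 'cV[R]_d * 'cV[R]_d => z (t, w.2)).
  exact: (measurableT_comp (mzs t)).
have i1 : g.-integrable setT (EFin \o (fun w => z (s, w.1))).
  by apply: bounded_integrable m1 _ => w; exact: zM'.
have i2 : g.-integrable setT (EFin \o (fun w => z (t, w.2))).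
  by apply: bounded_integrable m2 _ => w; exact: zM'.
rewrite -RintegralB//.
have i12 := integrableB measurableT i1 i2.
apply: (le_trans (le_normr_Rintegral _ _)) => //.
have icost : g.-integrable setT (EFin \o (fun w => enorm (w.1 - w.2) ^+ 2)).
  apply/integrableP; split; first by apply/measurable_EFinP; exact: measurable_cost.
  under eq_integral do rewrite gee0_abs ?lee_fin ?sqr_ge0//.
  by apply: lt_trans gk _; exact: ltry.
have icst : g.-integrable setT (EFin \o (fun=> e / 2)).
  by apply: (@bounded_integrable _ _ _ g (cst (e / 2)) (e / 2)) => // w; rewrite ger0_norm ?lexx // ltW.
have iC : g.-integrable setT (EFin \o (fun w => C * enorm (w.1 - w.2) ^+ 2)).
  by have := integrableZl measurableT C icost.
apply: (@le_trans _ _ (\int[g]_w (e / 2 + C * enorm (w.1 - w.2) ^+ 2))).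
  apply: le_Rintegral => //; first exact: integrable_abse i12.
    exact: integrableD icst iC.
  by move=> w _; exact: zxy.
rewrite RintegralD// [X in _ + X <= _]RintegralZl//.
have -> : \int[g]_w (fun=> e / 2) w = e / 2 * fine (g setT) by exact: Rintegral_cst.
rewrite probability_setT mulr1 [leRHS]splitr lerD2l; apply: le_trans Ck.
apply: ler_wpM2l => //; rewrite -lee_fin -EFin_Rintegral//.
exact: ltW.
Qed.

(** Curves of measures are controlled on [0, T] only; clamped time extends their integrals
    continuously to the line, which avoids one-sided statements in the calculus below. *)
Definition clampT (T t : R) : R := Num.max 0 (Num.min t T).

Lemma clampT_itv T t : 0 < T -> clampT T t \in `[0, T].
Proof.
by move=> T0; rewrite in_itv/= le_max lexx/= ge_max (ltW T0)/= ge_min lexx orbT.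
Qed.

Lemma clampT_id T t : t \in `[0, T] -> clampT T t = t.
Proof. by rewrite in_itv/= => /andP[t0 t1]; rewrite /clampT min_l// max_r. Qed.

Lemma clampT_lip T a b : 0 < T -> `|clampT T a - clampT T b| <= `|a - b|.
Proof.
move=> T0; wlog ab : a b / a <= b.
  move=> H; have [/H//|/ltW/H] := leP a b.
  by rewrite distrC [leRHS]distrC.
rewrite distrC [leRHS]distrC (@ger0_norm _ (b - a)) ?subr_ge0//.
by rewrite /clampT /Num.max /Num.min; do ?case: ifPn; rewrite ler_norml; lra.
Qed.

Lemma narrow_continuous (T : R) (mu : R -> probability 'cV[R]_d R) (z : R * 'cV[R]_d -> R) r :
  0 < T -> W2_continuous T mu -> continuous z ->
  (forall s x, s \in `[0, T] -> ~ cube r x -> z (s, x) = 0) ->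
  continuous (fun t => \int[mu (clampT T t)]_x z (clampT T t, x)).
Proof.
move=> T0 cmu cz z0 t; apply/cvgrPdist_le => e e0.
have [dl dl0 H] := narrow_eps cmu cz z0 (clampT_itv t T0) e0.
near=> s; rewrite distrC; apply: H; first exact: clampT_itv.
apply: (le_lt_trans (clampT_lip _ _ T0)); rewrite distrC; near: s.
by apply: cvgr_dist_lt => //; exact: cvg_id.
Unshelve. all: by end_near. Qed.

End wasserstein_lemmas.

(** * Weak solutions *)

Section time_cutoff.
Context {R : realType}.
Local Notation mu := (@lebesgue_measure R).

Lemma prim_continuous (g : R -> R) : continuous g -> continuous (prim g).
Proof.
move=> cg x; apply/cvgrPdist_le => e e0.
have [M M0 gM] := compact_bounded_fun (@segment_compact R 0 (x + 1)) cg.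
have lip a b : a <= b -> b <= x + 1 -> `|prim g b - prim g a| <= M * (b - a).
  move=> ab bx; have [a0|a0] := leP 0 a.
    apply: prim_lip => // r /andP[ar rb]; apply: gM.
    by rewrite /= in_itv/= (le_trans a0 ar) (le_trans rb bx).
  have pa : prim g a = 0 by rewrite /prim set_itv_ge ?Rintegral_set0// bnd_simp -ltNge.
  have [b0|b0] := leP 0 b; last first.
    have pb : prim g b = 0 by rewrite /prim set_itv_ge ?Rintegral_set0// bnd_simp -ltNge.
    by rewrite pa pb subrr normr0 mulr_ge0// subr_ge0.
  rewrite pa -(prim0 g); apply: (@le_trans _ _ (M * (b - 0))).
    apply: prim_lip => // r /andP[r0 rb]; apply: gM.
    by rewrite /= in_itv/= r0 (le_trans rb bx).
  by apply: ler_wpM2l => //; rewrite lerD2l lerN2 ltW.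
have M1 : 0 < M + 1 by rewrite ltr_wpDl.
near=> y.
have yx : y <= x + 1 by apply: ltW; near: y; apply: lt_nbhsl; rewrite ltrDl.
have xyM : `|x - y| <= e / (M + 1).
  by near: y; apply: cvgr_dist_le; [exact: cvg_id|exact: divr_gt0].
have h : `|prim g x - prim g y| <= M * `|x - y|.
  have [xy|xy] := leP x y.
    rewrite distrC (distrC x) [X in M * X]ger0_norm ?subr_ge0//.
    exact: lip.
  rewrite [X in M * X]gtr0_norm ?subr_gt0//; apply: lip; first exact: ltW.
  by rewrite lerDl.
apply: (le_trans h); move: xyM; rewrite ler_pdivlMr// mulrC => xyM.
by apply: le_trans xyM; apply: ler_wpM2r => //; rewrite lerDl.
Unshelve. all: by end_near. Qed.

Lemma FTC_itv (F f : R -> R) (a b : R) : a <= b -> continuous f -> continuous F ->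
  (forall t, a < t < b -> is_derive t (1 : R) F (f t)) ->
  \int[mu]_(r in `[a, b]) f r = F b - F a.
Proof.
rewrite le_eqVlt => /predU1P[<- _ _ _|ab cf cF dF].
  by rewrite set_itv1 Rintegral_set1 subrr.
rewrite /Rintegral (@continuous_FTC2 _ f F)//; first exact: continuous_subspaceT.
  split.
  - by move=> t; rewrite in_itv/= => /dF[].
  - exact/cvg_at_right_filter/cF.
  - exact/cvg_at_left_filter/cF.
by move=> t; rewrite in_itv/= => /dF dt; rewrite derive1E; exact: derive_val.
Qed.

Lemma flat_exp1_nd (x y : R) : x <= y -> flat_exp 1 x <= flat_exp 1 y.
Proof.
move=> xy; have [x0|x0] := leP x 0; first by rewrite flat_exp_le0// flat_exp1_ge0.
have y0 := lt_le_trans x0 xy.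
rewrite /flat_exp x0 y0 !hornerE ?mul1r ler_expR lerN2 lef_pV2//.
Qed.

Lemma smooth_step_ni (x y : R) : x <= y -> smooth_step y <= smooth_step x.
Proof.
move=> xy; rewrite /smooth_step.
have h1 := smooth_step_den x; have h2 := smooth_step_den y.
rewrite ler_pdivrMr// mulrAC ler_pdivlMr//.
rewrite !mulrDr ![flat_exp 1 (1 - y) * flat_exp 1 (1 - x)]mulrC lerD2l.
apply: ler_pM; rewrite ?flat_exp1_ge0//; apply: flat_exp1_nd; lra.
Qed.

Definition cutoff (k b r : R) : R := smooth_step (k * (r - b)).

Lemma smooth_cutoff k b : smooth (cutoff k b).
Proof.
apply: (smooth_comp smooth_step_smooth); apply: smooth_mul; first exact: smooth_cst.
by apply: smooth_sub; [exact: smooth_id|exact: smooth_cst].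
Qed.

Lemma is_derive_smooth (f : R -> R) x : smooth f -> is_derive x (1 : R) f ('D_1 f x).
Proof.
by move=> sf; apply: DeriveDef => //; apply/derivable1_diffP/smooth_differentiable.
Qed.

Lemma derive_ni_le0 (f : R -> R) x : smooth f -> (forall a b, a <= b -> f b <= f a) ->
  'D_1 f x <= 0.
Proof.
(* Subtracting [e * id] makes the function strictly decreasing; [e] is arbitrarily small. *)
move=> sf fni; apply/ler_addgt0Pr => e e0; rewrite add0r -subr_le0.
have d1 (y : R) : is_derive y (1 : R) (f - e \*: id) ('D_1 f y - e *: (1 : R)).
  by apply: is_deriveB; exact: is_derive_smooth.
have := @decr_derive1_le0 _ (f - e \*: id) setT x.
rewrite derive1E (@derive_val _ _ _ _ _ _ _ (d1 x)) /GRing.scale/= mulr1; apply.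
- by move=> y _; case: (d1 y).
- move=> a b _ _ ab; rewrite !fctE; apply: ler_ltB; first exact/fni/ltW.
  by rewrite /= ltr_pM2l.
- by rewrite interiorT.
Qed.

Lemma cutoff_derive_le0 k b r : 0 < k -> 'D_1 (cutoff k b) r <= 0.
Proof.
move=> k0; apply: derive_ni_le0; first exact: smooth_cutoff.
by move=> x y xy; apply: smooth_step_ni; rewrite ler_pM2l// lerD2r.
Qed.

Lemma cutoff_le k b r : 0 < k -> r <= b -> cutoff k b r = 1.
Proof.
by move=> k0 rb; apply: smooth_step_le0; rewrite pmulr_rle0// subr_le0.
Qed.

Lemma cutoff_ge k b r : 0 < k -> b + k^-1 <= r -> cutoff k b r = 0.
Proof.
move=> k0 rb; apply: smooth_step_ge1; rewrite -ler_pdivrMl// mulr1; lra.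
Qed.

Lemma cutoff_derive_lt k b r : 0 < k -> r < b -> 'D_1 (cutoff k b) r = 0.
Proof.
move=> k0 rb; rewrite (@near_eq_derive R R R _ (cst 1)) ?derive_cst//.
by near=> y; rewrite cutoff_le// ltW//; near: y; exact: lt_nbhsl.
Unshelve. all: by end_near. Qed.

Lemma cutoff_derive_gt k b r : 0 < k -> b + k^-1 < r -> 'D_1 (cutoff k b) r = 0.
Proof.
move=> k0 rb; rewrite (@near_eq_derive R R R _ (cst 0)) ?derive_cst//.
by near=> y; rewrite cutoff_ge// ltW//; near: y; exact: lt_nbhsr.
Unshelve. all: by end_near. Qed.

(** The integrand is the derivative of [cutoff k b * prim q], which vanishes at 0 because of [prim]
    and at [T] because of the cutoff. *)
Lemma cutoff_by_parts (T k b : R) (q : R -> R) : 0 < T -> 0 < k -> b + k^-1 <= T ->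
  continuous q ->
  \int[mu]_(r in `[0, T]) (cutoff k b r * q r + 'D_1 (cutoff k b) r * prim q r) = 0.
Proof.
move=> T0 k0 kT cq.
have sc := smooth_cutoff k b.
apply: etrans (_ : cutoff k b T * prim q T - cutoff k b 0 * prim q 0 = 0); last first.
  by rewrite prim0 mulr0 cutoff_ge// mul0r subrr.
apply: (@FTC_itv (fun r => cutoff k b r * prim q r)).
- exact: ltW.
- move=> x; apply: cvgD; apply: cvgM.
  + exact: (smooth_continuous sc).
  + exact: cq.
  + exact: (smooth_continuous (smooth_derive (1 : R) sc)).
  + exact: prim_continuous.
- move=> x; apply: cvgM; first exact: (smooth_continuous sc).
  exact: prim_continuous.
- move=> t /andP[t0 tT].
  have d1 := is_derive_smooth t sc; have d2 := prim_derive t0 cq.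
  apply: (is_derive_eq (is_deriveM d1 d2)).
  by rewrite /GRing.scale/= [X in _ + X]mulrC.
Qed.

(** Minus the derivative of the cutoff is a probability density carried by [[b, b + k^-1]]:
    integrating [w] against it gives nearly [w b]. *)
Lemma cutoff_limit (T b e : R) (w : R -> R) : 0 <= b -> b < T -> 0 < e -> continuous w ->
  exists2 k0, 0 < k0 & forall k, k0 <= k ->
   b + k^-1 < T /\ `|\int[mu]_(r in `[0, T]) ('D_1 (cutoff k b) r * w r) + w b| <= e.
Proof.
move=> b0 bT e0 cw.
have /cvgrPdist_le/(_ e e0)/nbhs_ballP[dl /= dl0 wdl] : w r @[r --> b] --> w b by exact: cw.
pose s := Num.min dl (T - b).
have s0 : 0 < s by rewrite lt_min dl0 subr_gt0.
exists (2 / s) => [|k kk]; first by rewrite divr_gt0.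
have k0 : 0 < k by apply: lt_le_trans kk; rewrite divr_gt0.
have ks : k^-1 < s.
  rewrite invf_plt ?posrE//; apply: lt_le_trans kk.
  by rewrite -[ltLHS]mul1r ltr_pM2r ?invr_gt0// ltr1n.
have [kdl kT] : k^-1 < dl /\ k^-1 < T - b by move: ks; rewrite lt_min => /andP[].
have bkT : b + k^-1 < T by rewrite -ltrBrDl.
split=> //.
have sc := smooth_cutoff k b.
have cd : continuous ('D_1 (cutoff k b)) := smooth_continuous (smooth_derive (1 : R) sc).
have int1 : \int[mu]_(r in `[0, T]) ('D_1 (cutoff k b) r) = -1.
  apply: etrans (_ : cutoff k b T - cutoff k b 0 = -1); last first.
    by rewrite cutoff_ge ?(ltW bkT)// cutoff_le// sub0r.
  apply: (@FTC_itv (cutoff k b)) => //.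
  - by rewrite ltW// (le_lt_trans b0).
  - exact: smooth_continuous.
  - by move=> t _; exact: is_derive_smooth.
have cdw : continuous (fun r => 'D_1 (cutoff k b) r * w r).
  by move=> x; apply: cvgM; [exact: cd|exact: cw].
have cdb : continuous (fun r => 'D_1 (cutoff k b) r * w b).
  by move=> x; apply: cvgM; [exact: cd|exact: cvg_cst].
have -> : w b = - \int[mu]_(r in `[0, T]) ('D_1 (cutoff k b) r * w b).
  rewrite RintegralZr//; last exact: continuous_itv_integrable.
  by rewrite int1 mulN1r opprK.
rewrite -RintegralB//; [|exact: continuous_itv_integrable..].
have cdd : continuous (fun r => 'D_1 (cutoff k b) r * w r - 'D_1 (cutoff k b) r * w b).
  by move=> x; apply: cvgB; [exact: cdw|exact: cdb].
apply: (le_trans (le_normr_Rintegral _ _)) => //; first exact: continuous_itv_integrable.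
have -> : e = \int[mu]_(r in `[0, T]) (- e * 'D_1 (cutoff k b) r).
  by rewrite RintegralZl ?int1 ?mulrN1 ?opprK//; exact: continuous_itv_integrable.
apply: le_Rintegral => //.
- by have /integrable_abse := continuous_itv_integrable 0 T cdd; exact.
- apply: (@continuous_itv_integrable _ (fun r => - e * 'D_1 (cutoff k b) r)).
  by move=> x; apply: cvgM; [exact: cvg_cst|exact: cd].
- move=> r _; rewrite -mulrBr normrM ler0_norm ?cutoff_derive_le0// mulNr -mulrN mulrC.
  have [rb|br] := ltP r b; first by rewrite cutoff_derive_lt// !mulr0.
  have [rk|rk] := ltP (b + k^-1) r; first by rewrite cutoff_derive_gt// !mulr0.
  rewrite !mulNr lerN2; apply: ler_wnM2r; first exact: cutoff_derive_le0.
  rewrite distrC; apply: wdl; rewrite /ball/= distrC ger0_norm ?subr_ge0//; lra.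
Qed.

End time_cutoff.

(** * Testing weak solutions within one piece of the time partition *)

Section weak_time.
Context {R : realType} {d : nat}.
Local Notation leb := (@lebesgue_measure R).
Local Notation E := 'cV[R]_d.
Implicit Types (phi : R * E -> R) (f : R -> R) (i j : 'I_d).

Lemma differentiable_pairl (t : R) (x : E) : differentiable (fun y : E => (t, y)) x /\
  forall v, 'd (fun y : E => (t, y)) x v = (0, v).
Proof.
have d1 : differentiable (cst t : E -> R) x by exact: differentiable_cst.
have d2 : differentiable (id : E -> E) x by [].
split; first exact: (differentiable_pair d1 d2).
by move=> v; rewrite (diff_pair d1 d2) diff_cst diff_val.
Qed.

Lemma differentiable_pairr (t : R) (x : E) : differentiable (fun s : R => (s, x)) t /\
  forall v, 'd (fun s : R => (s, x)) t v = (v, 0).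
Proof.
have d1 : differentiable (cst x : R -> E) t by exact: differentiable_cst.
have d2 : differentiable (id : R -> R) t by [].
split; first exact: (differentiable_pair d2 d1).
by move=> v; rewrite (diff_pair d2 d1) diff_cst diff_val.
Qed.

Lemma derive_slice_x phi t x v : smooth phi ->
  'D_v (fun y => phi (t, y)) x = 'D_(0, v) phi (t, x).
Proof.
move=> sp; have [d1 d2] := differentiable_pairl t x.
have dp := smooth_differentiable (t, x) sp.
rewrite deriveE; last exact: (differentiable_comp d1 dp).
by rewrite (diff_comp d1 dp)/= d2 deriveE.
Qed.

Lemma derive_slice_t phi t x : smooth phi ->
  'D_1 (fun s => phi (s, x)) t = 'D_(1, 0) phi (t, x).
Proof.
move=> sp; have [d1 d2] := differentiable_pairr t x.
have dp := smooth_differentiable (t, x) sp.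
rewrite deriveE; last exact: (differentiable_comp d1 dp).
by rewrite (diff_comp d1 dp)/= d2 deriveE.
Qed.

Lemma smooth_time : smooth (fun p : R * E => p.1).
Proof.
have lin : linear (fun p : R * E => p.1) by [].
pose linM := GRing.isLinear.Build _ _ _ _ _ lin.
pose h : {linear _ -> _} := HB.pack (fun p : R * E => p.1) linM.
by apply: (@smooth_linear _ _ h) => p; exact: cvg_fst.
Qed.

Lemma smooth_space i : smooth (fun p : R * E => p.2 i ord0).
Proof.
have lin : linear (fun p : R * E => p.2 i ord0) by move=> a p q; rewrite !mxE.
pose linM := GRing.isLinear.Build _ _ _ _ _ lin.
pose h : {linear _ -> _} := HB.pack (fun p : R * E => p.2 i ord0) linM.
apply: (@smooth_linear _ _ h) => p.
apply: (@continuous_comp _ _ _ snd (fun x : E => x i ord0)); first exact: cvg_snd.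
exact: coord_continuous.
Qed.

Definition fld f i j (x : E) : E := f (x j ord0) *: delta_mx i ord0.

Lemma dot_fld (u : E) f i j x : dot u (fld f i j x) = f (x j ord0) * u i ord0.
Proof.
rewrite /dot mxE (bigD1 i)//= big1 ?addr0.
  by rewrite !mxE !eqxx mulr1 mulrC.
by move=> k ki; rewrite !mxE (negbTE ki) !mulr0.
Qed.

Definition transport_op f i j phi (p : R * E) : R :=
  'D_(1, 0) phi p + f (p.2 j ord0) * 'D_(0, delta_mx i ord0) phi p.

Lemma transport_op_continuous f i j phi : continuous f -> smooth phi ->
  continuous (transport_op f i j phi).
Proof.
move=> cf sp p; apply: cvgD.
  exact: (smooth_continuous (smooth_derive _ sp)).
apply: cvgM; last exact: (smooth_continuous (smooth_derive _ sp)).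
apply: (@continuous_comp _ _ _ (fun p : R * E => p.2 j ord0) f); last exact: cf.
exact: (smooth_continuous (smooth_space j)).
Qed.

(* The open time interval contains [0, T], so that derivatives of phi vanish   *)
(* as well; all times cannot be required, as the support of the test functions *)
(* of euler_step spreads with time.                                           *)
Definition vanishing (T rho : R) phi : Prop :=
  forall s x, -1 < s < T + 1 -> ~ cube rho x -> phi (s, x) = 0.

Lemma derive_vanishing T phi rho v : vanishing T rho phi -> vanishing T rho ('D_v phi).
Proof.
move=> phi0 s x /andP[s0 sT] /existsNP[i /negP]; rewrite -ltNge => xi.
rewrite (@near_eq_derive _ _ _ _ (cst 0)) ?derive_cst//.
have ns : nbhs ((s, x) : R * E) [set p : R * E | -1 < p.1 < T + 1].
  have cs : continuous (fun p : R * E => p.1) by exact: (smooth_continuous smooth_time).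
  have n1 : nbhs ((s, x) : R * E) [set p : R * E | -1 < p.1] by apply: (cvgr_gt _ (cs (s, x))).
  have n2 : nbhs ((s, x) : R * E) [set p : R * E | p.1 < T + 1] by apply: (cvgr_lt _ (cs (s, x))).
  by apply: filterS2 n1 n2 => p /= -> ->.
have nx : nbhs ((s, x) : R * E) [set p : R * E | rho < `|p.2 i ord0|].
  have cn : continuous (fun p : R * E => `|p.2 i ord0|).
    move=> p; apply: (@continuous_comp _ _ _ (fun p : R * E => p.2 i ord0) (fun y : R => `|y|)).
      exact: (smooth_continuous (smooth_space i)).
    exact: norm_continuous.
  by apply: (cvgr_gt _ (cn (s, x))).
apply: filterS2 ns nx => -[s' x'] /= hs' xi'; apply: phi0 => // /(_ i).
by rewrite leNgt xi'.
Qed.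

Lemma transport_op_vanishing T f i j phi rho :
  vanishing T rho phi -> vanishing T rho (transport_op f i j phi).
Proof.
move=> phi0 s x sT xr.
by rewrite /transport_op !(derive_vanishing _ phi0)// mulr0 addr0.
Qed.

Variables (T : R) (V : R -> E -> E) (mu0 : probability E R) (mu : R -> probability E R).
Hypothesis T0 : 0 < T.
Hypothesis wmu : weak_solution T V mu0 mu.

Definition mean phi (r : R) : R := \int[mu (clampT T r)]_x phi (clampT T r, x).

Let cmu : W2_continuous T mu. Proof. by case: wmu. Qed.

Let itvT s : s \in `[0, T] -> -1 < s < T + 1.
Proof. by rewrite in_itv/=; have := T0; lra. Qed.

Lemma mean_continuous phi rho : continuous phi -> vanishing T rho phi ->
  continuous (mean phi).
Proof.
move=> cp p0; apply: (narrow_continuous (r := rho) T0 cmu cp) => s x /itvT sT.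
exact: p0.
Qed.

Lemma slice_integrable (m : probability E R) phi rho t : continuous phi ->
  vanishing T rho phi -> t \in `[0, T] ->
  m.-integrable setT (EFin \o (fun x => phi (t, x))).
Proof.
move=> cp p0 /itvT tT; apply: (@vanishing_integrable _ _ _ _ rho) => [x|x]; last exact: p0.
apply: (@continuous_comp _ _ _ (fun x => (t, x)) phi); last exact: cp.
exact: continuous_pairl.
Qed.

(** Test with [phi(t, x) * chi(t)]. As [chi] vanishes from [b < T] on, the support is compact in
    [[0, T[]; the velocity has to be known only where [chi] or its derivative is nonzero, which
    localizes the identity to one piece. *)
Lemma weak_time f i j phi rho (chi : R -> R) b : continuous f -> smooth phi ->
  vanishing T rho phi -> smooth chi -> b < T -> (forall r, b <= r -> chi r = 0) ->
  (forall r, r \in `[0, T] -> V r = fld f i j \/ chi r = 0 /\ 'D_1 chi r = 0) ->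
  \int[leb]_(r in `[0, T])
    (chi r * mean (transport_op f i j phi) r + 'D_1 chi r * mean phi r) =
  - (chi 0 * \int[mu0]_x phi (0, x)).
Proof.
move=> cf sp p0 sc bT chib Vchi.
have cp := smooth_continuous sp.
have cz := @transport_op_continuous f i j phi cf sp.
have z0 := @transport_op_vanishing T f i j phi rho p0.
pose phic (p : R * E) := phi p * chi p.1.
have sphic : smooth phic.
  by apply: smooth_mul => //; apply: (smooth_comp sc); exact: smooth_time.
have tphic : test_function T phic.
  split=> //; exists (`[0, b]%classic `*` @cube R d rho); split.
  - by apply: compact_setX; [exact: segment_compact|exact: compact_cube].
  - move=> [s x] [/= + _]; rewrite !in_itv/= => /andP[s0 sb]; split=> //=.
    by rewrite s0 (le_lt_trans sb).
  - move=> t x; rewrite in_itv/= => /andP[t0 tT] /not_andP[] /= h.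
      rewrite /phic/= chib ?mulr0//; move: h; rewrite in_itv/= t0/= => /negP.
      by rewrite -ltNge => /ltW.
    by rewrite /phic/= p0 ?mul0r// itvT// in_itv/= t0 ltW.
have [_ _ /(_ phic tphic)] := wmu.
have dphic t x : 'D_1 (fun s => phic (s, x)) t =
    chi t * 'D_(1, 0) phi (t, x) + 'D_1 chi t * phi (t, x).
  have dphi : is_derive t (1 : R) (fun s => phi (s, x)) ('D_(1, 0) phi (t, x)).
    rewrite -derive_slice_t//; apply: DeriveDef => //.
    apply/derivable1_diffP; have [d1 _] := differentiable_pairr t x.
    exact: (differentiable_comp d1 (smooth_differentiable (t, x) sp)).
  have dchi := is_derive_smooth t sc.
  have := @derive_val _ _ _ _ _ _ _ (is_deriveM dphi dchi).
  rewrite /GRing.scale/= => e; apply: (etrans e).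
  by rewrite addrC [phi (t, x) * _]mulrC.
have gphic t x k : grad phic t x k ord0 = chi t * 'D_(0, delta_mx k ord0) phi (t, x).
  rewrite /grad mxE derive_slice_x//.
  have schi : smooth (fun p : R * E => chi p.1) by apply: (smooth_comp sc); exact: smooth_time.
  have dphi : derivable phi (t, x) (0, delta_mx k ord0).
    exact/diff_derivable/smooth_differentiable.
  have dchi : derivable (fun p : R * E => chi p.1) (t, x) (0, delta_mx k ord0).
    exact/diff_derivable/smooth_differentiable.
  have z : 'D_(0, delta_mx k ord0) (fun p : R * E => chi p.1) (t, x) = 0.
    rewrite -(@derive_slice_x (fun p : R * E => chi p.1))//=.
    exact: (@derive_cst _ _ _ (chi t)).
  have := deriveM dphi dchi; rewrite /GRing.scale/= => e; apply: (etrans e).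
  by rewrite z mulr0 add0r.
have inner r : r \in `[0, T] ->
    (\int[mu r]_x (dt phic r x + dot (grad phic r x) (V r x))%:E)%E =
    (chi r * mean (transport_op f i j phi) r + 'D_1 chi r * mean phi r)%:E.
  move=> rT; rewrite /mean (clampT_id rT).
  have -> : (fun x => (dt phic r x + dot (grad phic r x) (V r x))%:E) =
      (fun x => (chi r * transport_op f i j phi (r, x) + 'D_1 chi r * phi (r, x))%:E).
    apply/funext => x; congr EFin; rewrite /dt dphic.
    have [->|[c0 c1]] := Vchi r rT.
      rewrite dot_fld gphic /transport_op/=; ring.
    rewrite c0 c1 !mul0r addr0 add0r /dot mxE big1// => k _.
    by rewrite mxE gphic c0 !mul0r.
  have iz := slice_integrable (mu r) cz z0 rT.
  have ip := slice_integrable (mu r) cp p0 rT.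
  have iz' := integrableZl measurableT (chi r) iz.
  have ip' := integrableZl measurableT ('D_1 chi r) ip.
  rewrite EFin_Rintegral; last exact: (integrableD measurableT iz' ip').
  by rewrite RintegralD// RintegralZl// RintegralZl.
under eq_integral => r rT do rewrite inner ?(set_mem rT)//.
have c1 := mean_continuous cz z0; have c2 := mean_continuous cp p0.
have cc : continuous (fun r => chi r * mean (transport_op f i j phi) r + 'D_1 chi r * mean phi r).
  move=> x; apply: cvgD; apply: cvgM; [exact: smooth_continuous|exact: c1| |exact: c2].
  exact: (smooth_continuous (smooth_derive (1 : R) sc)).
have ic := continuous_itv_integrable 0 T cc.
move=> h; apply: EFin_inj; rewrite /Rintegral fineK; last exact: integrable_fin_num.
apply: (etrans h).
have ip0 : mu0.-integrable setT (EFin \o (fun x => phi (0, x))).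
  by apply: (slice_integrable mu0 cp p0); rewrite in_itv/= lexx ltW.
rewrite /phic/=; under eq_integral do rewrite EFinM.
rewrite integralZr// EFin_Rintegral//.
by rewrite EFinN mulrC EFinM.
Qed.

Lemma exists_large_inverse_lt (k0 c : R) : 0 < c -> exists2 k, k0 <= k & k^-1 < c.
Proof.
move=> c0; exists (`|k0| + 2 / c).
  by rewrite (le_trans (ler_norm k0))// lerDl divr_ge0// ltW.
have h : 0 < 2 / c by rewrite divr_gt0.
by rewrite invf_plt ?posrE// ?ltr_wpDl// -[ltLHS]mul1r ltr_pM2r ?invr_gt0// ltr1n.
Qed.

Lemma dist_from_sums (p q u v e : R) : `|q + v| <= e / 2 -> `|p + u| <= e / 2 ->
  p - q = 0 -> `|u - v| <= 0 + e.
Proof. by rewrite !ler_norml; lra. Qed.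

(* Testing with chi(r) phi(r, x), where the time cutoff chi lives in one piece *)
(* of the partition and tends to an indicator, shows that w below is constant. *)
Section piece.
Variables (f : R -> R) (i j : 'I_d) (phi : R * E -> R) (rho : R).
Hypothesis cf : continuous f.
Hypothesis sp : smooth phi.
Hypothesis p0 : vanishing T rho phi.

Let M := mean phi.
Let Q := mean (transport_op f i j phi).
Let w (r : R) : R := M r - prim Q r.

Let cM : continuous M.
Proof. exact: (mean_continuous (smooth_continuous sp) p0). Qed.

Let cQ : continuous Q.
Proof.
exact: (mean_continuous (@transport_op_continuous f i j phi cf sp)
  (@transport_op_vanishing T f i j phi rho p0)).
Qed.

Let cw : continuous w.
Proof. by move=> x; apply: cvgB; [exact: cM|exact: prim_continuous]. Qed.

Let J (k b : R) := \int[leb]_(r in `[0, T]) (cutoff k b r * Q r + 'D_1 (cutoff k b) r * M r).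

Let icut (g : R -> R) k b : continuous g ->
  leb.-integrable `[0, T] (EFin \o (fun r => cutoff k b r * g r)) /\
  leb.-integrable `[0, T] (EFin \o (fun r => 'D_1 (cutoff k b) r * g r)).
Proof.
move=> cg; have sc := smooth_cutoff k b.
split; apply: continuous_itv_integrable => x; apply: cvgM; try exact: cg.
  exact: (smooth_continuous sc).
exact: (smooth_continuous (smooth_derive (1 : R) sc)).
Qed.

(** Integration by parts replaces the [Q] term by [- prim Q], so [J k b] is the integral of the
    cutoff's derivative against [w] and tends to [- w b]. *)
Let J_limit b e : 0 <= b -> b < T -> 0 < e ->
  exists2 k0, 0 < k0 & forall k, k0 <= k -> b + k^-1 < T /\ `|J k b + w b| <= e.
Proof.
move=> b0 bT e0; have [k0 k00 H] := cutoff_limit b0 bT e0 cw.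
exists k0 => // k kk; have [bkT hk] := H k kk; split=> //.
have k1 : 0 < k by exact: lt_le_trans kk.
have cP := prim_continuous cQ.
have [iQ _] := icut k b cQ; have [_ iM] := icut k b cM; have [_ iP] := icut k b cP.
rewrite (_ : J k b = \int[leb]_(r in `[0, T]) ('D_1 (cutoff k b) r * w r))//.
have h1 := cutoff_by_parts T0 k1 (ltW bkT) cQ; rewrite RintegralD// in h1.
have h2 : \int[leb]_(r in `[0, T]) ('D_1 (cutoff k b) r * w r) =
  \int[leb]_(r in `[0, T]) ('D_1 (cutoff k b) r * M r) -
  \int[leb]_(r in `[0, T]) ('D_1 (cutoff k b) r * prim Q r).
  by rewrite -RintegralB//; apply: eq_Rintegral => r _; rewrite mulrBr.
rewrite h2 /J RintegralD//.
rewrite -[LHS]subr0 -[X in _ - X = _]h1; ring.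
Qed.

(** A cutoff that drops right after time 0 leaves only the initial term of the weak formulation, so
    the curve does start at [mu0]. *)
Lemma weak_initial c : 0 < c -> c <= T -> (forall r, 0 <= r < c -> V r = fld f i j) ->
  M 0 = \int[mu0]_x phi (0, x).
Proof.
move=> c0 cT Vc; apply/eqP; rewrite -subr_eq0 -normr_le0; apply/ler_addgt0Pr => e e0.
have [k0 k00 H] := J_limit (lexx 0) T0 e0.
have [k kk kc] := exists_large_inverse_lt k0 c0.
have k1 : 0 < k by exact: lt_le_trans kk.
have [kT hk] := H k kk.
have h0 r : 0 + k^-1 <= r -> cutoff k 0 r = 0 by exact: cutoff_ge.
have hV r : r \in `[0, T] -> V r = fld f i j \/ cutoff k 0 r = 0 /\ 'D_1 (cutoff k 0) r = 0.
  rewrite in_itv/= => /andP[r0 _]; have [rc|rc] := ltP r c.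
    by left; apply: Vc; rewrite r0.
  right; rewrite cutoff_ge ?cutoff_derive_gt ?add0r//; first exact: lt_le_trans rc.
  by rewrite ltW// (lt_le_trans kc).
have := weak_time cf sp p0 (smooth_cutoff k 0) kT h0 hV.
rewrite -/(J k 0) cutoff_le// mul1r => e1.
by move: hk; rewrite e1 /w prim0 subr0 addrC add0r.
Qed.

(** [chi] below tends to the indicator of [[a, b]] and vanishes at time 0, which removes the initial
    term. The room between [b] and [c] lets it come down before the field changes; the end [b = c]
    is reached later by continuity of [w]. *)
Lemma weak_piece_open a b c : 0 <= a -> a <= b -> b < c -> c <= T ->
  (forall r, a <= r < c -> V r = fld f i j) -> w b = w a.
Proof.
move=> a0 ab bc cT Vc; have bT := lt_le_trans bc cT.
apply/eqP; rewrite -subr_eq0 -normr_le0; apply/ler_addgt0Pr => e e0.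
have e20 : 0 < e / 2 by rewrite divr_gt0.
have [ka ka0 Ha] := J_limit a0 (le_lt_trans ab bT) e20.
have [kb kb0 Hb] := J_limit (le_trans a0 ab) bT e20.
have [k kk kc] : exists2 k, Num.max ka kb <= k & k^-1 < c - b.
  by apply: exists_large_inverse_lt; rewrite subr_gt0.
have [kka kkb] : ka <= k /\ kb <= k by move: kk; rewrite ge_max => /andP[].
have k1 : 0 < k by exact: lt_le_trans kka.
have [_ hka] := Ha k kka; have [bkT hkb] := Hb k kkb.
pose chi r := cutoff k b r - cutoff k a r.
have schi : smooth chi by apply: smooth_sub; exact: smooth_cutoff.
have dchi r : 'D_1 chi r = 'D_1 (cutoff k b) r - 'D_1 (cutoff k a) r.
  have d1 := is_derive_smooth r (smooth_cutoff k b).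
  have d2 := is_derive_smooth r (smooth_cutoff k a).
  exact: (@derive_val _ _ _ _ _ _ _ (is_deriveB d1 d2)).
have h0 r : b + k^-1 <= r -> chi r = 0.
  by move=> br; rewrite /chi !cutoff_ge ?subrr//; lra.
have hV r : r \in `[0, T] -> V r = fld f i j \/ chi r = 0 /\ 'D_1 chi r = 0.
  rewrite in_itv/= => /andP[r0 _]; have [ar|ra] := leP a r; last first.
    right; rewrite dchi /chi !cutoff_le ?cutoff_derive_lt ?subrr//; lra.
  have [rc|rc] := ltP r c; first by left; apply: Vc; rewrite ar.
  by right; rewrite dchi /chi !cutoff_ge ?cutoff_derive_gt ?subrr//; lra.
have := weak_time cf sp p0 schi bkT h0 hV.
have c00 : chi 0 = 0 by rewrite /chi !cutoff_le ?subrr// (le_trans a0).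
rewrite c00 mul0r oppr0 => e1.
have jint b' : leb.-integrable `[0, T]
    (EFin \o (fun r => cutoff k b' r * Q r + 'D_1 (cutoff k b') r * M r)).
  have sc := smooth_cutoff k b'.
  apply: continuous_itv_integrable => x; apply: cvgD; apply: cvgM.
  - exact: (smooth_continuous sc).
  - exact: cQ.
  - exact: (smooth_continuous (smooth_derive (1 : R) sc)).
  - exact: cM.
have JJ : J k b - J k a = 0.
  rewrite -e1 /J -RintegralB//; [|exact: jint..].
  by apply: eq_Rintegral => r _; rewrite dchi /chi /Q /M; ring.
exact: (dist_from_sums hka hkb JJ).
Qed.

Lemma weak_piece a b c : 0 <= a -> a <= b -> b <= c -> a < c -> c <= T ->
  (forall r, a <= r < c -> V r = fld f i j) -> w b = w a.
Proof.
move=> a0 ab bc ac cT Vc.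
move: bc; rewrite le_eqVlt => /predU1P[->|bc]; last exact: weak_piece_open bc cT Vc.
apply/eqP; rewrite -subr_eq0 -normr_le0; apply/ler_addgt0Pr => e e0; rewrite add0r.
have /cvgrPdist_le/(_ e e0)/nbhs_ballP[dl /= dl0 wdl] : w r @[r --> c] --> w c by exact: cw.
pose s := Num.max a (c - dl / 2).
have sc : s < c by rewrite gt_max ac/= ltrBlDl ltrDr divr_gt0.
have sa : a <= s by rewrite le_max lexx.
have sdl : c - dl / 2 <= s by rewrite le_max lexx orbT.
rewrite -(weak_piece_open a0 sa sc cT Vc); apply: wdl.
by rewrite /ball/= gtr0_norm ?subr_gt0//; lra.
Qed.

Lemma weak_transported a c : 0 <= a -> a < c -> c <= T ->
  (forall r, a <= r < c -> V r = fld f i j) ->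
  forall e r1 r2, a <= r1 -> r1 <= r2 -> r2 <= c ->
  (forall r x, r1 <= r <= r2 -> `|transport_op f i j phi (r, x)| <= e) ->
  `|\int[mu r2]_x phi (r2, x) - \int[mu r1]_x phi (r1, x)| <= e * (r2 - r1).
Proof.
move=> a0 ac cT Vc e r1 r2 ar1 r12 r2c he.
have r10 := le_trans a0 ar1; have r2T := le_trans r2c cT.
have w1 := weak_piece a0 ar1 (le_trans r12 r2c) ac cT Vc.
have w2 := weak_piece a0 (le_trans ar1 r12) r2c ac cT Vc.
have -> : \int[mu r2]_x phi (r2, x) - \int[mu r1]_x phi (r1, x) = prim Q r2 - prim Q r1.
  have M1 : M r1 = \int[mu r1]_x phi (r1, x).
    by rewrite /M /mean clampT_id// in_itv/= r10 (le_trans r12 r2T).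
  have M2 : M r2 = \int[mu r2]_x phi (r2, x).
    by rewrite /M /mean clampT_id// in_itv/= r2T (le_trans r10 r12).
  by rewrite -M1 -M2; move: w1 w2; rewrite /w; lra.
apply: prim_lip => // r /andP[rr1 rr2].
have rT : r \in `[0, T] by rewrite in_itv/= (le_trans r10 rr1) (le_trans rr2 r2T).
rewrite /Q /mean (clampT_id rT); apply: Rintegral_prob_bound.
  exact: (slice_integrable _ (@transport_op_continuous f i j phi cf sp)
    (@transport_op_vanishing T f i j phi rho p0) rT).
by move=> x; apply: he; rewrite rr1.
Qed.

End piece.
End weak_time.

(* All that uniqueness uses of a weak solution on [a, c]: mu transports        *)
(* approximate solutions phi of the dual equation up to the accumulated error. *)
Definition transported {R : realType} {d : nat} (T a c : R) (f : R -> R) (i j : 'I_d)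
    (mu : R -> probability 'cV[R]_d R) : Prop :=
  forall phi rho, smooth phi -> vanishing T rho phi ->
  forall e r1 r2, a <= r1 -> r1 <= r2 -> r2 <= c ->
  (forall r x, r1 <= r <= r2 -> `|transport_op f i j phi (r, x)| <= e) ->
  `|\int[mu r2]_x phi (r2, x) - \int[mu r1]_x phi (r1, x)| <= e * (r2 - r1).

(** * Uniqueness by duality *)

Section euler_dual.
Context {R : realType} {d : nat}.
Local Notation E := 'cV[R]_d.
Implicit Types (psi : E -> R) (g : R -> R) (i j : 'I_d).

Lemma is_derive_ray (V : normedModType R) (x v : V) (h : R -> R) (t h' : R) :
  is_derive t (1 : R) h h' -> is_derive t (1 : R) (fun s => x + h s *: v) (h' *: v).
Proof.
move=> dh.
have dht : differentiable h t by apply/derivable1_diffP; case: dh.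
have dz : differentiable (fun s => h s *: v) t by exact: differentiableZl.
have h1 : is_derive t (1 : R) (fun s => h s *: v) (h' *: v).
  apply: DeriveDef; first exact/derivable1_diffP.
  by rewrite deriveE// diffZl//= -deriveE// derive_val.
have := is_deriveD (is_derive_cst x t (1 : R)) h1.
by rewrite add0r.
Qed.

Lemma is_derive_psi_ray psi x i (h : R -> R) (t h' : R) : smooth psi ->
  is_derive t (1 : R) h h' ->
  is_derive t (1 : R) (fun s => psi (x + h s *: delta_mx i ord0))
    (h' * 'D_(delta_mx i ord0) psi (x + h t *: delta_mx i ord0)).
Proof.
move=> sp dh; have dx y := smooth_differentiable y sp.
have := derive_line (dx _) (is_derive_ray x (delta_mx i ord0) dh) erefl.
by rewrite deriveE// linearZ/= -deriveE.
Qed.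

(** An explicit Euler step of length [s] for the field [g(x_j) e_i]. *)
Definition eshift g i j (s : R) (x : E) : E := x + (s * g (x j ord0)) *: delta_mx i ord0.

Lemma eshiftE g i j s x k :
  eshift g i j s x k ord0 = x k ord0 + (k == i)%:R * (s * g (x j ord0)).
Proof. by rewrite !mxE eqxx andbT [RHS]addrC mulrC addrC. Qed.

Lemma smooth_eshift_time g i j psi t : smooth g -> smooth psi ->
  smooth (fun p : R * E => psi (eshift g i j (t - p.1) p.2)).
Proof.
move=> sg sp; apply: (smooth_vec sp) => k.
rewrite (_ : (fun _ => _) =
  fun p : R * E => p.2 k ord0 + (k == i)%:R * ((t - p.1) * g (p.2 j ord0))); last first.
  by apply/funext => p; rewrite eshiftE.
apply: smooth_add; first exact: smooth_space.
apply: smooth_mul; first exact: smooth_cst.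
apply: smooth_mul.
  by apply: smooth_sub; [exact: smooth_cst|exact: smooth_time].
by apply: (smooth_comp sg); exact: smooth_space.
Qed.

Lemma smooth_eshift g i j psi s : smooth g -> smooth psi ->
  smooth (fun x => psi (eshift g i j s x)).
Proof.
move=> sg sp; apply: (smooth_vec sp) => k.
rewrite (_ : (fun _ => _) =
  fun x : E => x k ord0 + (k == i)%:R * (s * g (x j ord0))); last first.
  by apply/funext => p; rewrite eshiftE.
apply: smooth_add; first exact: smooth_coord.
apply: smooth_mul; first exact: smooth_cst.
apply: smooth_mul; first exact: smooth_cst.
by apply: (smooth_comp sg); exact: smooth_coord.
Qed.

(** Along the ray of direction [(a, b e_i)] the shifted point moves parallel to [e_i], with abscissa
    [h], and the factor is the derivative of [h] at 0. With a = 0 and b = 1 it controls the gradient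
    of the transported function; with a = 1 and b = f(x_j) it is the residual of the dual equation,
    [f - g] plus a term of order [t - r]. *)
Lemma derive_eshift g i j psi (t r a b : R) x : smooth g -> smooth psi ->
  'D_(a, b *: delta_mx i ord0) (fun p : R * E => psi (eshift g i j (t - p.1) p.2)) (r, x) =
  (b - a * g (x j ord0) + (t - r) * ((i == j)%:R * b * 'D_1 g (x j ord0))) *
   'D_(delta_mx i ord0) psi (eshift g i j (t - r) x).
Proof.
move=> sg sp; set phi := (fun p : R * E => _).
have sphi : smooth phi by exact: smooth_eshift_time.
have d0 : is_derive (0 : R) (1 : R) (id : R -> R) 1 by exact: is_derive_id.
have := derive_line (smooth_differentiable _ sphi)
  (is_derive_ray ((r, x) : R * E) (a, b *: delta_mx i ord0) d0) erefl.
rewrite scale0r addr0 scale1r => d1.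
pose h (s : R) : R := s * b + (t - r - s * a) * g (x j ord0 + s * ((i == j)%:R * b)).
have e1 : phi \o (fun s : R => (r, x) + id s *: (a, b *: delta_mx i ord0)) =
    fun s => psi (x + h s *: delta_mx i ord0).
  apply/funext => s; rewrite /phi /h /eshift /=; congr psi.
  have -> : (x + s *: (b *: delta_mx i ord0)) j ord0 = x j ord0 + s * ((i == j)%:R * b).
    by rewrite !mxE eqxx andbT eq_sym [b * _]mulrC.
  rewrite -addrA scalerA -scalerDl; congr (x + _ *: _).
  by rewrite /GRing.scale/= opprD addrA.
have dg := is_derive_smooth (x j ord0) sg.
have dh : is_derive (0 : R) (1 : R) h
   (b - a * g (x j ord0) + (t - r) * ((i == j)%:R * b * 'D_1 g (x j ord0))).
  have da : is_derive (0 : R) (1 : R) (fun s => x j ord0 + s * ((i == j)%:R * b)) ((i == j)%:R * b).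
    have := @is_derive_ray _ (x j ord0 : R^o) ((i == j)%:R * b : R^o) _ _ _ d0.
    by rewrite scale1r.
  have db := @is_derive_ray _ (0 : R^o) (b : R^o) _ _ _ d0.
  have dc := @is_derive_ray _ (t - r : R^o) (- a : R^o) _ _ _ d0.
  have dg' : is_derive (0 : R) (1 : R) (fun s => g (x j ord0 + s * ((i == j)%:R * b)))
      ((i == j)%:R * b * 'D_1 g (x j ord0)).
    have := @is_derive1_comp _ g (fun s => x j ord0 + s * ((i == j)%:R * b)) 0 ('D_1 g (x j ord0)) _ _ da.
    by rewrite mul0r addr0 [_ * ((i == j)%:R * b)]mulrC; apply.
  have eh : h = (fun s : R => 0 + s *: (b : R^o)) +
      (fun s : R => t - r + s *: (- a : R^o)) * (fun s => g (x j ord0 + s * ((i == j)%:R * b))).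
    apply/funext => s; rewrite /h.
    transitivity (0 + s * b + (t - r + s * - a) * g (x j ord0 + s * ((i == j)%:R * b))) => //.
    by ring.
  have dh0 := is_deriveD db (is_deriveM dc dg').
  have := is_derive_eq dh0; rewrite -eh; apply.
  by rewrite /GRing.scale/= !mul0r !addr0; ring.
have := is_derive_psi_ray x i sp dh.
rewrite -e1 => d2; rewrite -(@derive_val _ _ _ _ _ _ _ d1) (@derive_val _ _ _ _ _ _ _ d2).
by rewrite /h mul0r add0r mul0r subr0 mul0r addr0.
Qed.

Lemma eshift_norm g i j s x : `|eshift g i j s x - x| <= `|s * g (x j ord0)|.
Proof.
apply: norm_cV_le => // k; rewrite !mxE eqxx andbT addrAC subrr add0r normrM.
by case: (k == i); rewrite ?normr1 ?mulr1// normr0 mulr0.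
Qed.

Lemma derive_off_cube psi r v x : smooth psi -> (forall y, ~ cube r y -> psi y = 0) ->
  ~ cube r x -> 'D_v psi x = 0.
Proof.
move=> sp p0 xr.
have sp2 : smooth (fun p : R * E => psi p.2).
  by apply: (smooth_vec sp) => k; exact: smooth_space.
have v2 : vanishing 0 r (fun p : R * E => psi p.2) by move=> s y _; exact: p0.
rewrite -[LHS]/('D_v (fun y => (fun p : R * E => psi p.2) (0, y)) x) derive_slice_x//.
apply: (derive_vanishing (0, v) v2) => //; rewrite add0r ltr01 andbT; lra.
Qed.

Lemma off_cube_norm (r : R) (x : E) : 0 <= r -> ~ cube r x -> r < `|x|.
Proof.
move=> r0 /existsNP[k /negP]; rewrite -ltNge => h.
exact: (lt_le_trans h (coord_le_norm x k)).
Qed.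

Lemma norm_off_cube (r : R) (x : E) : 0 <= r -> r < `|x| -> ~ cube r x.
Proof. by move=> r0 rx /(norm_cV_le r0); rewrite leNgt rx. Qed.

Lemma eshift_displacement g (L M0 : R) : (forall s, `|g s| <= M0 + L * `|s|) -> 0 <= M0 -> 0 <= L ->
  forall i j s x h, 0 <= s <= h -> `|eshift g i j s x - x| <= h * (M0 + L * `|x|).
Proof.
move=> gM M00 L0 i j s x h /andP[s0 sh]; apply: (le_trans (eshift_norm _ _ _ _ _)).
rewrite normrM (ger0_norm s0); apply: ler_pM => //.
apply: (le_trans (gM _)); rewrite lerD2l; apply: ler_wpM2l => //.
exact: coord_le_norm.
Qed.

Lemma smooth_lipschitz g (L : R) : smooth g -> (forall s, `|'D_1 g s| <= L) ->
  forall s t, `|g s - g t| <= L * `|s - t|.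
Proof.
move=> sg gL; have aux s t : t <= s -> `|g s - g t| <= L * `|s - t|.
  move=> ts; have [||k _ ->] := @MVT_segment _ g ('D_1 g) _ _ ts.
  - by move=> x _; exact: is_derive_smooth.
  - by apply: continuous_subspaceT => x; exact: smooth_continuous.
  by rewrite normrM; apply: ler_wpM2r.
move=> s t; have [st|/ltW st] := leP t s; first exact: aux.
by rewrite distrC [X in _ * X]distrC; exact: aux.
Qed.

Section step.
Variables (T a c : R) (f g : R -> R) (i j : 'I_d) (L M0 B del Rmax h : R).
Hypotheses (a0 : 0 <= a) (cT : c <= T) (L0 : 0 <= L) (M00 : 0 <= M0).
Hypotheses (sg : smooth g) (gB : forall s, `|g s| <= B) (gL : forall s, `|'D_1 g s| <= L).
Hypotheses (gM : forall s, `|g s| <= M0 + L * `|s|) (fM : forall s, `|f s| <= M0 + L * `|s|).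
Hypotheses (gf : forall s, `|s| <= Rmax -> `|g s - f s| <= del) (del0 : 0 <= del).
Hypotheses (h0 : 0 <= h) (hL : h * L < 1).

Let rate := del + h * L * (M0 + L * Rmax).

(* Tested on phi(r, x) = psi (eshift g i j (t - r) x) for r in [t - h, t].      *)
Lemma euler_step psi r M : smooth psi -> 0 <= r -> (forall x, ~ cube r x -> psi x = 0) ->
  (r + h * M0) / (1 - h * L) <= Rmax ->
  0 <= M -> (forall x, `|'D_(delta_mx i ord0) psi x| <= M) ->
  let psi' := fun x => psi (eshift g i j h x) in
  [/\ smooth psi', forall x, ~ cube ((r + h * M0) / (1 - h * L)) x -> psi' x = 0,
      forall x, `|'D_(delta_mx i ord0) psi' x| <= (1 + h * L) * M &
      forall t, a <= t - h -> t <= c -> forall mu, transported T a c f i j mu ->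
      `|\int[mu t]_x psi x - \int[mu (t - h)]_x psi' x| <= M * rate * h].
Proof.
move=> sp r0 p0 rR M1 psiM psi'.
have hL1 : 0 < 1 - h * L by rewrite subr_gt0.
have r'0 : 0 <= (r + h * M0) / (1 - h * L).
  by rewrite divr_ge0 ?(ltW hL1)// addr_ge0// mulr_ge0.
(* A displacement of at most [h * (M0 + L * |x|)] cannot bring a point from outside the larger cube
   into the cube of radius [r]: this dictates the radius [(r + h * M0) / (1 - h * L)]. *)
have off s x : 0 <= s <= h -> ~ cube ((r + h * M0) / (1 - h * L)) x ->
    ~ cube r (eshift g i j s x).
  move=> sh /(off_cube_norm r'0); rewrite ltr_pdivrMr// => hx; apply: norm_off_cube => //.
  have h1 := eshift_displacement gM M00 L0 i j x sh.
  have h2 := lerB_dist x (x - eshift g i j s x).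
  rewrite subKr distrC in h2; lra.
split.
- exact: smooth_eshift.
- by move=> x xr; apply: p0; apply: off => //; rewrite h0 lexx.
- move=> x.
  have e := derive_eshift i j h 0 0 1 x sg sp.
  rewrite -derive_slice_x in e; last exact: smooth_eshift_time.
  rewrite /= scale1r subr0 in e.
  rewrite [X in `|X|]e normrM; apply: ler_pM => //.
  rewrite mul0r subr0 mulr1; apply: (le_trans (ler_normD _ _)); rewrite normr1 lerD2l.
  rewrite normrM (ger0_norm h0); apply: ler_wpM2l => //; rewrite normrM.
  apply: le_trans (gL (x j ord0)); rewrite -[leRHS]mul1r; apply: ler_wpM2r => //.
  by case: (i == j); rewrite ?normr1 ?normr0.
- move=> t ath tc mu tmu.
  pose phi := fun p : R * E => psi (eshift g i j (t - p.1) p.2).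
  have B0 : 0 <= B by apply: le_trans (gB 0).
  (* [vanishing] involves times at distance up to [T + 1] from [t], too far for the sharp radius;
     the global bound [B] of [g] gives a cruder one. *)
  have vphi : vanishing T (r + (T + 1) * B) phi.
    move=> s x /andP[s0 sT] xr; apply: p0; apply: norm_off_cube => //.
    have T0 : 0 <= T + 1 by have ? := a0; have ? := cT; have ? := h0; lra.
    have := off_cube_norm (addr_ge0 r0 (mulr_ge0 T0 B0)) xr.
    have h2 := lerB_dist x (x - eshift g i j (t - s) x).
    have h1 : `|eshift g i j (t - s) x - x| <= (T + 1) * B.
      apply: (le_trans (eshift_norm _ _ _ _ _)); rewrite normrM; apply: ler_pM => //.
      by rewrite ler_norml; have ? := a0; have ? := cT; have ? := h0; lra.
    rewrite subKr distrC in h2; move=> ?; lra.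
  have tmu' := tmu phi _ (smooth_eshift_time i j t sg sp) vphi (M * rate) (t - h) t ath _ tc.
  have -> : \int[mu t]_x psi x = \int[mu t]_x phi (t, x).
    by apply: eq_Rintegral => x _; rewrite /phi/= subrr /eshift mul0r scale0r addr0.
  have -> : \int[mu (t - h)]_x psi' x = \int[mu (t - h)]_x phi (t - h, x).
    by apply: eq_Rintegral => x _; rewrite /phi/= opprB addrC subrK.
  apply: (le_trans (tmu' _ _)); last by rewrite opprB addrC subrK.
    by rewrite gerBl.
  move=> s x /andP[s1 s2].
  have sp' := smooth_eshift_time i j t sg sp.
  have e := derive_eshift i j t s 1 (f (x j ord0)) x sg sp.
  have -> : transport_op f i j phi (s, x) =
     'D_(1, f (x j ord0) *: delta_mx i ord0) phi (s, x).
    have -> : ((1, f (x j ord0) *: delta_mx i ord0) : R * E) =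
       (1, 0) + f (x j ord0) *: (0, delta_mx i ord0).
      by apply: injective_projections; rewrite /= ?scaler0 ?addr0 ?add0r.
    have dphi := smooth_differentiable (s, x) sp'.
    by rewrite deriveE// linearD linearZ/= -!deriveE.
  have sh : 0 <= t - s <= h by lra.
  have [xr|xr] := pselect (cube ((r + h * M0) / (1 - h * L)) x); last first.
    rewrite [X in `|X|]e (derive_off_cube _ sp p0 (off _ _ sh xr)) mulr0 normr0.
    rewrite mulr_ge0// addr_ge0// mulr_ge0 ?mulr_ge0// addr_ge0// mulr_ge0//.
    exact: le_trans rR.
  rewrite [X in `|X|]e normrM mulrC; apply: ler_pM => //.
  have xR : `|x j ord0| <= Rmax := le_trans (xr j) rR.
  have fR : `|f (x j ord0)| <= M0 + L * Rmax.
    by apply: (le_trans (fM _)); rewrite lerD2l; apply: ler_wpM2l.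
  rewrite mul1r; apply: (le_trans (ler_normD _ _)); rewrite /rate; apply: lerD.
    by rewrite distrC; exact: gf.
  have [sh0 sh1] := andP sh.
  rewrite normrM (ger0_norm sh0) -[leRHS]mulrA; apply: ler_pM => //.
  rewrite normrM mulrC; apply: ler_pM => //.
  rewrite normrM; apply: le_trans fR; rewrite -[leRHS]mul1r; apply: ler_wpM2r => //.
  by case: (i == j); rewrite ?normr1 ?normr0.
Qed.
End step.

(** Both curves transport the same approximate dual solution and agree at time [a], so their
    integrals of [psi] at time [c] differ by at most twice the accumulated residual, which can be
    made arbitrarily small. *)
Lemma transported_unique T a c f i j (L : R) (mu nu : R -> probability E R) :
  0 <= a -> a < c -> c <= T -> 0 <= L -> (forall s t, `|f s - f t| <= L * `|s - t|) ->
  (c - a) * L <= 2^-1 -> transported T a c f i j mu -> transported T a c f i j nu ->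
  (forall A, measurable A -> mu a A = nu a A) ->
  forall A, measurable A -> mu c A = nu c A.
Proof.
move=> a0 ac cT L0 fL tL tmu tnu munu; apply: probability_bump_unique => psi r' sp p0'.
pose r := `|r'|; have r0 : 0 <= r by exact: normr_ge0.
have p0 x : ~ cube r x -> psi x = 0.
  by move=> xr; apply: p0' => xr'; apply: xr => k; exact: (le_trans (xr' k) (ler_norm _)).
pose tau := c - a; have tau0 : 0 < tau by rewrite subr_gt0.
(* The extra 1 makes the growth bound hold for [g] too, which is within [del <= 1] of [f] at 0. *)
pose M0 := `|f 0| + 1; have M00 : 0 <= M0 by rewrite addr_ge0.
(* A cube for the supports of all backward steps. It is fixed before [g], which approximates [f]
   only on this range. *)
pose Rmax := 2 * (r + tau * M0).
have Rmax0 : 0 <= Rmax by rewrite mulr_ge0// addr_ge0// mulr_ge0// ltW.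
have cD := smooth_continuous (smooth_derive (delta_mx i ord0) sp).
have [M1 M10 M1P] := vanishing_bounded cD (fun x => derive_off_cube (delta_mx i ord0) sp p0).
pose F := M0 + L * Rmax; have F0 : 0 <= F by rewrite addr_ge0// mulr_ge0.
apply/eqP; rewrite -subr_eq0 -normr_le0; apply/ler_addgt0Pr => eta eta0; rewrite add0r.
(* Each of the two curves has error at most [tau * (2 * M1 * (del + h * L * F))], where [del] and
   [h * L * F] will both be at most [eta / D]. *)
pose D := 8 * M1 * tau + 1.
have D0 : 0 < D by rewrite ltr_wpDl// !mulr_ge0// ltW.
pose del := Num.min 1 (eta / D).
have del0 : 0 < del by rewrite lt_min ltr01 divr_gt0.
have [g sg [[B gB] gL gf]] := smooth_lipschitz_approx L0 fL Rmax del0.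
have [N NP] : exists N : nat, tau * L * F * D / eta < N.+1%:R.
  exists (Num.truncn (tau * L * F * D / eta)); exact: truncnS_gt.
pose h := tau / N.+1%:R.
have h0 : 0 < h by rewrite divr_gt0.
have Nh : N.+1%:R * h = tau by rewrite mulrC divfK.
have kh k : (k <= N.+1)%N -> k%:R * h <= tau.
  by move=> kN; rewrite -Nh; apply: ler_wpM2r; [exact: ltW|rewrite ler_nat].
have fM s : `|f s| <= M0 + L * `|s|.
  have := fL s 0; rewrite subr0 => h1; have := ler_dist_dist (f s) (f 0); rewrite /M0.
  have := ler_norm (`|f s| - `|f 0|); lra.
have gM s : `|g s| <= M0 + L * `|s|.
  have g0 : `|g 0| <= M0.
    have := gf 0; rewrite normr0 => /(_ Rmax0) h1.
    have := ler_dist_dist (g 0) (f 0); have := ler_norm (`|g 0| - `|f 0|).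
    have : del <= 1 by rewrite ge_min lexx.
    rewrite /M0; lra.
  have := @smooth_lipschitz g L sg gL s 0; rewrite subr0 => h1.
  have := ler_dist_dist (g s) (g 0); have := ler_norm (`|g s| - `|g 0|); lra.
have x1 k : (k <= N.+1)%N -> k%:R * (h * L) <= 2^-1.
  move=> kN; rewrite mulrA; apply: le_trans tL; apply: ler_wpM2r => //; exact: kh.
have hL1 : h * L < 1 by have := x1 1%N isT; rewrite mul1r; lra.
(* Bernoulli-type invariants instead of the powers [(1 - h * L)^-k] and [(1 + h * L)^k]: once
   multiplied by [1 - k * h * L], which is at least 1/2, the radius grows at most linearly and the
   gradient bound not at all. *)
have step k : (k <= N.+1)%N -> exists psik rk Mk,
  [/\ smooth psik, 0 <= rk /\ rk * (1 - k%:R * (h * L)) <= r + k%:R * h * M0,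
      forall x, ~ cube rk x -> psik x = 0,
      [/\ 0 <= Mk, Mk * (1 - k%:R * (h * L)) <= M1 &
      forall x, `|'D_(delta_mx i ord0) psik x| <= Mk] &
      forall mu, transported T a c f i j mu ->
        `|\int[mu c]_x psi x - \int[mu (c - k%:R * h)]_x psik x| <=
        k%:R * h * (2 * M1 * (del + h * L * F))].
  elim: k => [|k IH] kN.
    exists psi, r, M1; split => //.
    - by rewrite !mul0r subr0 mulr1 addr0.
    - by rewrite mul0r subr0 mulr1.
    - by move=> m _; rewrite !mul0r subr0 subrr normr0.
  have [psik [rk [Mk [spk [rk0 rkP] pk0 [Mk0 MkP MkD] IHk]]]] := IH (ltnW kN).
  have xk := x1 _ (ltnW kN); have xk1 := x1 _ kN.
  have hL0 : 0 <= h * L by rewrite mulr_ge0// ltW.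
  have hM0 : 0 <= h * M0 by rewrite mulr_ge0// ltW.
  have kk0 : 0 <= k%:R :> R by [].
  have k1 : k.+1%:R = k%:R + 1 :> R by rewrite natr1.
  have hL1' : 0 < 1 - h * L by rewrite subr_gt0.
  set rk' := (rk + h * M0) / (1 - h * L).
  have rk'0 : 0 <= rk' by rewrite divr_ge0 ?(ltW hL1')// addr_ge0.
  have rk'E : rk' * (1 - h * L) = rk + h * M0 by rewrite /rk' divfK// gt_eqF.
  have rk'P : rk' * (1 - k.+1%:R * (h * L)) <= r + k.+1%:R * h * M0.
    apply: (@le_trans _ _ (rk' * (1 - h * L) * (1 - k%:R * (h * L)))).
      rewrite -mulrA; apply: ler_wpM2l => //; rewrite k1.
      have : 0 <= k%:R * (h * L) * (h * L) by rewrite !mulr_ge0// ltW.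
      lra.
    rewrite rk'E mulrDl k1.
    have : 0 <= h * M0 * (k%:R * (h * L)) by rewrite !mulr_ge0// ltW.
    lra.
  have rk'R : rk' <= Rmax.
    have h1 := kh _ kN.
    have h2 : k.+1%:R * h * M0 <= tau * M0 by apply: ler_wpM2r.
    have h3 : rk' * 2^-1 <= rk' * (1 - k.+1%:R * (h * L)) by apply: ler_wpM2l => //; lra.
    rewrite /Rmax; lra.
  have Mk2 : Mk <= 2 * M1.
    have h3 : Mk * 2^-1 <= Mk * (1 - k%:R * (h * L)) by apply: ler_wpM2l => //; lra.
    lra.
  have [s1 s2 s3 s4] := euler_step j a0 cT L0 M00 sg gB gL gM fM gf (ltW del0) (ltW h0) hL1
     spk rk0 pk0 rk'R Mk0 MkD.
  exists (fun x => psik (eshift g i j h x)), rk', ((1 + h * L) * Mk); split => //.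
    split=> //; first by rewrite mulr_ge0// addr_ge0.
    apply: le_trans MkP; rewrite k1.
    have -> : (1 + h * L) * Mk * (1 - (k%:R + 1) * (h * L)) =
       Mk * (1 - k%:R * (h * L)) - Mk * (k%:R + 1) * (h * L) * (h * L) by ring.
    by rewrite gerBl; do 3![apply: mulr_ge0 => //]; rewrite addr_ge0.
  move=> m tm; have IHm := IHk m tm.
  have h1 := kh _ kN; have h1' := kh _ (ltnW kN).
  have e1 : c - k%:R * h - h = c - k.+1%:R * h by rewrite k1 mulrDl mul1r opprD addrA.
  have := s4 (c - k%:R * h) _ _ m tm; rewrite e1 => /(_ _ _) h2.
  have {}h2 : `|\int[m (c - k%:R * h)]_x psik x -
      \int[m (c - k.+1%:R * h)]_x psik (eshift g i j h x)| <= Mk * (del + h * L * F) * h.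
    apply: h2; last by rewrite gerBl mulr_ge0// ltW.
    by move: h1; rewrite /tau; lra.
  have h3 : Mk * (del + h * L * F) * h <= 2 * M1 * (del + h * L * F) * h.
    apply: ler_wpM2r; first exact: ltW.
    by apply: ler_wpM2r => //; rewrite addr_ge0 ?(ltW del0)// mulr_ge0.
  apply: (le_trans (ler_distD (\int[m (c - k%:R * h)]_x psik x) _ _)).
  have -> : k.+1%:R * h * (2 * M1 * (del + h * L * F)) =
    k%:R * h * (2 * M1 * (del + h * L * F)) + 2 * M1 * (del + h * L * F) * h.
    by rewrite k1; ring.
  by apply: lerD => //; exact: le_trans h3.
have [psiN [rN [MN [spN _ pN0 _ H]]]] := step _ (leqnn _).
have Hm := H _ tmu; have Hn := H _ tnu; rewrite Nh in Hm Hn.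
have ea : c - tau = a by rewrite /tau; ring.
rewrite ea in Hm Hn.
have eN : \int[mu a]_x psiN x = \int[nu a]_x psiN x.
  rewrite /Rintegral; congr fine; apply: eq_measure_integral => A mA _; exact: munu.
rewrite eN in Hm.
have hD : h * L * F * D <= eta.
  have : tau * L * F * D / eta <= N.+1%:R := ltW NP.
  rewrite ler_pdivrMr// => h1.
  rewrite -(@ler_pM2l _ N.+1%:R)// -[X in X <= _]/(_ * (_ * _)).
  by apply: le_trans h1; rewrite -Nh le_eqVlt; apply/orP; left; apply/eqP; ring.
have dD : del * D <= eta.
  by rewrite -ler_pdivlMr// ge_min lexx orbT.
have fin : tau * (2 * M1 * (del + h * L * F)) <= eta / 2.
  have : (del + h * L * F) * D <= 2 * eta by rewrite mulrDl; lra.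
  have : 0 <= del + h * L * F by rewrite addr_ge0 ?(ltW del0)// !mulr_ge0// ltW.
  rewrite /D; set q := del + _; move=> q0 h1.
  have -> : tau * (2 * M1 * q) = (q * (8 * M1 * tau)) / 4 by field.
  lra.
move: Hm Hn; rewrite !ler_norml; lra.
Qed.
End euler_dual.

(** * Existence *)

Section flowmap.
Context {R : realType} {d : nat}.
Local Notation E := 'cV[R]_d.
Variables (f : nat -> R -> R) (ii jj : nat -> 'I_d) (u : nat -> R -> R -> R).
Hypothesis fL : forall k s t, `|f k s - f k t| <= 2^-1 * `|s - t|.
Hypothesis u_init : forall k s, u k 0 s = 0.
Hypothesis u_time : forall k t t' s, `|u k t s - u k t' s| <= 2 * `|f k s| * `|t - t'|.
Hypothesis u_space : forall k t s s', `|u k t s - u k t s'| <= `|s - s'|.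
Hypothesis u_derive : forall k (t s : R), 0 < t < 1 ->
  is_derive t (1 : R) (u k ^~ s) (f k (s + (ii k == jj k)%:R * u k t s)).

(** Time is clamped in each factor separately, so at time [r] only the command whose slot contains
    [r] is moving. *)
Fixpoint flowmap n (r : R) (x : E) : E :=
  if n is m.+1 then
    let y := flowmap m r x in
    y + u m (clamp01 (r - m%:R)) (y (jj m) ord0) *: delta_mx (ii m) ord0
  else x.

Lemma norm_delta_le i (a : R) : `|a *: (delta_mx i ord0 : E)| <= `|a|.
Proof.
apply: norm_cV_le => // k; rewrite !mxE eqxx andbT normrM.
by case: (k == i); rewrite ?normr1 ?mulr1// normr0 mulr0.
Qed.

Lemma flowmap_lip_x n r x y : `|flowmap n r x - flowmap n r y| <= 2 ^+ n * `|x - y|.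
Proof.
elim: n => [|n IH] /=; first by rewrite expr0 mul1r.
set a := flowmap n r x in IH *; set b := flowmap n r y in IH *.
rewrite opprD addrACA -scalerBl; apply: (le_trans (ler_normD _ _)).
have h1 : `|(u n (clamp01 (r - n%:R)) (a (jj n) ord0) -
    u n (clamp01 (r - n%:R)) (b (jj n) ord0)) *: (delta_mx (ii n) ord0 : E)| <= `|a - b|.
  apply: (le_trans (norm_delta_le _ _)); apply: (le_trans (u_space _ _ _ _)).
  by have := coord_le_norm (a - b) (jj n); rewrite !mxE.
rewrite exprS; move: h1 IH; set p := `|_ *: _|; lra.
Qed.

Lemma f_growth k s : `|f k s| <= `|f k 0| + 2^-1 * `|s|.
Proof.
have := fL k s 0; rewrite subr0; have := ler_dist_dist (f k s) (f k 0).
have := ler_norm (`|f k s| - `|f k 0|); lra.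
Qed.

Lemma flowmap_bound n (C : R) : 0 <= C ->
  exists2 B, 0 <= B & forall r x, `|x| <= C -> `|flowmap n r x| <= B.
Proof.
move=> C0; elim: n => [|n [B B0 IH]]; first by exists C.
exists (B + 2 * (`|f n 0| + 2^-1 * B)) => [|r x xC /=].
  by rewrite addr_ge0// mulr_ge0// addr_ge0// mulr_ge0.
apply: (le_trans (ler_normD _ _)); apply: lerD; first exact: IH.
apply: (le_trans (norm_delta_le _ _)); set y := flowmap n r x.
have := u_time n (clamp01 (r - n%:R)) 0 (y (jj n) ord0); rewrite u_init !subr0 => h.
apply: (le_trans h); rewrite (ger0_norm (clamp01_ge0 _)) -[leRHS]mulr1.
apply: ler_pM; rewrite ?mulr_ge0 ?clamp01_ge0 ?clamp01_le1//.
apply: ler_wpM2l => //; apply: (le_trans (f_growth _ _)); rewrite lerD2l.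
by apply: ler_wpM2l => //; apply: (le_trans (coord_le_norm _ _)); exact: IH.
Qed.

Lemma flowmap_lip_t n (C : R) : 0 <= C ->
  exists2 K, 0 <= K & forall r r' x, `|x| <= C ->
    `|flowmap n r x - flowmap n r' x| <= K * `|r - r'|.
Proof.
move=> C0; elim: n => [|n [K K0 IH]].
  by exists 0 => // r r' x _; rewrite subrr normr0 mul0r.
have [B B0 HB] := flowmap_bound n C0.
pose D := 2 * (`|f n 0| + 2^-1 * B).
have D0 : 0 <= D by rewrite mulr_ge0// addr_ge0// mulr_ge0.
exists (K + (D + K)) => [|r r' x xC /=]; first by rewrite !addr_ge0.
set a := flowmap n r x; set b := flowmap n r' x.
have ab : `|a - b| <= K * `|r - r'| by exact: IH.
rewrite opprD addrACA -scalerBl; apply: (le_trans (ler_normD _ _)).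
rewrite mulrDl; apply: lerD => //; apply: (le_trans (norm_delta_le _ _)).
set c := clamp01 (r - n%:R); set c' := clamp01 (r' - n%:R).
have h1 : `|c - c'| <= `|r - r'|.
  by apply: (le_trans (clamp01_lip _ _)); rewrite opprB addrA subrK.
have h2 : `|u n c (a (jj n) ord0) - u n c (b (jj n) ord0)| <= K * `|r - r'|.
  apply: (le_trans (u_space _ _ _ _)); apply: le_trans ab.
  by have := coord_le_norm (a - b) (jj n); rewrite !mxE.
have h3 : `|u n c (b (jj n) ord0) - u n c' (b (jj n) ord0)| <= D * `|r - r'|.
  apply: (le_trans (u_time _ _ _ _)); apply: ler_pM; rewrite ?mulr_ge0//.
  apply: ler_wpM2l => //; apply: (le_trans (f_growth _ _)); rewrite lerD2l.
  by apply: ler_wpM2l => //; apply: (le_trans (coord_le_norm _ _)); exact: HB.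
apply: (le_trans (ler_distD (u n c (b (jj n) ord0)) _ _)); rewrite mulrDl; lra.
Qed.

Lemma flowmap0 n x : flowmap n 0 x = x.
Proof.
elim: n => //= n ->; rewrite sub0r (_ : clamp01 _ = 0) ?u_init ?scale0r ?addr0//.
by rewrite /clamp01 max_l// ge_min oppr_le0 ler0n.
Qed.

Lemma flowmap_late n r r' x : n%:R <= r -> n%:R <= r' -> flowmap n r x = flowmap n r' x.
Proof.
have cl t : 1 <= t -> clamp01 t = 1 by move=> t1; rewrite /clamp01 min_r// max_r.
elim: n => //= n IH; rewrite -natr1 => h h'.
rewrite (IH _ _) ?cl//; lra.
Qed.

Lemma flowmap_early k n r x : (k <= n)%N -> r <= k%:R -> flowmap n r x = flowmap k r x.
Proof.
move=> kn rk; elim: n kn => [|n IH]; first by rewrite leqn0 => /eqP->.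
rewrite leq_eqVlt => /predU1P[->//|/[!ltnS] kn] /=.
rewrite (IH kn) (_ : clamp01 _ = 0) ?u_init ?scale0r ?addr0//.
have : k%:R <= n%:R :> R by rewrite ler_nat.
by move=> h; rewrite /clamp01 max_l// ge_min subr_le0 (le_trans rk h).
Qed.

(** Within slot [k] the later factors are still the identity and the earlier ones are frozen at [y].
    If [ii k = jj k], the coordinate being read moves too: this is the coefficient in the scalar
    equation. *)
Lemma flowmap_derive k n (r : R) x : (k < n)%N -> k%:R < r < k.+1%:R ->
  is_derive r (1 : R) (fun r => flowmap n r x)
    (fld (f k) (ii k) (jj k) (flowmap n r x)).
Proof.
move=> kn /andP[kr rk]; set y := flowmap k k%:R x.
have E0 r' : k%:R < r' -> r' < k.+1%:R -> flowmap n r' x =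
    y + u k (r' - k%:R) (y (jj k) ord0) *: delta_mx (ii k) ord0.
  move=> h1 h2; rewrite (flowmap_early _ kn (ltW h2))/=.
  rewrite (@flowmap_late k r' k%:R x)// ?ltW// clamp01_id//.
  by move: h2; rewrite -natr1; lra.
have r01 : 0 < r - k%:R < 1 by move: rk; rewrite -natr1; lra.
have dk : is_derive r (1 : R) (fun r : R => r - k%:R) 1.
  have := is_deriveB (is_derive_id r (1 : R)) (is_derive_cst (k%:R : R) r (1 : R)).
  by rewrite subr0.
have du : is_derive r (1 : R) (fun r : R => u k (r - k%:R) (y (jj k) ord0))
    (f k (y (jj k) ord0 + (ii k == jj k)%:R * u k (r - k%:R) (y (jj k) ord0))).
  have := @is_derive1_comp _ (u k ^~ (y (jj k) ord0)) (fun r : R => r - k%:R) r _ _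
    (u_derive k (y (jj k) ord0) r01) dk.
  by rewrite mulr1.
have := is_derive_ray y (delta_mx (ii k) ord0 : E) du.
rewrite {1}/fld E0// => h.
have -> : f k ((y + u k (r - k%:R) (y (jj k) ord0) *: delta_mx (ii k) ord0) (jj k) ord0) =
  f k (y (jj k) ord0 + (ii k == jj k)%:R * u k (r - k%:R) (y (jj k) ord0)).
  by rewrite !mxE eqxx andbT mulrC eq_sym.
apply: near_eq_is_derive h; near=> r'; rewrite E0//; near: r'.
  exact: lt_nbhsr.
exact: lt_nbhsl.
Unshelve. all: by end_near. Qed.

End flowmap.

(** * Laws and differentiation under the integral *)

Definition law {d1 d2} {T1 : measurableType d1} {T2 : measurableType d2} {R : realType}
    (P : probability T1 R) (X : T1 -> T2) (mX : measurable_fun setT X) : probability T2 R :=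
  let h := isMeasurableFun.Build _ _ _ _ X mX in
  distribution P (HB.pack X h : {mfun T1 >-> T2}).

Section law.
Context {d1 d2 : measure_display} {T1 : measurableType d1} {T2 : measurableType d2}.
Context {R : realType}.
Variables (P : probability T1 R) (X : T1 -> T2) (mX : measurable_fun setT X).

Lemma lawE A : law P mX A = P (X @^-1` A).
Proof. by []. Qed.

Lemma ge0_integral_law (h : T2 -> \bar R) : measurable_fun setT h ->
  (forall y, 0 <= h y)%E -> (\int[law P mX]_y h y = \int[P]_x h (X x))%E.
Proof. by move=> mh h0; rewrite ge0_integral_distribution. Qed.

Lemma integral_law (h : T2 -> R) : measurable_fun setT h ->
  P.-integrable setT (EFin \o (h \o X)) ->
  (\int[law P mX]_y (h y)%:E = \int[P]_x (h (X x))%:E)%E.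
Proof.
by move=> mh ih; apply: (@integral_pushforward _ _ _ _ _ X mX P setT (EFin \o h)) => //; exact/measurable_EFinP.
Qed.
End law.

Lemma probability_integral_cst {dd} {Y : measurableType dd} {R : realType}
  (P : probability Y R) (c : R) : (\int[P]_x c%:E = c%:E)%E.
Proof. by rewrite -[RHS]mule1 -(@probability_setT _ _ _ P) -integral_cst. Qed.

Section leibniz.
Context {dd : measure_display} {Y : measurableType dd} {R : realType}.
Variables (P : probability Y R) (F G : R -> Y -> R) (M a b : R).
Hypotheses (mF : forall t, measurable_fun setT (F t)) (mG : forall t, measurable_fun setT (G t)).
Hypotheses (FM : forall t y, `|F t y| <= M) (GM : forall t y, `|G t y| <= M).
Hypotheses (cF : forall y, continuous (F^~ y)) (cG : forall y, continuous (G^~ y)).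
Hypothesis dF : forall t y, a < t < b -> is_derive t (1 : R) (F^~ y) (G t y).
Local Notation leb := (@lebesgue_measure R).

Lemma continuous_mean (H : R -> Y -> R) : (forall t, measurable_fun setT (H t)) ->
  (forall t y, `|H t y| <= M) -> (forall y, continuous (H^~ y)) ->
  continuous (fun t => \int[P]_y H t y).
Proof.
move=> mH HM cH t.
have iM : P.-integrable setT (EFin \o cst M) by apply: (@bounded_integrable _ _ _ _ _ `|M|).
have := @continuity_under_integral R _ Y P H setT measurableT (t - 1) (t + 1) _ _ (cst M) iM.
apply.
- by move=> x _; apply: bounded_integrable (HM x).
- by apply: aeW => y _ x _; exact: cH.
- by move=> x _; apply: aeW => y _; exact: HM.
- by rewrite inE/= in_itv/=; apply/andP; split; lra.
Qed.

(** The derivative is required only inside the interval, since the velocity jumps at the ends of a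
    piece. *)
Lemma leibniz_itv : a <= b ->
  \int[leb]_(t in `[a, b]) \int[P]_y G t y = \int[P]_y F b y - \int[P]_y F a y.
Proof.
move=> ab; apply: (@FTC_itv _ (fun t => \int[P]_y F t y)) => //; [exact: continuous_mean|exact: continuous_mean|].
move=> t atb.
have It : `]a, b[%classic t by rewrite /= in_itv.
have iF x : `]a, b[%classic x -> P.-integrable setT (EFin \o F x).
  by move=> _; apply: bounded_integrable (FM x).
have iM : P.-integrable setT (EFin \o cst `|M|).
  by apply: (@bounded_integrable _ _ _ _ _ `|M|) => // y; rewrite normr_id.
have dF1 x y : `]a, b[%classic x -> setT y -> derivable (F^~ y) x 1.
  by rewrite /= in_itv/= => xab _; case: (dF y xab).
have dFE x y : a < x < b -> (F^~ y : R -> R)^`()%classic x = G x y.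
  by move=> xab; rewrite derive1E (@derive_val _ _ _ _ _ _ _ (dF y xab)).
have GB x y : `]a, b[%classic x -> setT y -> `|partial1of2 F x y| <= cst `|M| y.
  rewrite /= in_itv/= => xab _; rewrite /partial1of2 dFE//.
  by apply: (le_trans (GM x y)); exact: ler_norm.
apply: DeriveDef.
  exact: (@derivable_under_integral R _ Y P F setT measurableT t a b It iF dF1 (cst `|M|) _ iM GB).
rewrite -derive1E (@differentiation_under_integral R _ Y P F setT measurableT t a b It iF dF1 (cst `|M|) _ iM GB)//.
by apply: eq_Rintegral => y _; exact: dFE.
Qed.
End leibniz.

Lemma lipschitz_continuous_map {R : realType} (V W : normedModType R) (g : V -> W) (K : R) :
  (forall x y, `|g x - g y| <= K * `|x - y|) -> continuous g.
Proof.
move=> gK x; apply/cvgrPdist_le => e e0.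
have K1 : 0 < `|K| + 1 by rewrite ltr_wpDl.
near=> y; apply: (le_trans (gK _ _)).
apply: (@le_trans _ _ ((`|K| + 1) * `|x - y|)).
  by apply: ler_wpM2r => //; apply: (le_trans (ler_norm _)); rewrite lerDl.
rewrite mulrC -ler_pdivlMr//; near: y.
apply: cvgr_dist_le; first exact: cvg_id.
exact: divr_gt0.
Unshelve. all: by end_near. Qed.

(* Flows are precomposed with the retraction onto a cube carrying mu0: this    *)
(* changes no law, and bounds all integrands.                                 *)
Section retraction.
Context {R : realType} {d : nat}.
Local Notation E := 'cV[R]_d.

Definition retract (r : R) (x : E) : E :=
  \col_i (clampT (2 * r) (x i ord0 + r) - r).

Lemma retract_norm r x : 0 < r -> `|retract r x| <= r.
Proof.
move=> r0; apply: norm_cV_le; first exact: ltW.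
have r20 : 0 < 2 * r by lra.
move=> i; rewrite mxE; have := clampT_itv (x i ord0 + r) r20.
by rewrite in_itv/= ler_norml; lra.
Qed.

Lemma retract_id r x : cube r x -> retract r x = x.
Proof.
move=> xr; apply/matrixP => i j; rewrite !mxE (ord1 j).
have := xr i; rewrite ler_norml => h; rewrite clampT_id ?addrK// in_itv/=; lra.
Qed.

Lemma retract_lip r x y : 0 < r -> `|retract r x - retract r y| <= `|x - y|.
Proof.
move=> r0; apply: norm_cV_le => // i; rewrite !mxE.
have r20 : 0 < 2 * r by lra.
rewrite opprB addrA subrK; apply: (le_trans (clampT_lip _ _ r20)).
rewrite opprD addrACA subrr addr0.
by have := coord_le_norm (x - y) i; rewrite !mxE.
Qed.
End retraction.

(** * The flow of a list of commands as a weak solution *)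

Section existence.
Context {R : realType} {d : nat}.
Local Notation E := 'cV[R]_d.
Local Notation leb := (@lebesgue_measure R).
Variables (f : nat -> R -> R) (ii jj : nat -> 'I_d) (u : nat -> R -> R -> R).
Hypothesis fL : forall k s t, `|f k s - f k t| <= 2^-1 * `|s - t|.
Hypothesis u_init : forall k s, u k 0 s = 0.
Hypothesis u_time : forall k t t' s, `|u k t s - u k t' s| <= 2 * `|f k s| * `|t - t'|.
Hypothesis u_space : forall k t s s', `|u k t s - u k t s'| <= `|s - s'|.
Hypothesis u_derive : forall k (t s : R), 0 < t < 1 ->
  is_derive t (1 : R) (u k ^~ s) (f k (s + (ii k == jj k)%:R * u k t s)).
Variables (T : R) (N : nat) (r0 : R) (mu0 : probability E R).
Hypotheses (T0 : 0 < T) (N0 : (0 < N)%N) (r00 : 0 < r0).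
Hypothesis supp : (mu0 (~` cube r0) = 0)%E.

Definition step_time := T / N%:R.
Definition flow_at (t : R) (x : E) : E := flowmap ii jj u N (t / step_time) (retract r0 x).
Local Notation tau := step_time.
Local Notation X := flow_at.

Let tau0 : 0 < tau. Proof. by rewrite divr_gt0// ltr0n. Qed.

Lemma flow_at_lip_x t x y : `|X t x - X t y| <= 2 ^+ N * `|x - y|.
Proof.
apply: (le_trans (flowmap_lip_x _ _ u_space _ _ _ _)).
by apply: ler_wpM2l; [rewrite exprn_ge0|exact: retract_lip].
Qed.

Lemma flow_at_lip_t : exists2 K, 0 <= K & forall t t' x, `|X t x - X t' x| <= K * `|t - t'|.
Proof.
have [K K0 H] := flowmap_lip_t ii jj fL u_init u_time u_space N (ltW r00).
exists (K / tau) => [|t t' x]; first by rewrite divr_ge0// ltW.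
apply: (le_trans (H _ _ _ (retract_norm x r00))).
by rewrite -mulrBl normrM (@ger0_norm _ tau^-1) ?invr_ge0 ?(ltW tau0)// mulrA mulrAC.
Qed.

Lemma flow_at_bound : exists2 B, 0 <= B & forall t x, `|X t x| <= B.
Proof.
have [B B0 H] := flowmap_bound ii jj fL u_init u_time N (ltW r00).
by exists B => // t x; apply: H; exact: retract_norm.
Qed.

Lemma flow_at_continuous t : continuous (X t).
Proof. exact: lipschitz_continuous_map (flow_at_lip_x t). Qed.

Lemma measurable_flow_at t : measurable_fun setT (X t).
Proof.
apply: measurable_cV_map => i; apply: measurable_cV_continuous => x.
apply: (@continuous_comp _ _ _ (X t) (fun y : E => y i ord0)); first exact: flow_at_continuous.
exact: coord_continuous.
Qed.

Definition flow_law t : probability E R := law mu0 (measurable_flow_at t).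

Lemma flow_at0 x : X 0 x = retract r0 x.
Proof. by rewrite /flow_at mul0r (flowmap0 ii jj u_init). Qed.

Lemma flow_at_derive k t x : (k < N)%N -> k%:R * tau < t < k.+1%:R * tau ->
  is_derive t (1 : R) (X ^~ x) (fld (fun s => tau^-1 * f k s) (ii k) (jj k) (X t x)).
Proof.
move=> kN tk.
have tk' : k%:R < t / tau < k.+1%:R by rewrite ltr_pdivlMr// ltr_pdivrMr.
have d1 : is_derive t (1 : R) (fun t : R => t / tau) tau^-1.
  have := @is_derive_ray R R^o 0 (tau^-1 : R^o) id t 1 (is_derive_id _ _).
  rewrite scale1r; apply: near_eq_is_derive; near=> s.
  by rewrite add0r.
have d2 := flowmap_derive u_init u_derive (retract r0 x) kN tk'.
have D1 : differentiable (fun t : R => t / tau) t by apply/derivable1_diffP; case: d1.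
have D2 : differentiable (fun r => flowmap ii jj u N r (retract r0 x)) (t / tau).
  by apply/derivable1_diffP; case: d2.
apply: DeriveDef.
  by apply/derivable1_diffP; exact: (differentiable_comp D1 D2).
rewrite deriveE; last exact: (differentiable_comp D1 D2).
rewrite (diff_comp D1 D2)/= -(deriveE _ D1) (@derive_val _ _ _ _ _ _ _ d1).
rewrite -[X in 'd _ _ X]mulr1 [LHS]linearZ/= -(deriveE _ D2) (@derive_val _ _ _ _ _ _ _ d2).
by rewrite /fld scalerA.
Unshelve. all: by end_near. Qed.

Lemma flow_law_moment t : finite_second_moment (flow_law t).
Proof.
rewrite /finite_second_moment ge0_integral_law; last 2 first.
- by apply/measurable_EFinP; apply: measurable_enorm_sq.
- by move=> y; rewrite lee_fin sqr_ge0.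
have [B B0 BP] := flow_at_bound.
apply: (@le_lt_trans _ _ (\int[mu0]_x (d%:R * B ^+ 2)%:E)%E).
  apply: ge0_le_integral => //.
  - by move=> x _; rewrite lee_fin sqr_ge0.
  - apply/measurable_EFinP; apply: measurable_enorm_sq; exact: measurable_flow_at.
  - move=> x _; rewrite lee_fin; apply: (@enorm_sq_le _ _ _ B) => i.
    by apply: (le_trans (coord_le_norm _ _)).
by rewrite probability_integral_cst ltry.
Qed.

(** The joint law of [(X s, X t)] under [mu0] is a coupling, whose cost is bounded by the Lipschitz
    constant of the flow in time. The factor [d], rather than its square root, avoids a root. *)
Lemma flow_law_continuous : W2_continuous T flow_law.
Proof.
move=> t _; have [K K0 KP] := flow_at_lip_t.
have WP s : (W2 (flow_law s) (flow_law t) <= (d%:R * K * `|s - t|)%:E)%E.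
  have mst : measurable_fun setT (fun x => (X s x, X t x)).
    by apply: measurable_fun_pair; exact: measurable_flow_at.
  apply: (@coupling_W2 _ _ _ _ (law mu0 mst)); first by rewrite !mulr_ge0.
    by split => A mA; rewrite lawE.
  rewrite ge0_integral_law; last 2 first.
  - by apply/measurable_EFinP; exact: measurable_cost.
  - by move=> y; rewrite lee_fin sqr_ge0.
  apply: (@le_trans _ _ (\int[mu0]_x ((d%:R * K * `|s - t|) ^+ 2)%:E)%E); last first.
    by rewrite probability_integral_cst.
  apply: ge0_le_integral => //.
  - by move=> x _; rewrite lee_fin sqr_ge0.
  - apply/measurable_EFinP; apply: measurable_enorm_sq.
    by apply: measurable_cV_sub; exact: measurable_flow_at.
  move=> x _; rewrite lee_fin /=.
  have h : forall i, `|(X s x - X t x) i ord0| <= K * `|s - t|.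
    by move=> i; apply: (le_trans (coord_le_norm _ _)); exact: KP.
  apply: (le_trans (enorm_sq_le h)); rewrite -mulrA [leRHS]exprMn.
  apply: ler_wpM2r; first exact: sqr_ge0.
  by case: (d) => [|k]; rewrite ?expr0n//= -natrX ler_nat expnS expn1 leq_pmull.
have lim : (d%:R * K * `|s - t|)%:E @[s --> within `[0, T] (nbhs t)] --> 0%E.
  apply: cvg_EFin; first exact: nearW.
  have h0 : (d%:R * K * `|s - t|) @[s --> t] --> (0 : R).
    have h1 : `|s - t| @[s --> t] --> (0 : R).
      rewrite -(@normr0 _ R) -(subrr t).
      by apply: cvg_norm; apply: cvgB; [exact: cvg_id|exact: cvg_cst].
    by rewrite -(mulr0 (d%:R * K)); apply: cvgM => //; exact: cvg_cst.
  exact: cvg_within_filter h0.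
apply: (@squeeze_cvge _ _ _ _ (cst 0%E) _ _ _ _ _ lim).
  by apply: nearW => s; rewrite W2_ge0 WP.
exact: cvg_cst.
Qed.

Variable V : R -> E -> E.
Hypothesis VP : forall k t, (k < N)%N -> k%:R * tau <= t < k.+1%:R * tau ->
  V t = fld (fun s => tau^-1 * f k s) (ii k) (jj k).

Let f_cont k : continuous (fun s => tau^-1 * f k s).
Proof.
move=> s; apply: cvgM; first exact: cvg_cst.
by apply: (@lipschitz_cont _ _ 2^-1) => a b; exact: fL.
Qed.

Lemma is_derive_phi_flow (phi : R * E -> R) k t x : smooth phi -> (k < N)%N ->
  k%:R * tau < t < k.+1%:R * tau ->
  is_derive t (1 : R) (fun t => phi (t, X t x))
    (transport_op (fun s => tau^-1 * f k s) (ii k) (jj k) phi (t, X t x)).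
Proof.
move=> sp kN tk; set a := tau^-1 * f k (X t x (jj k) ord0).
have dX := flow_at_derive x kN tk.
have dp := smooth_differentiable (t, X t x) sp.
have dX' : differentiable (X ^~ x) t by apply/derivable1_diffP; case: dX.
have did : differentiable (id : R -> R) t by [].
have dpair : is_derive t (1 : R) (fun t : R => (t, X t x)) (1, a *: delta_mx (ii k) ord0).
  apply: DeriveDef.
    by apply/derivable1_diffP; exact: (differentiable_pair did dX').
  rewrite deriveE; last exact: (differentiable_pair did dX').
  rewrite (diff_pair did dX')/= diff_val; congr (_, _).
  by rewrite -(deriveE _ dX') (@derive_val _ _ _ _ _ _ _ dX).
have := derive_line dp dpair erefl.
rewrite /transport_op -/a.
have -> : ((1, a *: delta_mx (ii k) ord0) : R * E) = (1, 0) + a *: (0, delta_mx (ii k) ord0).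
  by apply: injective_projections; rewrite /= ?scaler0 ?addr0 ?add0r.
by rewrite (deriveE _ dp) linearD linearZ/= -!(deriveE _ dp).
Qed.

Let cl t := clampT T t.
Let q k (phi : R * E -> R) t x :=
  transport_op (fun s => tau^-1 * f k s) (ii k) (jj k) phi (cl t, X (cl t) x).
Let m (phi : R * E -> R) t x := phi (cl t, X (cl t) x).

Let clX_cont x : continuous (fun t => (cl t, X (cl t) x)).
Proof.
have [K K0 KP] := flow_at_lip_t.
apply: (@lipschitz_continuous_map _ R^o (R * E)%type _ (1 + K)) => s t.
have h := clampT_lip s t T0.
rewrite prod_normE/= ge_max; apply/andP; split.
  by apply: (le_trans h); rewrite mulrDl mul1r lerDl mulr_ge0.
apply: (le_trans (KP _ _ _)); rewrite mulrDl mul1r.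
by apply: ler_wpDl => //; apply: ler_wpM2l.
Qed.

Let bounded_along (z : R * E -> R) : continuous z ->
  exists M, forall t x, `|z (cl t, X (cl t) x)| <= M.
Proof.
move=> cz; have [B B0 BP] := flow_at_bound.
have cK : compact (`[0, T]%classic `*` @cube R d B).
  by apply: compact_setX; [exact: segment_compact|exact: compact_cube].
have [M _ MP] := compact_bounded_fun cK cz.
exists M => t x; apply: MP; split; first exact: clampT_itv.
by move=> i; apply: (le_trans (coord_le_norm (X (cl t) x) i)); exact: BP.
Qed.

Let along_measurable (z : R * E -> R) t : continuous z ->
  measurable_fun setT (fun x => z (cl t, X (cl t) x)).
Proof.
move=> cz; apply: measurable_cV_continuous => x.
apply: (@continuous_comp _ _ _ (fun x => (cl t, X (cl t) x)) z); last exact: cz.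
apply: (@continuous_comp _ _ _ (X (cl t)) (fun y => (cl t, y))).
  exact: flow_at_continuous.
exact: continuous_pairl.
Qed.

Let along_continuous (z : R * E -> R) x : continuous z ->
  continuous (fun t => z (cl t, X (cl t) x)).
Proof.
move=> cz t; apply: (@continuous_comp _ _ _ (fun t => (cl t, X (cl t) x)) z).
  exact: clX_cont.
exact: cz.
Qed.

Let k_le k : (k <= N)%N -> k%:R * tau <= T.
Proof.
move=> kN; rewrite /step_time mulrCA ler_piMr ?(ltW T0)//.
by rewrite ler_pdivrMr ?ltr0n// mul1r ler_nat.
Qed.

Lemma flow_piece phi k : smooth phi -> (k < N)%N ->
  \int[leb]_(t in `[k%:R * tau, k.+1%:R * tau]) \int[mu0]_x q k phi t x =
  \int[mu0]_x m phi (k.+1%:R * tau) x - \int[mu0]_x m phi (k%:R * tau) x.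
Proof.
move=> sp kN; have cp := smooth_continuous sp.
have cq := @transport_op_continuous _ _ _ (ii k) (jj k) phi (@f_cont k) sp.
have [M1 M1P] := bounded_along cp; have [M2 M2P] := bounded_along cq.
have kT := k_le kN.
apply: (@leibniz_itv _ _ _ _ _ _ (Num.max M1 M2)).
- by move=> t; exact: along_measurable.
- by move=> t; exact: along_measurable.
- by move=> t x; rewrite le_max M1P.
- by move=> t x; rewrite le_max M2P orbT.
- by move=> x; exact: along_continuous.
- by move=> x; exact: along_continuous.
- move=> t x /[dup] tk /andP[tk1 tk2].
  have t0 : 0 < t by apply: le_lt_trans tk1; rewrite mulr_ge0// ltW.
  have tT : t < T by exact: lt_le_trans kT.
  have clt : cl t = t by apply: clampT_id; rewrite in_itv/= !ltW.
  have := is_derive_phi_flow x sp kN tk; rewrite /q clt.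
  apply: near_eq_is_derive; near=> s; rewrite /m /cl clampT_id// in_itv/=.
  apply/andP; split; apply: ltW; near: s; [exact: lt_nbhsr|exact: lt_nbhsl].
- by apply: ler_wpM2r; [exact: ltW|rewrite ler_nat].
Unshelve. all: by end_near. Qed.

Let mean_cont (z : R * E -> R) : continuous z ->
  continuous (fun t => \int[mu0]_x z (cl t, X (cl t) x)).
Proof.
move=> cz; have [M MP] := bounded_along cz.
apply: (@continuous_mean _ _ _ mu0 M) => [t|t x|x]; [exact: along_measurable|exact: MP|].
exact: along_continuous.
Qed.

Let weak_integrand (phi : R * E -> R) t : (\bar R) :=
  (\int[flow_law t]_x (dt phi t x + dot (grad phi t x) (V t x))%:E)%E.

Let weak_integrandE phi k t : smooth phi -> (k < N)%N -> k%:R * tau <= t < k.+1%:R * tau ->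
  weak_integrand phi t = (\int[mu0]_x q k phi t x)%:E.
Proof.
move=> sp kN tk; have cq := @transport_op_continuous _ _ _ (ii k) (jj k) phi (@f_cont k) sp.
have [t1 t2] := andP tk.
have t0 : 0 <= t by apply: le_trans t1; rewrite mulr_ge0// ltW.
have tT : t <= T by rewrite (le_trans (ltW t2))// k_le.
have clt : cl t = t by apply: clampT_id; rewrite in_itv/= t0.
rewrite /weak_integrand (VP kN tk).
have -> : (fun x => (dt phi t x + dot (grad phi t x) (fld (fun s => tau^-1 * f k s) (ii k) (jj k) x))%:E) =
   (fun x => (transport_op (fun s => tau^-1 * f k s) (ii k) (jj k) phi (t, x))%:E).
  apply/funext => x; congr EFin; rewrite dot_fld /transport_op /dt derive_slice_t//.
  by rewrite /grad mxE derive_slice_x.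
have [M MP] := bounded_along cq.
have mq := along_measurable t cq.
rewrite clt in mq.
have iq : mu0.-integrable setT (EFin \o (fun x =>
   transport_op (fun s => tau^-1 * f k s) (ii k) (jj k) phi (t, X t x))).
  have hM x : `|transport_op (fun s => tau^-1 * f k s) (ii k) (jj k) phi (t, X t x)| <= M.
    by have := MP t x; rewrite clt.
  exact: bounded_integrable mq hM.
have mt : measurable_fun setT (fun x : E =>
    transport_op (fun s => tau^-1 * f k s) (ii k) (jj k) phi (t, x)).
  apply: measurable_cV_continuous => x.
  apply: (@continuous_comp _ _ _ (fun x => (t, x))); last exact: cq.
  exact: continuous_pairl.
apply: (etrans (@integral_law _ _ _ _ _ mu0 (X t) (measurable_flow_at t) _ mt iq)).
by rewrite /q clt; exact: (EFin_Rintegral iq).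
Qed.

(** The pieces telescope. Half-open intervals match the hypothesis on [V], and the integrand, given
    by a different formula on each piece, is shown measurable in the same induction. *)
Let weak_sum phi k : smooth phi -> (k <= N)%N ->
  measurable_fun `[0, k%:R * tau[ (weak_integrand phi) /\
  (\int[leb]_(t in `[0%R, (k%:R * tau)%R[) weak_integrand phi t =
   (\int[mu0]_x m phi (k%:R * tau) x - \int[mu0]_x m phi 0 x)%:E)%E.
Proof.
move=> sp; elim: k => [_|k IH kN].
  rewrite mul0r set_itvco0 integral_set0 subrr; split=> //.
  exact: measurable_fun_set0.
have [mk Ik] := IH (ltnW kN).
have cq := @transport_op_continuous _ _ _ (ii k) (jj k) phi (@f_cont k) sp.
have cqm := mean_cont cq.
have k0 : 0 <= k%:R * tau by rewrite mulr_ge0// ltW.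
have kk : k%:R * tau <= k.+1%:R * tau by apply: ler_wpM2r; [exact: ltW|rewrite ler_nat].
have eU : `[0, k.+1%:R * tau[%classic = `[0, k%:R * tau[%classic `|` `[k%:R * tau, k.+1%:R * tau[%classic.
  by rewrite -itv_bndbnd_setU// bnd_simp.
have eqk t : t \in `[k%:R * tau, k.+1%:R * tau[ ->
    weak_integrand phi t = (\int[mu0]_x q k phi t x)%:E.
  by rewrite in_itv/=; exact: weak_integrandE.
have mq : measurable_fun `[k%:R * tau, k.+1%:R * tau[ (fun t => (\int[mu0]_x q k phi t x)%:E).
  by apply/measurable_EFinP; apply: measurable_funTS; exact: continuous_measurable_fun.
have mqk : measurable_fun `[k%:R * tau, k.+1%:R * tau[ (weak_integrand phi).
  by apply: eq_measurable_fun mq => t; rewrite inE => /eqk.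
have mU : measurable_fun (`[0, k%:R * tau[%classic `|` `[k%:R * tau, k.+1%:R * tau[%classic) (weak_integrand phi).
  by apply/measurable_funU.
rewrite eU; split=> //.
rewrite integral_setU//; last first.
  apply/disj_setPS => t [/=]; rewrite !in_itv/= => /andP[_ a1] /andP[a2 _].
  by move: (le_lt_trans a2 a1); rewrite ltxx.
rewrite Ik.
have -> : (\int[leb]_(t in `[(k%:R * tau)%R, (k.+1%:R * tau)%R[) weak_integrand phi t =
   (\int[leb]_(t in `[k%:R * tau, k.+1%:R * tau]) \int[mu0]_x q k phi t x)%:E)%E.
  have -> : (\int[leb]_(t in `[(k%:R * tau)%R, (k.+1%:R * tau)%R[) weak_integrand phi t =
    \int[leb]_(t in `[(k%:R * tau)%R, (k.+1%:R * tau)%R[) (\int[mu0]_x q k phi t x)%:E)%E.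
    by apply: eq_integral => t; rewrite inE => /eqk.
  rewrite integral_itv_bndo_bndc// [in RHS]/Rintegral fineK//.
  by apply: integrable_fin_num => //; exact: continuous_itv_integrable.
rewrite flow_piece// -EFinD; congr EFin; ring.
Qed.

(** [K] is closed and misses [(T, x)], so [phi] vanishes just before [T], and at [T] by continuity.
    This removes the boundary term at the final time. *)
Lemma test_function_end (phi : R * E -> R) (x : E) : test_function T phi -> phi (T, x) = 0.
Proof.
move=> [sp [K [cK KT K0]]].
have clK : closed K by apply: compact_closed => //; exact: norm_hausdorff.
have nK : ~ K (T, x) by move=> /KT[/=]; rewrite in_itv/= ltxx andbF.
have ct : continuous (fun t : R => (t, x)).
  by move=> t; apply: (@cvg_pair _ _ _ _ (nbhs t) (nbhs x) _ _ _ id (cst x)); [exact: cvg_id|exact: cvg_cst].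
have n1 : \forall t \near T, ~ K (t, x).
  have oK : open (~` K) by exact: closed_openC.
  by move: (oK); rewrite openE => /(_ (T, x) nK) => /(ct T).
have cf : continuous (fun t => phi (t, x)).
  by move=> t; apply: (@continuous_comp _ _ _ (fun t : R => (t, x)) phi); [exact: ct|exact: smooth_continuous].
apply/eqP/negP => /negP /= pT.
have n2 : \forall t \near T, phi (t, x) != 0.
  have := cvgr_neq0 _ (cf T) pT; exact.
have n1' : \forall t \near T^'-, ~ K (t, x) by exact: cvg_within n1.
have n2' : \forall t \near T^'-, phi (t, x) != 0 by exact: cvg_within n2.
have n3 : \forall t \near T^'-, False.
  near=> t; have h1 : ~ K (t, x) by near: t.
  have h2 : phi (t, x) != 0 by near: t.
  move: h2; rewrite K0 ?eqxx// in_itv/=; apply/andP; split; near: t.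
    by apply: nbhs_left_ge.
  by apply: nbhs_left_lt.
by have [] := filter_ex n3.
Unshelve. all: by end_near. Qed.

Lemma flow_weak_solution : weak_solution T V mu0 flow_law.
Proof.
split=> [t _||phi tphi]; [exact: flow_law_moment|exact: flow_law_continuous|].
have sp : smooth phi by case: tphi.
have NT : N%:R * tau = T by rewrite /step_time mulrC divfK// pnatr_eq0 -lt0n.
have [mN IN] := weak_sum sp (leqnn N).
rewrite NT in mN IN.
rewrite -(@integral_itv_bndo_bndc _ (BLeft 0) T (weak_integrand phi))// IN.
have cp := smooth_continuous sp.
have -> : \int[mu0]_x m phi T x = 0.
  rewrite (_ : (fun x => m phi T x) = cst 0) ?Rintegral_cst ?mul0r//.
  by apply/funext => x; rewrite /m /cl clampT_id ?in_itv/= ?lexx ?(ltW T0)// test_function_end.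
rewrite sub0r EFinN; congr (- _)%E.
have [M MP] := bounded_along cp.
rewrite -EFin_Rintegral; last first.
  by apply: bounded_integrable (MP 0); exact: along_measurable.
have cp0 : continuous (fun x => phi (0, x)).
  move=> x; apply: (@continuous_comp _ _ _ (fun x => (0, x)) phi); last exact: cp.
  exact: continuous_pairl.
apply: ae_eq_integral => //.
- by apply/measurable_EFinP; exact: along_measurable.
- by apply/measurable_EFinP; exact: measurable_cV_continuous.
(* On the cube, which carries [mu0], the retraction is the identity. *)
exists (~` cube r0); split=> //.
  by apply: measurableC; exact: measurable_cube.
move=> x /= nh xr; apply: nh => _.
by rewrite /m /cl clampT_id ?in_itv/= ?lexx ?(ltW T0)// flow_at0 retract_id.
Qed.

End existence.

(** * Controls constant on a uniform time grid *)

Section truncation_intervals.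
Context {R : realType}.
Variables (T : R) (N : nat).
Hypotheses (T0 : 0 < T) (N0 : (0 < N)%N).
Local Notation tau := (step_time T N).

Let tau0 : 0 < tau. Proof. by rewrite divr_gt0// ltr0n. Qed.

Lemma piecewise_constant_truncn (X : Type) (g : nat -> X) :
  piecewise_constant T (fun t => g (Num.truncn (t / tau))).
Proof.
(* The last of the [N + 1] intervals, [[N * tau, T]], is reduced to the point [T], where the
   truncated quotient equals [N]. *)
pose I (k : 'I_N.+1) : interval R := Interval (BLeft (k%:R * tau))
  (if (k < N)%N then BLeft (k.+1%:R * tau) else BRight T).
have NT : N%:R * tau = T by rewrite /step_time mulrC divfK// pnatr_eq0 -lt0n.
have le_t (k : nat) t : (k%:R <= t / tau) = (k%:R * tau <= t) by rewrite ler_pdivlMr.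
have lt_t (k : nat) t : (t / tau < k%:R) = (t < k%:R * tau) by rewrite ltr_pdivrMr.
have IP (k : 'I_N.+1) t : t \in I k <-> (0 <= t <= T /\ Num.truncn (t / tau) = k).
  rewrite itv_boundlr /I bnd_simp; split.
    move=> /andP[kt tk].
    have t0 : 0 <= t by apply: le_trans kt; rewrite mulr_ge0// ltW.
    have [kN|kN] := ltnP k N; move: tk; rewrite ?kN ?(leq_gtF kN) bnd_simp => tk; split.
    - rewrite t0 (le_trans (ltW tk))// -[leRHS]NT; apply: ler_wpM2r; first exact: ltW.
      by rewrite ler_nat.
    - by apply: truncn_def; rewrite le_t lt_t kt.
    - by rewrite t0.
    have kNe : k = N :> nat by apply/eqP; rewrite eqn_leq kN -ltnS ltn_ord.
    apply: truncn_def; rewrite le_t kt lt_t (le_lt_trans tk)// -[X in X < _]NT kNe.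
    by rewrite ltr_pM2r// ltr_nat.
  move=> [/andP[t0 tT] tk].
  have := truncn_itv (divr_ge0 t0 (ltW tau0)); rewrite tk le_t lt_t => /andP[-> h].
  by case: ifPn => _; rewrite bnd_simp.
exists N.+1, I; split.
- apply/seteqP; split=> [t /=|t [k _] /IP[]]; last by rewrite /= in_itv.
  rewrite in_itv/= => tT; have [t0 t1] := andP tT.
  have kN : (Num.truncn (t / tau) < N.+1)%N.
    have tt : 0 <= t / tau by rewrite divr_ge0// ltW.
    rewrite (truncn_lt_nat _ tt) lt_t (le_lt_trans t1)// -[X in X < _]NT.
    by rewrite ltr_pM2r// ltr_nat.
  by exists (Ordinal kN) => //; apply/IP.
- move=> i j _ _ [t [/= /IP[_ ti] /IP[_ tj]]].
  by apply: val_inj; rewrite /= -ti -tj.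
- by move=> k; exists (g k) => t /IP[_ ->].
Qed.

Lemma truncn_step k t : k%:R * tau <= t < k.+1%:R * tau -> Num.truncn (t / tau) = k.
Proof. by move=> /andP[h1 h2]; apply: truncn_def; rewrite ler_pdivlMr// ltr_pdivrMr// h1. Qed.

End truncation_intervals.

(* A unit-time control acting on the coordinate [ci] through the single neuron *)
(* [cal * sigma (cw * x_cj + cth)]; [cu t s] is the displacement at time [t] of *)
(* a point whose coordinate [cj] starts at [s].                               *)
Record command {R : realType} (d : nat) (sigma : R -> R) := Command {
  ci : 'I_d ; cj : 'I_d ; cal : R ; cw : R ; cth : R ; cu : R -> R -> R ;
  cfun := fun s => cal * sigma (cw * s + cth) ;
  cfun_lip : forall s t, `|cfun s - cfun t| <= 2^-1 * `|s - t| ;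
  cu_init : forall s, cu 0 s = 0 ;
  cu_time : forall t t' s, `|cu t s - cu t' s| <= 2 * `|cfun s| * `|t - t'| ;
  cu_space : forall t s s', `|cu t s - cu t s'| <= `|s - s'| ;
  cu_derive : forall (t s : R), 0 < t < 1 ->
    is_derive t (1 : R) (cu ^~ s) (cfun (s + (ci == cj)%:R * cu t s)) }.

(** * From commands to network controls *)

Section commands.
Context {R : realType} {d : nat}.
Local Notation E := 'cV[R]_d.
Variable sigma : R -> R.
Local Notation cmd := (command d sigma).

Definition run1 (x : E) (c : cmd) : E :=
  x + cu c 1 (x (cj c) ord0) *: delta_mx (ci c) ord0.

Definition run (cs : seq cmd) (x : E) : E := foldl run1 x cs.

Lemma run_cat cs1 cs2 x : run (cs1 ++ cs2) x = run cs2 (run cs1 x).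
Proof. exact: foldl_cat. Qed.

Lemma nat_of_bool_le1 (b : bool) : b%:R <= 1 :> R.
Proof. by case: b. Qed.

Lemma command_exists (K L : R) (i j : 'I_d) (al w th : R) :
  (forall s t, `|sigma s - sigma t| <= K * `|s - t|) ->
  `|al * w| * K <= L -> L <= 2^-1 ->
  exists c : cmd, [/\ ci c = i, cj c = j &
    forall s, `|cu c 1 s - al * sigma (w * s + th)| <= L * (2 * `|al * sigma (w * s + th)|)].
Proof.
move=> sK alK L2.
pose f s := al * sigma (w * s + th).
have K0 : 0 <= K by have := le_trans (normr_ge0 _) (sK 1 0); rewrite subr0 normr1 mulr1.
have L0 : 0 <= L by apply: le_trans alK; rewrite mulr_ge0.
have fL s t : `|f s - f t| <= L * `|s - t|.
  rewrite -mulrBr normrM; apply: (@le_trans _ _ (`|al| * (K * `|w * s + th - (w * t + th)|))).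
    by apply: ler_wpM2l.
  rewrite opprD addrACA subrr addr0 -mulrBr normrM.
  apply: (@le_trans _ _ (`|al * w| * K * `|s - t|)); last by apply: ler_wpM2r.
  by rewrite normrM le_eqVlt; apply/orP; left; apply/eqP; ring.
have fL2 s t : `|f s - f t| <= 2^-1 * `|s - t|.
  by apply: (le_trans (fL _ _)); apply: ler_wpM2r.
have [u [u0 u1 u2 u3 u4]] := @scalar_flow R f L (i == j)%:R fL L0 L2 (ler0n _ _) (nat_of_bool_le1 _).
by exists (@Command R d sigma i j al w th u fL2 u0 u1 u2 u3).
Qed.

Section network_flow.
Variables (T r0 : R) (mu0 : probability E R) (c0 : cmd) (cs' : seq cmd).
Hypotheses (T0 : 0 < T) (r00 : 0 < r0) (supp : (mu0 (~` cube r0) = 0)%E).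
Let cs := c0 :: cs'.
Let N := size cs.
Local Notation tau := (step_time T N).
Let nc (k : nat) := nth c0 cs k.
Let f k := cfun (nc k).
Let ii k := ci (nc k).
Let jj k := cj (nc k).
Let u k := cu (nc k).

Lemma flowmap_run n x : (n <= N)%N ->
  flowmap ii jj u n n%:R x = run (take n cs) x.
Proof.
elim: n => [|n IH] nN; first by rewrite take0.
rewrite (take_nth c0)// -cats1 run_cat -IH ?(ltnW nN)//=.
rewrite (@flowmap_late _ _ ii jj u n n.+1%:R n%:R)// ?ler_nat//.
by rewrite -natr1 [n%:R + 1]addrC addrK clamp01_id// ler01 lexx.
Qed.

(** The zero rows of [W] and [theta] still produce entries [sigma 0]; they are discarded because [A]
    selects the entry [ci] alone. The factor [tau^-1] makes a unit-time command run in time [tau].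
    At time [T] the index is out of range and [nth] returns [c0]. *)
Definition nn_A (t : R) : 'M[R]_d :=
  let c := nc (Num.truncn (t / tau)) in (tau^-1 * cal c) *: delta_mx (ci c) (ci c).
Definition nn_W (t : R) : 'M[R]_d :=
  let c := nc (Num.truncn (t / tau)) in cw c *: delta_mx (ci c) (cj c).
Definition nn_theta (t : R) : E :=
  let c := nc (Num.truncn (t / tau)) in cth c *: delta_mx (ci c) ord0.
Definition nn_field t x := nn_A t *m map_mx sigma (nn_W t *m x + nn_theta t).

Let tau0 : 0 < tau. Proof. by rewrite divr_gt0// ltr0n. Qed.

Lemma delta_mulmx_col (i j : 'I_d) (x : E) :
  delta_mx i j *m x = x j ord0 *: delta_mx i ord0.
Proof.
apply/matrixP => a b; rewrite (ord1 b) !mxE (bigD1 j)//= big1 ?addr0.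
  by rewrite !mxE !eqxx !andbT mulrC.
by move=> k kj; rewrite !mxE (negbTE kj) andbF mul0r.
Qed.

Lemma nn_fieldE k t : (k < N)%N -> k%:R * tau <= t < k.+1%:R * tau ->
  nn_field t = fld (fun s => tau^-1 * f k s) (ii k) (jj k).
Proof.
move=> kN tk; apply/funext => x.
rewrite /nn_field /nn_A /nn_W /nn_theta (truncn_step T0 _ tk)//.
rewrite -!scalemxAl !delta_mulmx_col /fld !mxE !eqxx/= !mulr1 scalerA.
by rewrite /f /cfun mulrA.
Qed.

Lemma nn_existence : exists mu, weak_solution T nn_field mu0 mu.
Proof.
eexists; apply: (@flow_weak_solution R d f ii jj u _ _ _ _ _ T N r0 mu0 T0 _ r00 supp _ nn_fieldE) => //.
- by move=> k; exact: cfun_lip.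
- by move=> k; exact: cu_init.
- by move=> k; exact: cu_time.
- by move=> k; exact: cu_space.
- by move=> k; exact: cu_derive.
Qed.

(** Induction over the pieces: [weak_initial] settles time 0, and on each piece the duration [tau]
    times the Lipschitz constant [tau^-1 / 2] is exactly the 1/2 allowed by [transported_unique]. *)
Lemma nn_unique mu nu : weak_solution T nn_field mu0 mu -> weak_solution T nn_field mu0 nu ->
  forall A, measurable A -> mu T A = nu T A.
Proof.
move=> wmu wnu.
have NT : N%:R * tau = T by rewrite /step_time mulrC divfK// pnatr_eq0.
have kT k : (k <= N)%N -> k%:R * tau <= T.
  by move=> kN; rewrite -[leRHS]NT; apply: ler_wpM2r; [exact: ltW|rewrite ler_nat].
have cf k : continuous (fun s => tau^-1 * f k s).
  move=> s; apply: cvgM; first exact: cvg_cst.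
  by apply: (@lipschitz_cont _ _ 2^-1) => a b; exact: cfun_lip.
suff H k : (k <= N)%N -> forall A, measurable A -> mu (k%:R * tau) A = nu (k%:R * tau) A.
  by move=> A mA; rewrite -[X in mu X]NT -[X in nu X]NT; exact: H.
elim: k => [_|k IH kN].
  rewrite mul0r; apply: probability_bump_unique => psi r sp p0.
  pose phi := fun p : R * E => psi p.2.
  have sphi : smooth phi by apply: (smooth_vec sp) => k; exact: smooth_space.
  have vphi : vanishing T r phi by move=> s x _; exact: p0.
  have V0 s : 0 <= s < 1%:R * tau -> nn_field s = fld (fun s => tau^-1 * f 0%N s) (ii 0%N) (jj 0%N).
    by move=> s1; apply: nn_fieldE => //; rewrite mul0r.
  have t1 : 0 < 1%:R * tau by rewrite mul1r.
  have h0 : (0 : R) \in `[0, T] by rewrite in_itv/= lexx ltW.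
  have := weak_initial T0 wmu (cf 0%N) sphi vphi t1 (kT 1%N isT) V0.
  have := weak_initial T0 wnu (cf 0%N) sphi vphi t1 (kT 1%N isT) V0.
  by rewrite /mean (clampT_id h0) /phi/= => -> ->.
have kk : k%:R * tau < k.+1%:R * tau by rewrite ltr_pM2r// ltr_nat.
have k0 : 0 <= k%:R * tau by rewrite mulr_ge0// ltW.
have Vk t : k%:R * tau <= t < k.+1%:R * tau -> nn_field t = fld (fun s => tau^-1 * f k s) (ii k) (jj k).
  exact: nn_fieldE.
have tr m : weak_solution T nn_field mu0 m ->
    transported T (k%:R * tau) (k.+1%:R * tau) (fun s => tau^-1 * f k s) (ii k) (jj k) m.
  move=> wm phi rho sphi vphi; exact: (weak_transported T0 wm (cf k) sphi vphi k0 kk (kT _ kN) Vk).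
apply: (@transported_unique _ _ T _ _ _ (ii k) (jj k) (tau^-1 * 2^-1) mu nu k0 kk (kT _ kN) _ _ _
  (tr _ wmu) (tr _ wnu) (IH (ltnW kN))).
- by rewrite mulr_ge0// invr_ge0// ltW.
- move=> s t; rewrite -mulrBr normrM (@ger0_norm _ tau^-1) ?invr_ge0 ?(ltW tau0)// -mulrA.
  by apply: ler_wpM2l; [rewrite invr_ge0 ltW|exact: cfun_lip].
- by rewrite -mulrBl -natr1 [k%:R + 1]addrC addrK mul1r mulrA divff ?mul1r// gt_eqF.
Qed.

Lemma measurable_run_retract : measurable_fun setT (fun x => run cs (retract r0 x)).
Proof.
have -> : (fun x => run cs (retract r0 x)) = flow_at ii jj u T N r0 T.
  apply/funext => x; rewrite /flow_at.
  have -> : T / tau = N%:R by rewrite /step_time invf_div mulrC divfK// gt_eqF.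
  by rewrite flowmap_run// take_size.
by apply: measurable_flow_at => // k; exact: cu_space.
Qed.

Theorem network_flow :
  exists (A W : R -> 'M[R]_d) (theta : R -> E),
    [/\ piecewise_constant T A, piecewise_constant T W,
        piecewise_constant T theta &
        let V t x := A t *m map_mx sigma (W t *m x + theta t) in
        (exists mu, weak_solution T V mu0 mu) /\
        (forall mu, weak_solution T V mu0 mu -> forall B, measurable B ->
           mu T B = mu0 ((fun x => run cs (retract r0 x)) @^-1` B))].
Proof.
exists nn_A, nn_W, nn_theta; split.
- exact: (piecewise_constant_truncn T0 _ (fun k => (tau^-1 * cal (nc k)) *: delta_mx (ci (nc k)) (ci (nc k)))).
- exact: (piecewise_constant_truncn T0 _ (fun k => cw (nc k) *: delta_mx (ci (nc k)) (cj (nc k)))).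
- exact: (piecewise_constant_truncn T0 _ (fun k => cth (nc k) *: delta_mx (ci (nc k)) ord0)).
split; first exact: nn_existence.
move=> mu wmu B mB.
have fL k : forall s t, `|f k s - f k t| <= 2^-1 * `|s - t| by exact: cfun_lip.
have ui k := @cu_init _ _ _ (nc k); have ut k := @cu_time _ _ _ (nc k).
have us k := @cu_space _ _ _ (nc k); have ud k := @cu_derive _ _ _ (nc k).
have wm := flow_weak_solution fL ui ut us ud T0 (isT : (0 < N)%N) r00 supp nn_fieldE.
rewrite (nn_unique wmu wm mB) lawE; congr (mu0 (_ @^-1` B)).
apply/funext => x; rewrite /flow_at.
have -> : T / tau = N%:R by rewrite /step_time invf_div mulrC divfK// gt_eqF.
by rewrite flowmap_run// take_size.
Qed.
End network_flow.
End commands.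

(** * Control *)

Section control.
Context {R : realType} {d : nat}.
Local Notation E := 'cV[R]_d.
Variables (sigma : R -> R) (K : R).
Hypothesis sK : forall s t, `|sigma s - sigma t| <= K * `|s - t|.
Local Notation cmd := (command d sigma).
Implicit Types (i : 'I_d) (x : E) (cs : seq cmd).

Let K0 : 0 <= K.
Proof. by have := le_trans (normr_ge0 _) (sK 1 0); rewrite subr0 normr1 mulr1. Qed.

Definition neuron (t : 'I_d * (R * R * R)) x : R :=
  t.2.1.1 * sigma (t.2.1.2 * x t.1 ord0 + t.2.2).
Definition neurons ts x : R := \sum_(t <- ts) neuron t x.

Lemma run1_coord x (c : cmd) k : run1 x c k ord0 =
  x k ord0 + (k == ci c)%:R * cu c 1 (x (cj c) ord0).
Proof. by rewrite !mxE eqxx andbT [in RHS]mulrC. Qed.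

Lemma neuron_bound t r : 0 <= r -> exists2 S, 0 <= S & forall x, cube r x -> `|neuron t x| <= S.
Proof.
case: t => j [[al w] th] r0.
exists (`|al| * (`|sigma th| + K * (`|w| * r))).
  by rewrite mulr_ge0// addr_ge0// mulr_ge0// mulr_ge0.
move=> x xr; rewrite /neuron/= normrM; apply: ler_wpM2l => //.
have h := sK (w * x j ord0 + th) th; rewrite addrK normrM in h.
have h2 : K * (`|w| * `|x j ord0|) <= K * (`|w| * r).
  by apply: ler_wpM2l => //; apply: ler_wpM2l.
have := ler_dist_dist (sigma (w * x j ord0 + th)) (sigma th).
have := ler_norm (`|sigma (w * x j ord0 + th)| - `|sigma th|); lra.
Qed.

(** Operator splitting: the neurons act one after the other with strength [h], and evaluating each
    of them at the initial point instead of the current one costs order [h ^ 2]. *)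
Lemma trotter i ts r : 0 <= r -> exists M C h0, [/\ 0 <= M, 0 <= C, 0 < h0 <= 1,
  forall x, cube r x -> `|neurons ts x| <= M &
  forall h, 0 < h <= h0 -> exists cs, forall x, cube r x ->
    (forall k, k != i -> run cs x k ord0 = x k ord0) /\
    `|run cs x i ord0 - x i ord0 - h * neurons ts x| <= C * h ^+ 2].
Proof.
move=> r0; elim: ts => [|t ts [M [C [h0 [M0 C0 /andP[h00 h01] NM IH]]]]].
  exists 0, 0, 1; split=> //.
  - by rewrite ltr01 lexx.
  - by move=> x _; rewrite /neurons big_nil normr0.
  - move=> h _; exists [::] => x _; split=> //=.
    by rewrite subrr sub0r normrN /neurons big_nil mulr0 normr0 mul0r.
have [S S0 SP] := neuron_bound t r0.
case: t SP => j [[al w] th] SP.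
pose A := `|al * w| * K; have A0 : 0 <= A by rewrite mulr_ge0.
pose B := M + C; have B0 : 0 <= B by rewrite addr_ge0.
(* Coefficients of [h ^ 2]: the earlier commands; the new neuron evaluated at a point displaced by
   up to [h * B]; the gap between its flow and an explicit step. The bound [(2 * A + 1)^-1] on [h]
   ensures [h * A <= 1/2]. *)
pose C' := C + A * B + 2 * A * (S + A * B).
have A1 : 0 < 2 * A + 1 by lra.
exists (S + M), C', (Num.min h0 (2 * A + 1)^-1); split.
- exact: addr_ge0.
- by rewrite /C' !addr_ge0// !mulr_ge0// addr_ge0// mulr_ge0.
- by rewrite lt_min h00 invr_gt0 A1/= ge_min h01.
- move=> x xr; rewrite /neurons big_cons; apply: (le_trans (ler_normD _ _)).
  by apply: lerD; [exact: SP|exact: NM].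
move=> h; rewrite le_min => /andP[hp /andP[hh0 hA]].
have h1 : h <= 1 := le_trans hh0 h01.
have hhh : 0 < h <= h0 by rewrite hp.
have [cs csP] := IH h hhh.
have hA2 : h * A <= 2^-1.
  have := ler_wpM2r (ltW A1) hA; rewrite mulVf ?gt_eqF//; lra.
have hL : `|(h * al) * w| * K <= h * A by rewrite -mulrA normrM (gtr0_norm hp) -mulrA.
have [c [ci_ cj_ cP]] := @command_exists R d sigma K (h * A) i j (h * al) w th sK hL hA2.
exists (cs ++ [:: c]) => x xr; rewrite run_cat.
have [yk yi] := csP x xr; set y := run cs x in yk yi *.
split=> [k ki|]; first by rewrite run1_coord ci_ (negbTE ki) mul0r addr0 yk.
rewrite /= run1_coord ci_ cj_ eqxx mul1r.
set q := cu c 1 (y j ord0); set p := h * al * sigma (w * y j ord0 + th).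
set p' := h * al * sigma (w * x j ord0 + th).
have qp : `|q - p| <= h * A * (2 * `|p|) := cP _.
have nM := NM x xr; set v := neurons ts x in yi nM.
have hh : h ^+ 2 <= h by rewrite expr2 ler_piMl// ltW.
have yxi : `|y i ord0 - x i ord0| <= h * B.
  have e1 : `|h * v| <= h * M by rewrite normrM gtr0_norm// ler_pM2l.
  have e2 : C * h ^+ 2 <= C * h by apply: ler_wpM2l.
  rewrite /B; have := ler_normD (y i ord0 - x i ord0 - h * v) (h * v).
  rewrite subrK; lra.
have yxj : `|y j ord0 - x j ord0| <= h * B.
  have [->//|ji] := eqVneq j i.
  by rewrite yk// subrr normr0 mulr_ge0// ltW.
have pp' : `|p - p'| <= h * A * (h * B).
  rewrite /p /p' -mulrBr normrM.
  apply: (@le_trans _ _ (`|h * al| * (K * `|w * y j ord0 + th - (w * x j ord0 + th)|))).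
    by apply: ler_wpM2l.
  rewrite opprD addrACA subrr addr0 -mulrBr normrM.
  apply: (@le_trans _ _ (`|h * al * w| * K * `|y j ord0 - x j ord0|)).
    by rewrite !normrM le_eqVlt; apply/orP; left; apply/eqP; ring.
  by apply: ler_pM => //; rewrite mulr_ge0.
have hA0 : 0 <= h * A by rewrite mulr_ge0// ltW.
have np : `|p| <= h * (S + A * B).
  have e1 : `|p'| <= h * S.
    rewrite /p' -mulrA normrM gtr0_norm// ler_pM2l//; exact: (SP x xr).
  have e2 : h * A * (h * B) <= h * (A * B).
    rewrite -mulrA ler_pM2l// mulrCA; apply: ler_piMl => //; exact: mulr_ge0.
  have := ler_normD (p - p') p'; rewrite subrK; lra.
have e3 : h * A * (2 * `|p|) <= 2 * A * (S + A * B) * h ^+ 2.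
  apply: (@le_trans _ _ (h * A * (2 * (h * (S + A * B))))).
    by apply: ler_wpM2l => //; apply: ler_wpM2l.
  by rewrite le_eqVlt; apply/orP; left; apply/eqP; ring.
have -> : y i ord0 + q - x i ord0 - h * neurons ((j, (al, w, th)) :: ts) x =
    (y i ord0 - x i ord0 - h * v) + (q - p) + (p - p').
  by rewrite /neurons big_cons /neuron/= -/(neurons ts x) -/v /p'; ring.
apply: (le_trans (ler_normD _ _)); have := ler_normD (y i ord0 - x i ord0 - h * v) (q - p).
have -> : C' * h ^+ 2 = C * h ^+ 2 + h * A * (h * B) + 2 * A * (S + A * B) * h ^+ 2.
  by rewrite /C'; ring.
lra.
Qed.

Variable i0 : 'I_d.
Hypothesis dense : dense_on_compacts (@shallow_networks R d sigma).

(** Density is used on a segment of the [j]-th axis only. There a network depends on the [j]-th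
    entry of each weight alone, so it coincides with a sum of neurons reading just [x_j]. *)
Lemma neurons_dense (j : 'I_d) (g : R -> R) (r dl : R) : continuous g -> 0 < dl ->
  exists ts, forall x, `|x j ord0| <= r -> `|neurons ts x - g (x j ord0)| <= dl.
Proof.
move=> cg dl0.
pose line (s : R) : E := s *: delta_mx j ord0.
have cl : continuous line by move=> s; apply: cvgZr_tmp; exact: cvg_id.
have cK : compact (line @` `[- r, r]).
  by apply: continuous_compact; [exact: continuous_subspaceT|exact: segment_compact].
have cf : continuous (fun x : E => g (x j ord0)).
  move=> x; apply: (@continuous_comp _ _ _ (fun x : E => x j ord0) g); last exact: cg.
  exact: coord_continuous.
have [_ [m [al [w [th [_ ->]]]]] H] := dense cf cK dl0.
exists [seq (j, (al k, w k j ord0, th k)) | k <- enum 'I_m] => x xr.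
have xl : (line @` `[- r, r]) (line (x j ord0)).
  by exists (x j ord0) => //=; rewrite in_itv/= -ler_norml.
have := ereal_sup_ubound (ex_intro2 _ _ (line (x j ord0)) xl erefl :
  [set `|g ((x : E) j ord0) - \sum_i al i * sigma (dot (w i) x + th i)|%:E | x in line @` `[- r, r]]
   `|g ((line (x j ord0)) j ord0) - \sum_i al i * sigma (dot (w i) (line (x j ord0)) + th i)|%:E).
move=> /le_lt_trans/(_ H); rewrite lte_fin => /ltW.
rewrite distrC /neurons big_map big_enum/=.
have -> : line (x j ord0) j ord0 = x j ord0 by rewrite /line !mxE !eqxx mulr1.
congr (`|_ - _| <= _); apply: eq_bigr => k _.
rewrite /neuron/=; congr (_ * sigma (_ + _)).
rewrite /dot mxE (bigD1 j)//= big1 ?addr0.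
  by rewrite /line !mxE !eqxx mulr1.
by move=> q qj; rewrite /line !mxE (negbTE qj) !mulr0.
Qed.

Lemma expr_small (q D e : R) : 0 <= q < 1 -> 0 <= D -> 0 < e -> exists n, q ^+ n * D <= e.
Proof.
move=> /andP[q0 q1] D0 e0.
have : q ^+ n @[n --> \oo] --> (0 : R) by apply: cvg_expr; rewrite ger0_norm.
have De : 0 < e / (D + 1) by rewrite divr_gt0// ltr_wpDl.
move=> /cvgrPdist_le/(_ _ De)[n _ /(_ n (leqnn n))].
rewrite sub0r normrN ger0_norm ?exprn_ge0// => h; exists n.
apply: (@le_trans _ _ (q ^+ n * (D + 1))).
  by apply: ler_wpM2l; [rewrite exprn_ge0|rewrite lerDl].
by move: h; rewrite ler_pdivlMr// ltr_wpDl.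
Qed.

(* Discretized flow of the field [Z(x_i0) - x_i], realized up to a relative    *)
(* error [th] per unit of time.                                               *)
Lemma attract_step i (Z : R -> R) (r th : R) : continuous Z -> 0 <= r -> 0 < th ->
  exists h cs, 0 < h < 1 /\ forall x, cube r x ->
    (forall k, k != i -> run cs x k ord0 = x k ord0) /\
    `|run cs x i ord0 - ((1 - h) * x i ord0 + h * Z (x i0 ord0))| <= th * h.
Proof.
move=> cZ r0 th0; have th4 : 0 < th / 4 by rewrite divr_gt0.
have cN : continuous (fun s : R => - s) by move=> s; apply: cvgN; exact: cvg_id.
(* The field is a function of [x_i0] plus a function of [x_i], each within reach of neurons that
   read a single coordinate. *)
have [t1 T1] := @neurons_dense i0 Z r _ cZ th4.
have [t2 T2] := @neurons_dense i (fun s => - s) r _ cN th4.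
have [M [C [h0 [M0 C0 /andP[h00 h01] _ H]]]] := trotter i (t1 ++ t2) r0.
have C1 : 0 < 2 * (C + 1) by lra.
pose h := Num.min (Num.min h0 2^-1) (th / (2 * (C + 1))).
have hp : 0 < h by rewrite !lt_min h00 invr_gt0 ltr0n/= divr_gt0.
have hh : 0 < h <= h0 by rewrite hp/= !ge_min lexx.
have h2 : h <= 2^-1 by rewrite !ge_min lexx orbT.
have hC : h * (2 * (C + 1)) <= th by rewrite -ler_pdivlMr// !ge_min lexx !orbT.
have [cs csP] := H h hh; exists h, cs; split; first by rewrite hp/=; lra.
move=> x xr; have [c1 c2] := csP x xr; split=> //.
have := T1 x (xr i0); have := T2 x (xr i).
have e : neurons (t1 ++ t2) x = neurons t1 x + neurons t2 x by rewrite /neurons big_cat.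
rewrite e in c2 => b2 b1.
set n1 := neurons t1 x in b1 c2; set n2 := neurons t2 x in b2 c2.
have e3 : C * h ^+ 2 <= th / 2 * h.
  by rewrite expr2 mulrA; apply: ler_wpM2r; [exact: ltW|lra].
have -> : run cs x i ord0 - ((1 - h) * x i ord0 + h * Z (x i0 ord0)) =
  (run cs x i ord0 - x i ord0 - h * (n1 + n2)) + h * (n1 - Z (x i0 ord0)) + h * (n2 - - x i ord0).
  by ring.
have b1' : `|h * (n1 - Z (x i0 ord0))| <= h * (th / 4) by rewrite normrM gtr0_norm// ler_pM2l.
have b2' : `|h * (n2 - - x i ord0)| <= h * (th / 4) by rewrite normrM gtr0_norm// ler_pM2l.
apply: (le_trans (ler_normD _ _)).
have := ler_normD (run cs x i ord0 - x i ord0 - h * (n1 + n2)) (h * (n1 - Z (x i0 ord0))).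
lra.
Qed.

(** Each iteration contracts the distance to [z] by [1 - h], while the errors [th * h] sum to at
    most [th = dl / 2]. Convexity and the margin [dl] keep the cube invariant and, if [i = i0], also
    the interval [[l, u]], so that [Z] keeps reading the same value. *)
Lemma attract i (Z : R -> R) (r dl : R) : continuous Z -> 0 < dl ->
  (forall s, `|Z s| <= r - dl) ->
  exists cs, forall x, cube r x -> [/\ cube r (run cs x),
    (forall k, k != i -> run cs x k ord0 = x k ord0) &
    forall l u z, (forall s, l <= s <= u -> Z s = z) -> l <= x i0 ord0 <= u ->
      (i = i0 -> l + dl <= z <= u - dl) -> `|run cs x i ord0 - z| <= dl].
Proof.
move=> cZ dl0 Zr; have r0 : 0 <= r by have := le_trans (normr_ge0 _) (Zr 0); lra.
have th0 : 0 < dl / 2 by rewrite divr_gt0.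
have [h [cs [/andP[h0 h1] csP]]] := attract_step i cZ r0 th0.
have q01 : 0 <= 1 - h < 1 by lra.
have [n nP] := expr_small q01 (mulr_ge0 (ler0n R 2) r0) th0.
suff H m : exists cs, forall x, cube r x -> [/\ cube r (run cs x),
    (forall k, k != i -> run cs x k ord0 = x k ord0) &
    forall l u z, (forall s, l <= s <= u -> Z s = z) -> l <= x i0 ord0 <= u ->
      (i = i0 -> l + dl <= z <= u - dl) ->
      `|run cs x i ord0 - z| <= (1 - h) ^+ m * `|x i ord0 - z| + dl / 2 /\
      l <= run cs x i0 ord0 <= u].
  have [cs' P'] := H n; exists cs' => x xr; have [p1 p2 p3] := P' x xr.
  split=> // l u z lu xlu zlu; have [h2 _] := p3 l u z lu xlu zlu.
  apply: (le_trans h2).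
  have xz : `|x i ord0 - z| <= 2 * r.
    have := xr i; have := Zr (x i0 ord0); rewrite (lu _ xlu) => a1 a2.
    have := ler_normB (x i ord0) z; lra.
  have := ler_wpM2l (exprn_ge0 n (andP q01).1) xz; lra.
elim: m => [|m [cs' IH]].
  exists [::] => x xr; split=> // l u z _ xlu _; split=> //=.
  by rewrite expr0 mul1r lerDl ltW.
exists (cs' ++ cs) => x xr; rewrite run_cat.
have [p1 p2 p3] := IH x xr; set y := run cs' x in p1 p2 p3 *.
have [c1 c2] := csP y p1.
have hq : (1 - h) * `|y i ord0| <= (1 - h) * r by apply: ler_wpM2l; [lra|exact: p1].
have Zy := Zr (y i0 ord0).
split.
- move=> k; have [->|ki] := eqVneq k i; last by rewrite c1.
  have e1 := ler_normD (run cs y i ord0 - ((1 - h) * y i ord0 + h * Z (y i0 ord0)))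
     ((1 - h) * y i ord0 + h * Z (y i0 ord0)).
  rewrite subrK in e1; have e2 := ler_normD ((1 - h) * y i ord0) (h * Z (y i0 ord0)).
  rewrite !normrM (gtr0_norm h0) (@ger0_norm _ (1 - h)) in e2; last by lra.
  have e3 : h * `|Z (y i0 ord0)| <= h * (r - dl) by rewrite ler_pM2l.
  have e4 : 0 <= h * dl by rewrite mulr_ge0// ltW.
  lra.
- by move=> k ki; rewrite c1// p2.
move=> l u z lu xlu zlu; have [a1 a2] := p3 l u z lu xlu zlu.
rewrite (lu _ a2) in c2; split.
  have -> : run cs y i ord0 - z = (run cs y i ord0 - ((1 - h) * y i ord0 + h * z)) +
     (1 - h) * (y i ord0 - z) by ring.
  apply: (le_trans (ler_normD _ _)); rewrite normrM (@ger0_norm _ (1 - h)); last by lra.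
  have := ler_wpM2l (andP q01).1 a1; rewrite mulrDr mulrA -exprS; lra.
have [ii0|ii0] := eqVneq i i0; last by rewrite c1// eq_sym.
have [z1 z2] := andP (zlu ii0); have [y1 y2] := andP a2.
rewrite -ii0 in y1 y2 *.
have h3 : (1 - h) * l <= (1 - h) * y i ord0 by apply: ler_wpM2l => //; lra.
have h4 : (1 - h) * y i ord0 <= (1 - h) * u by apply: ler_wpM2l => //; lra.
have h5 : h * (l + dl) <= h * z by rewrite ler_pM2l.
have h6 : h * z <= h * (u - dl) by rewrite ler_pM2l.
have h7 : 0 <= h * dl by rewrite mulr_ge0// ltW.
by move: c2; rewrite ler_norml => /andP[? ?]; apply/andP; split; lra.
Qed.

(** Each new slab adds a ramp across the gap before it. The third conclusion strengthens the
    induction: the function built so far is constant past [l n], hence on the next gap and slab. *)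
Lemma step_function n (l u z : nat -> R) (M : R) :
  (forall j, (j <= n)%N -> l j <= u j) -> (forall j, (j < n)%N -> u j < l j.+1) ->
  (forall j, (j <= n)%N -> `|z j| <= M) ->
  exists Z : R -> R, [/\ continuous Z, forall s, `|Z s| <= M,
    forall s, l n <= s -> Z s = z n &
    forall (j : nat) s, (j <= n)%N -> l j <= s <= u j -> Z s = z j].
Proof.
elim: n => [|n IH] lu ul zM.
  exists (cst (z 0%N)); split=> //.
  - by move=> s; exact: cvg_cst.
  - by move=> s /=; exact: (zM 0%N).
  - by move=> j s; rewrite leqn0 => /eqP->.
have [Z [cZ ZM Zn Zj]] := IH (fun j jn => lu j (leqW jn)) (fun j jn => ul j (ltnW jn)) (fun j jn => zM j (leqW jn)).
have w0 : 0 < l n.+1 - u n by rewrite subr_gt0 ul.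
pose ramp (s : R) := clamp01 ((s - u n) / (l n.+1 - u n)).
have r1 s : l n.+1 <= s -> ramp s = 1.
  move=> h; rewrite /ramp /clamp01 min_r ?max_r//.
  by rewrite ler_pdivlMr// mul1r lerD2r.
have r0 s : s <= u n -> ramp s = 0.
  move=> h; rewrite /ramp /clamp01 max_l// ge_min; apply/orP; left.
  by rewrite ler_pdivrMr// mul0r subr_le0.
have lun := lu n (leqnSn n).
have Zhi s : l n.+1 <= s -> Z s + (z n.+1 - z n) * ramp s = z n.+1.
  move=> h; have := ul n (ltnSn n) => h2.
  rewrite r1// Zn ?mulr1; last by lra.
  by rewrite addrC subrK.
have Zlo s : s <= u n -> Z s + (z n.+1 - z n) * ramp s = Z s.
  by move=> h; rewrite r0// mulr0 addr0.
exists (fun s => Z s + (z n.+1 - z n) * ramp s); split.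
- move=> s; apply: cvgD; first exact: cZ.
  apply: cvgM; first exact: cvg_cst.
  apply: (@lipschitz_cont _ ramp (l n.+1 - u n)^-1) => a b.
  apply: (le_trans (clamp01_lip _ _)); rewrite -mulrBl opprB addrA subrK normrM mulrC.
  by rewrite ger0_norm// invr_ge0 ltW.
- move=> s; have [su|us] := leP s (u n); first by rewrite Zlo.
  rewrite Zn; last by lra.
  have z1 := zM n (leqnSn n); have z2 := zM n.+1 (leqnn _).
  have c0 : 0 <= ramp s := clamp01_ge0 _; have c1 : ramp s <= 1 := clamp01_le1 _.
  have -> : z n + (z n.+1 - z n) * ramp s = (1 - ramp s) * z n + ramp s * z n.+1 by ring.
  apply: (le_trans (ler_normD _ _)); rewrite !normrM (ger0_norm c0) (@ger0_norm _ (1 - ramp s)); last by lra.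
  have := ler_wpM2l c0 z2; have c1' : 0 <= 1 - ramp s by lra.
  have := ler_wpM2l c1' z1; lra.
- exact: Zhi.
- move=> j s; rewrite leq_eqVlt => /predU1P[->|jn] /andP[js sj]; first exact: Zhi.
  have sun : s <= u n.
    apply: (le_trans sj); elim: n jn lu ul {IH zM Z cZ ZM Zn Zj w0 ramp r1 r0 lun Zhi Zlo} => [|n IHn] jn lu ul.
      by move: jn; rewrite ltnS leqn0 => /eqP->.
    move: jn; rewrite ltnS leq_eqVlt => /predU1P[->//|jn].
    apply: (le_trans (IHn jn (fun j jn => lu j (leqW jn)) (fun j jn => ul j (ltnW jn)))).
    by apply: (le_trans (ltW (ul n (leqW (ltnSn n))))); exact: lu.
  by rewrite Zlo// (Zj j s)// js.
Qed.

Lemma finite_lower_bound n (f : nat -> R) : (forall j, (j <= n)%N -> 0 < f j) ->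
  exists2 rho, 0 < rho & forall j, (j <= n)%N -> rho <= f j.
Proof.
elim: n => [|n IH] f0.
  by exists (f 0%N) => [|j]; [exact: f0|rewrite leqn0 => /eqP->].
have [rho rho0 P] := IH (fun j jn => f0 j (leqW jn)).
exists (Num.min rho (f n.+1)) => [|j]; first by rewrite lt_min rho0 f0.
rewrite leq_eqVlt => /predU1P[->|jn]; first by rewrite ge_min lexx orbT.
by rewrite ge_min P.
Qed.

Lemma interpolation_bound (s a b M : R) : 0 <= s <= 1 -> `|a| <= M -> `|b| <= M ->
  `|a + s * (b - a)| <= M.
Proof.
move=> /andP[s0 s1] aM bM.
have -> : a + s * (b - a) = (1 - s) * a + s * b by ring.
apply: (le_trans (ler_normD _ _)); rewrite !normrM (ger0_norm s0) (@ger0_norm _ (1 - s)); last by lra.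
have s1' : 0 <= 1 - s by lra.
have := ler_wpM2l s0 bM; have := ler_wpM2l s1' aM; lra.
Qed.

(* Clusters at the increasing positions [z] are moved to the increasing       *)
(* positions [a] through intermediate configurations close to one another.    *)
Lemma move_clusters n (z a : nat -> R) (M r dl : R) : 0 < dl -> M < r ->
  (forall j, (j <= n)%N -> `|z j| <= M) -> (forall j, (j <= n)%N -> `|a j| <= M) ->
  (forall j, (j < n)%N -> z j < z j.+1) -> (forall j, (j < n)%N -> a j < a j.+1) ->
  exists2 rho, 0 < rho & exists cs, forall x, cube r x -> [/\ cube r (run cs x),
    (forall k, k != i0 -> run cs x k ord0 = x k ord0) &
    forall j, (j <= n)%N -> `|x i0 ord0 - z j| <= rho -> `|run cs x i0 ord0 - a j| <= dl].
Proof.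
move=> dl0 Mr zM aM zz aa.
have [g g0 gP] : exists2 g, 0 < g & forall j, (j <= n)%N ->
    g <= if (j < n)%N then Num.min (z j.+1 - z j) (a j.+1 - a j) else 1.
  apply: finite_lower_bound => j jn; case: ifPn => // jn'.
  by rewrite lt_min !subr_gt0 zz// aa.
pose rho := g / 4; have rho0 : 0 < rho by rewrite divr_gt0.
pose e := Num.min (Num.min dl (rho / 2)) (r - M).
have e0 : 0 < e by rewrite !lt_min dl0 subr_gt0 Mr divr_gt0.
have [edl er eM] : [/\ e <= dl, e <= rho / 2 & e <= r - M].
  by rewrite !ge_min !lexx !orbT.
have M0 : 0 <= M by apply: le_trans (zM 0%N isT).
have [K' K'P] : exists K' : nat, 4 * M / rho < K'.+1%:R.
  by exists (Num.truncn (4 * M / rho)); exact: truncnS_gt.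
(* Convex combinations keep all gaps at least [4 * rho], so intervals of half-width [rho] around the
   [m k j] are disjoint. With [K'] large the next target stays in the current interval with margin
   [e], as [attract] demands when acting on [i0] itself. *)
pose m (k j : nat) : R := z j + k%:R / K'.+1%:R * (a j - z j).
have k01 k : (k <= K'.+1)%N -> 0 <= (k%:R / K'.+1%:R : R) <= 1.
  by move=> kK; rewrite divr_ge0//= ler_pdivrMr// mul1r ler_nat.
have mM k j : (k <= K'.+1)%N -> (j <= n)%N -> `|m k j| <= M.
  by move=> kK jn; apply: interpolation_bound; [exact: k01|exact: zM|exact: aM].
have mgap k j : (k <= K'.+1)%N -> (j < n)%N -> 4 * rho <= m k j.+1 - m k j.
  move=> kK jn; have := gP j (ltnW jn); rewrite jn le_min => /andP[h1 h2].
  have /andP[s0 s1] := k01 k kK; rewrite /m; set s := _ / _ in s0 s1 *.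
  have -> : z j.+1 + s * (a j.+1 - z j.+1) - (z j + s * (a j - z j)) =
    (1 - s) * (z j.+1 - z j) + s * (a j.+1 - a j) by ring.
  have s1' : 0 <= 1 - s by lra.
  have := ler_wpM2l s0 h2; have := ler_wpM2l s1' h1; rewrite /rho; lra.
have mstep k j : (j <= n)%N -> `|m k.+1 j - m k j| <= rho / 2.
  move=> jn; have -> : m k.+1 j - m k j = (a j - z j) / K'.+1%:R.
    by rewrite /m -[k.+1%:R]natr1; field.
  rewrite normrM (@ger0_norm _ (_^-1)) ?invr_ge0// ler_pdivrMr//.
  have h1 : `|a j - z j| <= 2 * M.
    by have := ler_normB (a j) (z j); have := zM j jn; have := aM j jn; lra.
  apply: (le_trans h1); move/ltW: K'P; rewrite ler_pdivrMr//; lra.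
exists rho => //.
suff H k : (k <= K'.+1)%N -> exists cs, forall x, cube r x -> [/\ cube r (run cs x),
    (forall k, k != i0 -> run cs x k ord0 = x k ord0) &
    forall j, (j <= n)%N -> `|x i0 ord0 - z j| <= rho ->
      `|run cs x i0 ord0 - m k j| <= if k is 0%N then rho else e].
  have [cs csP] := H _ (leqnn _); exists cs => x xr; have [p1 p2 p3] := csP x xr.
  split=> // j jn xz; apply: le_trans edl; have := p3 j jn xz.
  by have -> : m K'.+1 j = a j by rewrite /m divff// mul1r addrC subrK.
elim: k => [_|k IH kK].
  by exists [::] => x xr; split=> // j jn; rewrite /m mul0r mul0r addr0.
have [cs csP] := IH (ltnW kK).
have [||j jn|Z [cZ ZM _ Zj]] := @step_function n (fun j => m k j - rho) (fun j => m k j + rho) (m k.+1) M.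
- by move=> j jn; lra.
- by move=> j jn; have := mgap k j (ltnW kK) jn; lra.
- exact: mM.
have Zr s : `|Z s| <= r - e by apply: (le_trans (ZM s)); lra.
have [cs' cs'P] := @attract i0 Z r e cZ e0 Zr.
exists (cs ++ cs') => x xr; rewrite run_cat.
have [p1 p2 p3] := csP x xr; set y := run cs x in p1 p2 p3 *.
have [q1 q2 q3] := cs'P y p1; split=> // [i ii0|j jn xz]; first by rewrite q2// p2.
have yr : `|y i0 ord0 - m k j| <= rho.
  apply: (le_trans (p3 j jn xz)); case: (k) => // _; lra.
apply: (q3 (m k j - rho) (m k j + rho)).
- by move=> s; exact: Zj.
- by move: yr; rewrite ler_norml; lra.
- by move=> _; have := mstep k j jn; rewrite ler_norml; lra.
Qed.

(** Coordinate [i0] never moves, so a point keeps its slab while the others are treated one after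
    another. *)
Lemma set_transverse_coords n (l u : nat -> R) (y : nat -> E) (M r dl : R) : 0 < dl -> M < r ->
  (forall j, (j <= n)%N -> l j <= u j) -> (forall j, (j < n)%N -> u j < l j.+1) ->
  (forall j k, (j <= n)%N -> `|y j k ord0| <= M) ->
  exists cs, forall x, cube r x -> [/\ cube r (run cs x), run cs x i0 ord0 = x i0 ord0 &
    forall j, (j <= n)%N -> l j <= x i0 ord0 <= u j ->
      forall k, k != i0 -> `|run cs x k ord0 - y j k ord0| <= dl].
Proof.
move=> dl0 Mr lu ul yM.
suff [cs csP] : exists cs, forall x, cube r x -> [/\ cube r (run cs x), run cs x i0 ord0 = x i0 ord0 &
    forall j, (j <= n)%N -> l j <= x i0 ord0 <= u j ->
      forall k, k \in enum 'I_d -> k != i0 -> `|run cs x k ord0 - y j k ord0| <= dl].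
  exists cs => x xr; have [p1 p2 p3] := csP x xr; split=> // j jn xlu k.
  by apply: p3 => //; rewrite mem_enum.
elim: (enum 'I_d) => [|i ks [cs csP]]; first by exists [::] => x xr; split.
have [ii0|ii0] := eqVneq i i0.
  exists cs => x xr; have [p1 p2 p3] := csP x xr; split=> // j jn xlu k.
  by rewrite inE => /predU1P[->|kks]; [rewrite ii0 eqxx|exact: p3].
have [Z [cZ ZM _ Zj]] := @step_function n l u (fun j => y j i ord0) M lu ul (fun j => yM j i).
pose e := Num.min dl (r - M).
have e0 : 0 < e by rewrite lt_min dl0 subr_gt0.
have [edl eM] : e <= dl /\ e <= r - M by rewrite !ge_min !lexx !orbT.
have Zr s : `|Z s| <= r - e by apply: (le_trans (ZM s)); lra.
have [cs' cs'P] := @attract i Z r e cZ e0 Zr.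
exists (cs ++ cs') => x xr; rewrite run_cat.
have [p1 p2 p3] := csP x xr; set v := run cs x in p1 p2 p3 *.
have [q1 q2 q3] := cs'P v p1; split=> //; first by rewrite q2// eq_sym.
move=> j jn xlu k; rewrite inE.
have [-> _ _|ki /= kks ki0] := eqVneq k i; last by rewrite q2//; exact: p3.
apply: le_trans edl; apply: (q3 (l j) (u j)); first by move=> s; exact: Zj.
  by rewrite p2.
by move=> h; rewrite h eqxx in ii0.
Qed.

Theorem control n (l u : nat -> R) (y : nat -> E) (M r dl : R) : 0 < dl -> M < r ->
  (forall j, (j <= n)%N -> l j < u j) -> (forall j, (j < n)%N -> u j < l j.+1) ->
  (forall j, (j <= n)%N -> - M <= l j /\ u j <= M) ->
  (forall j k, (j <= n)%N -> `|y j k ord0| <= M) ->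
  (forall j, (j < n)%N -> y j i0 ord0 < y j.+1 i0 ord0) ->
  exists cs, forall x, cube r x -> cube r (run cs x) /\
    forall j, (j <= n)%N -> l j <= x i0 ord0 <= u j ->
      forall k, `|run cs x k ord0 - y j k ord0| <= dl.
Proof.
move=> dl0 Mr lu ul luM yM yy.
have lu' j : (j <= n)%N -> l j <= u j by move=> /lu/ltW.
pose z j := (l j + u j) / 2.
have zM j : (j <= n)%N -> `|z j| <= M.
  by move=> jn; have := luM j jn; have := lu j jn; rewrite /z ler_norml; lra.
have zz j : (j < n)%N -> z j < z j.+1.
  by move=> jn; have := lu j (ltnW jn); have := lu j.+1 jn; have := ul j jn; rewrite /z; lra.
have [cs1 P1] := set_transverse_coords dl0 Mr lu' ul yM.
have [rho rho0 [cs3 P3]] := move_clusters dl0 Mr zM (fun j => yM j i0) zz yy.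
have [g g0 gP] : exists2 g, 0 < g & forall j, (j <= n)%N -> g <= u j - l j.
  by apply: finite_lower_bound => j jn; rewrite subr_gt0 lu.
pose e := Num.min (Num.min rho (g / 2)) (r - M).
have e0 : 0 < e by rewrite !lt_min rho0 subr_gt0 Mr divr_gt0.
have [erho eg eM] : [/\ e <= rho, e <= g / 2 & e <= r - M].
  by rewrite !ge_min !lexx !orbT.
have [Z [cZ ZM _ Zj]] := step_function lu' ul zM.
have Zr s : `|Z s| <= r - e by apply: (le_trans (ZM s)); lra.
have [cs2 P2] := @attract i0 Z r e cZ e0 Zr.
(* [cs2] compresses each slab around its midpoint: [cs3] only handles points within [rho] of [z j],
   and [rho] may be much smaller than the slabs. *)
exists (cs1 ++ (cs2 ++ cs3)) => x xr; rewrite !run_cat.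
have [p1 p2 p3] := P1 x xr; set x1 := run cs1 x in p1 p2 p3 *.
have [q1 q2 q3] := P2 x1 p1; set x2 := run cs2 x1 in q1 q2 q3 *.
have [s1 s2 s3] := P3 x2 q1; split=> // j jn xlu k.
have [->|ki0] := eqVneq k i0; last by rewrite s2// q2//; exact: p3.
apply: s3 => //; apply: le_trans erho; apply: (q3 (l j) (u j)).
- by move=> s; exact: Zj.
- by rewrite p2.
- by move=> _; have := gP j jn; rewrite /z; lra.
Qed.

End control.

(** * Coupling *)

Section glue.
Context {d1 d2 : measure_display} {T1 : measurableType d1} {T2 : measurableType d2}.
Context {R : realType}.
Variables (mu : probability T1 R) (nu : probability T2 R).
Variables (N : nat) (G : nat -> set T1) (C : nat -> set T2) (w : nat -> {nonneg R}).
Hypotheses (mG : forall j, measurable (G j)) (mC : forall j, measurable (C j)).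
Local Open Scope ereal_scope.
Hypothesis Gpart : forall A, measurable A -> mu A = \sum_(j < N) mu (A `&` G j).
Hypothesis wC : forall j, (j < N)%N -> (w j)%:num%:E * nu (C j) = 1.
Hypothesis Cpart : forall B, measurable B ->
  nu B = \sum_(j < N) (w j)%:num%:E * mu (G j) * nu (B `&` C j).

Let mGC j : measurable (G j `*` C j). Proof. exact: measurableX. Qed.
Let piece (j : nat) : {measure set (T1 * T2)%type -> \bar R} :=
  mscale (w j) (mrestr (mu \x nu) (mGC j)).
Let glued := msum piece N.

Let gluedX A B : measurable A -> measurable B ->
  glued (A `*` B) = \sum_(j < N) (w j)%:num%:E * (mu (A `&` G j) * nu (B `&` C j)).
Proof.
move=> mA mB; apply: eq_bigr => j _; rewrite /piece /= /mscale/= /mrestr.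
congr (_ * _); rewrite -setXI; apply: product_measure1E; exact: measurableI.
Qed.

Let glued_fst A : measurable A -> glued (A `*` setT) = mu A.
Proof.
move=> mA; rewrite gluedX// Gpart//; apply: eq_bigr => j _.
by rewrite setTI muleCA wC ?mule1.
Qed.

Let glued_snd B : measurable B -> glued (setT `*` B) = nu B.
Proof.
move=> mB; rewrite gluedX// Cpart//; apply: eq_bigr => j _.
by rewrite setTI muleA.
Qed.

Let glued_prob : glued setT = 1.
Proof. by rewrite -setXTT glued_fst// probability_setT. Qed.

(** A sum of product measures restricted to [G j] times [C j], with weight [1 / nu (C j)]. Its mass
    is already 1, and normalizing merely supplies the probability structure. The [C j] may overlap:
    the last one will be a whole cube. *)
Lemma glue_coupling : exists h : probability (T1 * T2)%type R,
  [/\ forall A, measurable A -> h (fst @^-1` A) = mu A,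
      forall B, measurable B -> h (snd @^-1` B) = nu B &
      h (~` \bigcup_(j < N) (G j `*` C j)) = 0].
Proof.
pose h : probability (T1 * T2)%type R := mnormalize glued (mu \x nu).
have hE A : h A = glued A.
  suff g1 z : z = 1 -> (if (z == 0) || (z == +oo) then (fun U => (mu \x nu) U)
    else fun U => glued U * ((fine z)^-1)%:E) A = glued A by exact: g1 glued_prob.
  by move=> ->; rewrite onee_eq0/= invr1 mule1.
exists h; split => [A mA|B mB|]; rewrite hE.
- by rewrite -(glued_fst mA); congr (glued _); apply/seteqP; split=> x //= [].
- by rewrite -(glued_snd mB); congr (glued _); apply/seteqP; split=> x //= [].
apply: big1 => j _; rewrite /piece /= /mscale/= /mrestr.
rewrite (_ : _ `&` _ = set0) ?measure0 ?mule0//.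
by apply/seteqP; split=> // x [] nx xj; apply: nx; exists (j : nat) => //=.
Qed.
End glue.

(** * Slabs of prescribed mass *)

Section quantiles.
Context {R : realType} {d : nat}.
Local Notation E := 'cV[R]_d.
Variables (mu : probability E R) (i : 'I_d) (r : R).
Hypothesis noatom : forall c, mu [set x : E | x i ord0 = c] = 0%E.
Hypothesis supp : mu (~` cube r) = 0%E.
Hypothesis r0 : 0 < r.

Definition below c := [set x : E | x i ord0 <= c].

Lemma measurable_below c : measurable (below c).
Proof.
rewrite (_ : below c = (fun x : E => x i ord0) @^-1` `]-oo, c]).
  by rewrite -[X in measurable X]setTI; apply: measurable_coord.
by apply/seteqP; split=> x; rewrite /below /= in_itv.
Qed.

Definition coord_cdf (c : R) : R := fine (mu (below c)).
Local Notation F := coord_cdf.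

Lemma coord_cdfE c : (F c)%:E = mu (below c).
Proof. by rewrite fineK// fin_num_measure//; exact: measurable_below. Qed.

Lemma coord_cdf_nd a b : a <= b -> F a <= F b.
Proof.
move=> ab; rewrite -lee_fin !coord_cdfE; apply: le_measure; rewrite ?inE; try exact: measurable_below.
by move=> x; rewrite /below/= => /le_trans; apply.
Qed.

Lemma coord_cdf_slab a b : a <= b ->
  mu [set x : E | a < x i ord0 <= b] = (F b - F a)%:E.
Proof.
move=> ab; rewrite EFinB !coord_cdfE.
have -> : [set x : E | a < x i ord0 <= b] = below b `\` below a.
  apply/seteqP; split=> x; rewrite /below/=.
    by move=> /andP[h1 h2]; split=> //; apply/negP; rewrite -ltNge.
  by move=> [h1 /negP]; rewrite -ltNge h1 => ->.
rewrite measureD; try exact: measurable_below.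
  rewrite setIidr// => x; rewrite /below/= => h; exact: (le_trans h).
by rewrite -ge0_fin_numE// fin_num_measure//; exact: measurable_below.
Qed.

Lemma coord_cdf_right c e : 0 < e -> exists n : nat, F (c + n.+1%:R^-1) < F c + e.
Proof.
move=> e0.
have := @nonincreasing_cvg_mu _ _ _ mu (fun n : nat => below (c + n.+1%:R^-1)).
have mb n := measurable_below (c + n.+1%:R^-1).
have cap : \bigcap_n below (c + n.+1%:R^-1) = below c.
  apply/seteqP; split=> x; rewrite /below/=.
    move=> h; apply/ler_addgt0Pr => eps eps0.
    have [|k] := @ltr_add_invr _ 0 eps; first by [].
    by rewrite add0r => ke; apply: (le_trans (h k I)); rewrite lerD2l ltW.
  by move=> h n _ /=; apply: (le_trans h); rewrite lerDl.
rewrite cap => /(_ _ _ _ _) H.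
have {}H : mu \o (fun n : nat => below (c + n.+1%:R^-1)) @ \oo --> mu (below c).
  apply: H => //.
  - by rewrite -ge0_fin_numE// fin_num_measure.
  - exact: measurable_below.
  - apply/nonincreasing_seqP => n; apply/subsetPset => x; rewrite /below/= => h.
    by apply: (le_trans h); rewrite lerD2l lef_pV2 ?posrE// ler_nat.
have H' : F (c + n.+1%:R^-1) @[n --> \oo] --> F c.
  apply: fine_cvg; rewrite coord_cdfE; exact: H.
have [n _ /(_ n (leqnn n))] := cvgr_lt _ H' (F c + e) (ltr_pwDr e0 (lexx _)).
by exists n.
Qed.

(** Here hyperplanes must be null: the union of the half-spaces below [c - 1 / (n + 1)] differs from
    the one below [c] by exactly a hyperplane. *)
Lemma coord_cdf_left c e : 0 < e -> exists n : nat, F c - e < F (c - n.+1%:R^-1).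
Proof.
move=> e0.
have mb n := measurable_below (c - n.+1%:R^-1).
have cup : \bigcup_n below (c - n.+1%:R^-1) = below c `\` [set x : E | x i ord0 = c].
  apply/seteqP; split=> x; rewrite /below/=.
    move=> [n _] h; have : x i ord0 < c by apply: (le_lt_trans h); rewrite ltrBlDr ltrDl.
    by move=> xc; split; [exact: ltW|move=> xe; rewrite xe ltxx in xc].
  move=> [xc /eqP xnc]; have {xnc}xc : x i ord0 < c by rewrite lt_neqAle xnc.
  have [k] := @ltr_add_invr _ (x i ord0) c xc; move=> h; exists k => //; by rewrite /= lerBrDr ltW.
have mc : measurable [set x : E | x i ord0 = c].
  rewrite (_ : mkset _ = (fun x : E => x i ord0) @^-1` [set c]).
    by rewrite -[X in measurable X]setTI; apply: measurable_coord.
  by apply/seteqP; split.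
have eF : mu (\bigcup_n below (c - n.+1%:R^-1)) = (F c)%:E.
  rewrite cup measureD ?coord_cdfE//; last 2 first.
  - exact: measurable_below.
  - by rewrite -ge0_fin_numE// fin_num_measure//; exact: measurable_below.
  set Z := (X in (_ - X)%E); suff Z0 : Z = 0%E by rewrite Z0 sube0.
  rewrite /Z.
  apply/eqP; rewrite eq_le measure_ge0 andbT -[leRHS](noatom c).
  by apply: le_measure => //; rewrite inE//; apply: measurableI => //; exact: measurable_below.
have H : mu \o (fun n : nat => below (c - n.+1%:R^-1)) @ \oo --> (F c)%:E.
  rewrite -eF; apply: nondecreasing_cvg_mu => //.
    by apply: bigcupT_measurable.
  apply/nondecreasing_seqP => n; apply/subsetPset => x; rewrite /below/= => h.
  by apply: (le_trans h); rewrite lerD2l lerN2 lef_pV2 ?posrE// ler_nat.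
have H' : F (c - n.+1%:R^-1) @[n --> \oo] --> F c by exact: fine_cvg.
have Fe : F c - e < F c by rewrite ltrBlDr ltrDl.
have [n _ /(_ n (leqnn n))] := cvgr_gt _ H' _ Fe.
by exists n.
Qed.

Lemma coord_cdf_continuous : continuous F.
Proof.
move=> c; apply/cvgrPdist_lt => e e0.
have [n hn] := coord_cdf_right c e0; have [m hm] := coord_cdf_left c e0.
near=> s; have h1 : s <= c + n.+1%:R^-1.
  by apply: ltW; near: s; apply: lt_nbhsl; rewrite ltrDl.
have h2 : c - m.+1%:R^-1 <= s.
  by apply: ltW; near: s; apply: lt_nbhsr; rewrite ltrBlDr ltrDl.
by have := coord_cdf_nd h1; have := coord_cdf_nd h2; rewrite ltr_norml; lra.
Unshelve. all: by end_near. Qed.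

Lemma quantile q : 0 <= q <= 1 -> exists2 c, - (r + 1) <= c <= r + 1 & F c = q.
Proof.
move=> q01.
have mcube : measurable (@cube R d r) by exact: measurable_cube.
have F0 : F (- (r + 1)) = 0.
  apply/eqP; rewrite -eqe coord_cdfE eq_le measure_ge0 andbT -[leRHS]supp.
  apply: le_measure; rewrite ?inE; [exact: measurable_below|exact: measurableC|].
  move=> x; rewrite /below/= => h /(_ i); rewrite ler_norml => /andP[h2 _].
  by have := le_trans h2 h; lra.
have F1 : F (r + 1) = 1.
  apply/eqP; rewrite -eqe coord_cdfE eq_le probability_le1/=; last exact: measurable_below.
  have c1 : mu (cube r) = 1%E.
    by have := probability_setC mu (measurableC mcube); rewrite setCK supp sube0.
  rewrite -[leLHS]c1; apply: le_measure; rewrite ?inE//; first exact: measurable_below.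
  move=> x /(_ i) h; rewrite /below/=; apply: (le_trans (ler_norm _)); apply: (le_trans h).
  by rewrite lerDl.
have rr : - (r + 1) <= r + 1 by have := r0; lra.
have [||c] := @IVT _ F _ _ q rr.
- by apply: continuous_subspaceT => x; exact: coord_cdf_continuous.
- by rewrite F0 F1 min_l ?max_r.
by rewrite in_itv/= => cr Fc; exists c.
Qed.

(* The mass 2 kap left outside of the slabs separates them.                    *)
Lemma quantile_slabs n (p : nat -> R) (kap : R) : (forall j, (j <= n)%N -> 0 < p j) ->
  \sum_(j < n.+1) p j = 1 -> 0 < kap < 2^-1 ->
  exists l u : nat -> R, [/\ forall j, (j <= n)%N -> l j < u j,
    forall j, (j < n)%N -> u j < l j.+1,
    forall j, (j <= n)%N -> - (r + 1) <= l j /\ u j <= r + 1 &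
    forall j, (j <= n)%N ->
      mu [set x : E | l j < x i ord0 <= u j] = ((1 - 2 * kap) * p j)%:E].
Proof.
move=> p0 p1 /andP[k0 k1].
pose S (j : nat) := \sum_(k < j) p k.
have SS j : S j.+1 = S j + p j by rewrite /S big_ord_recr.
have S0 j : (j <= n.+1)%N -> 0 <= S j.
  by move=> jn; apply: sumr_ge0 => k _; apply: ltW; apply: p0; rewrite -ltnS (leq_trans (ltn_ord k)).
have Smono a b : (a <= b)%N -> (b <= n.+1)%N -> S a <= S b.
  elim: b => [|b IH]; first by rewrite leqn0 => /eqP->.
  rewrite leq_eqVlt => /predU1P[->//|]; rewrite ltnS => ab bn.
  by rewrite SS; apply: ler_wpDr; [exact/ltW/p0|exact/IH/ltnW].
have S1 j : (j <= n)%N -> S j + p j <= 1.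
  by move=> jn; rewrite -SS -p1; exact: Smono.
(* [l j] and [u j] are quantiles at the fractions [kap] and [1 - kap] of the mass interval
   [[S j, S j.+1]]; indices beyond [n] get the default 0. *)
have ql j : exists c, (j <= n)%N -> - (r + 1) <= c <= r + 1 /\ F c = S j + kap * p j.
  case: (leqP j n) => [jn|_]; last by exists 0.
  have pj := p0 j jn; have Sj := S0 j (leqW jn).
  have h1 : 0 <= kap * p j by rewrite mulr_ge0// ltW.
  have h2 : kap * p j <= 2^-1 * p j by apply: ler_wpM2r; exact: ltW.
  have [|c c1 c2] := @quantile (S j + kap * p j); last by exists c.
  by have := S1 j jn; lra.
have qu j : exists c, (j <= n)%N -> - (r + 1) <= c <= r + 1 /\ F c = S j + (1 - kap) * p j.
  case: (leqP j n) => [jn|_]; last by exists 0.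
  have pj := p0 j jn; have Sj := S0 j (leqW jn).
  have h1 : 0 <= kap * p j by rewrite mulr_ge0// ltW.
  have h2 : kap * p j <= 2^-1 * p j by apply: ler_wpM2r; exact: ltW.
  have [|c c1 c2] := @quantile (S j + (1 - kap) * p j); last by exists c.
  by have := S1 j jn; rewrite mulrBl mul1r; lra.
have /choice[l lP] := ql; have /choice[u uP] := qu.
have Flt a b : F a < F b -> a < b.
  by move=> Fab; rewrite ltNge; apply/negP => /coord_cdf_nd; rewrite leNgt Fab.
have lu j : (j <= n)%N -> l j < u j.
  move=> jn; apply: Flt; rewrite (lP j jn).2 (uP j jn).2 ltrD2l ltr_pM2r; [lra|exact: p0].
exists l, u; split=> // [j jn|j jn|j jn].
- apply: Flt; rewrite (lP j.+1 jn).2 (uP j (ltnW jn)).2 SS.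
  have h1 : 0 < kap * p j.+1 by rewrite mulr_gt0// p0.
  have h2 : 0 < kap * p j by rewrite mulr_gt0// p0// ltnW.
  by rewrite mulrBl mul1r; lra.
- by have [/andP[? _] _] := lP j jn; have [/andP[_ ?] _] := uP j jn.
- rewrite coord_cdf_slab; last exact/ltW/lu.
  by rewrite (lP j jn).2 (uP j jn).2; congr EFin; ring.
Qed.
End quantiles.

(** * Sorted grid cells *)

Section cells.
Context {R : realType} {d : nat}.
Local Notation E := 'cV[R]_d.

Lemma measure_disjoint_seq (I : choiceType) (s : seq I) (mu : probability E R) (F : I -> set E) :
  uniq s -> (forall a, measurable (F a)) -> trivIset setT F ->
  mu (\big[setU/set0]_(a <- s) F a) = (\sum_(a <- s) mu (F a))%E.
Proof.
move=> us mF tF; elim: s us => [_|a s IH /= /andP[nas us]].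
  by rewrite !big_nil measure0.
have mU : measurable (\big[setU/set0]_(b <- s) F b) by apply: bigsetU_measurable => b _.
have dis : F a `&` \big[setU/set0]_(b <- s) F b = set0.
  rewrite -subset0 => x [Fax]; rewrite -bigcup_seq => -[b /= bs Fbx].
  by move: nas; rewrite (tF a b Logic.I Logic.I) ?bs//; exists x.
rewrite !big_cons measureU//; congr (_ + _)%E; exact: IH.
Qed.

Lemma measure_partition (I : choiceType) (s : seq I) (mu : probability E R) (F : I -> set E) :
  uniq s -> (forall a, measurable (F a)) -> trivIset setT F ->
  mu (~` \big[setU/set0]_(a <- s) F a) = 0%E ->
  forall B, measurable B -> mu B = (\sum_(a <- s) mu (B `&` F a))%E.
Proof.
move=> us mF tF mu0 B mB; set U := \big[setU/set0]_(a <- s) F a in mu0 *.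
have mU : measurable U by exact: bigsetU_measurable.
have mBF a : measurable (B `&` F a) by exact: measurableI.
rewrite -measure_disjoint_seq//; last first.
  by move=> a b _ _ [x [[_ ax] [_ bx]]]; apply: tF => //; exists x.
rewrite -big_distrr/=.
rewrite -[in LHS](setUIDK B U) measureU//; last 3 first.
- exact: measurableI.
- exact: measurableD.
- by rewrite -subset0 => x [[_ ?] [_ ?]].
set Z := (X in (_ + X)%E); suff -> : Z = 0%E by rewrite adde0.
rewrite /Z.
apply/eqP; rewrite eq_le measure_ge0 andbT -[leRHS]mu0.
by apply: le_measure; rewrite ?inE; [exact: measurableD|exact: measurableC|move=> x []].
Qed.

(** Cells of mass 0 are dropped, as the coupling divides by the mass. Sorting by the index along
    [i0] leaves ties, so the points [y j] are shifted by fractions of [e] in that coordinate to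
    become strictly increasing; hence [2 * e] and not [e]. *)
Lemma grid_cells (nu : probability E R) (i0 : 'I_d) (r e : R) : 0 < r -> 0 < e ->
  (nu (~` cube r) = 0)%E ->
  exists n (C : nat -> set E) (y : nat -> E),
  [/\ forall j, measurable (C j) /\ ((j <= n)%N -> (0 < nu (C j))%E),
      forall B, measurable B -> nu B = (\sum_(j < n.+1) nu (B `&` C j))%E,
      forall j x k, (j <= n)%N -> C j x -> `|x k ord0 - y j k ord0| <= 2 * e,
      forall j, (j < n)%N -> y j i0 ord0 < y j.+1 i0 ord0 &
      forall j k, (j <= n)%N -> `|y j k ord0| <= r + 4 * e].
Proof.
move=> r0 e0 supp.
pose m := Num.truncn (2 * r / e).
pose I := {ffun 'I_d -> 'I_m.+1}.
pose cell (a : I) : set E := [set x : E | forall k, `[(a k)%:R * e - r, (a k).+1%:R * e - r[%classic (x k ord0)].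
have cellP a x k : cell a x -> (a k)%:R * e <= x k ord0 + r < (a k).+1%:R * e.
  by move=> /(_ k); rewrite /= in_itv/= lerBlDr ltrBrDr.
have cellt a x k : cell a x -> Num.truncn ((x k ord0 + r) / e) = a k :> nat.
  by move=> cx; have /andP[h1 h2] := cellP a x k cx; apply: truncn_def; rewrite ler_pdivlMr// ltr_pdivrMr// h1.
have mcell a : measurable (cell a) by
  exact: (@measurable_box R d (fun k => `[(a k)%:R * e - r, (a k).+1%:R * e - r[%classic)).
have tcell : trivIset setT cell.
  move=> a b _ _ [x [ax bx]]; apply/ffunP => k; apply: val_inj.
  by rewrite /= -(cellt a x k ax) -(cellt b x k bx).
have cover : nu (~` \big[setU/set0]_(a <- enum I) cell a) = 0%E.
  apply/eqP; rewrite eq_le measure_ge0 andbT -[leRHS]supp.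
  apply: le_measure; rewrite ?inE.
  - by apply: measurableC; apply: bigsetU_measurable.
  - by apply: measurableC; exact: measurable_cube.
  move=> x; rewrite -bigcup_seq; apply: contra_not => xr.
  have t0 k : 0 <= (x k ord0 + r) / e.
    by rewrite divr_ge0// ?(ltW e0)//; have := xr k; rewrite ler_norml; lra.
  have tm k : (Num.truncn ((x k ord0 + r) / e) < m.+1)%N.
    rewrite ltnS /m truncn_ge_nat; last by rewrite divr_ge0 ?(ltW e0)// mulr_ge0// ltW.
    apply: (@le_trans _ _ ((x k ord0 + r) / e)); first by rewrite truncn_le.
    by rewrite ler_pM2r ?invr_gt0//; have := xr k; rewrite ler_norml; lra.
  exists [ffun k => Ordinal (tm k)] => /=; first by rewrite mem_enum.
  move=> k; rewrite /= ffunE in_itv/= lerBlDr ltrBrDr.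
  by have /andP[] := truncn_itv (t0 k); rewrite ler_pdivlMr// ltr_pdivrMr// => -> ->.
pose le (a b : I) := (a i0 <= b i0)%N.
pose s := sort le [seq a <- enum I | nu (cell a) != 0%E].
have ms a : a \in s -> (0 < nu (cell a))%E.
  by rewrite mem_sort mem_filter => /andP[h _]; rewrite lt_neqAle eq_sym h measure_ge0.
have part B : measurable B -> nu B = (\sum_(a <- s) nu (B `&` cell a))%E.
  move=> mB; rewrite (measure_partition (enum_uniq I) mcell tcell cover mB).
  rewrite /s (perm_big _ (permEl (perm_sort _ _)))/= [RHS]big_filter [RHS]big_mkcond/=.
  apply: eq_bigr => a _; case: ifPn => // /negPn/eqP ca.
  apply/eqP; rewrite eq_le measure_ge0 andbT -[leRHS]ca.
  by apply: le_measure; rewrite ?inE//; exact: measurableI.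
have ss : sorted le s by apply: sort_sorted => a b; exact: leq_total.
case E0 : s => [|a0 s'].
  have := part setT measurableT; rewrite E0 big_nil probability_setT => /eqP.
  by rewrite onee_eq0.
have s0 : (0 < size s)%N by rewrite E0.
pose n := (size s).-1; have nS : n.+1 = size s by rewrite prednK.
pose c j := nth a0 s j.
exists n, (fun j => cell (c j)), (fun j => \col_k ((c j k)%:R * e - r + (k == i0)%:R * (j%:R / (size s)%:R * e))).
have cj j : (j <= n)%N -> c j \in s by move=> jn; rewrite mem_nth// -nS.
have j01 j : (j <= n)%N -> 0 <= (j%:R / (size s)%:R : R) <= 1.
  move=> jn; rewrite divr_ge0//= ler_pdivrMr ?ltr0n// mul1r ler_nat -nS; exact: leqW.
have pert j (k : 'I_d) : (j <= n)%N -> 0 <= (k == i0)%:R * (j%:R / (size s)%:R * e) <= e.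
  move=> jn; have /andP[h1 h2] := j01 j jn; case: (k == i0); last by rewrite mul0r lexx ltW.
  by rewrite mul1r mulr_ge0 ?(ltW e0)//= -[leRHS]mul1r ler_pM2r.
split.
- by move=> j; split=> // /cj/ms.
- move=> B mB; rewrite (part B mB) (big_nth a0) nS big_mkord; exact: eq_bigr.
- move=> j x k jn cx; rewrite !mxE; have := cellP _ _ k cx; rewrite -natr1.
  have := pert j k jn; rewrite ler_norml; set p := _ * (_ * e); lra.
- move=> j jn; rewrite !mxE eqxx !mul1r.
  have h1 : (c j i0 <= c j.+1 i0)%N.
    by move/sortedP : ss => /(_ a0 j); apply; rewrite -nS.
  have h2 : (c j i0)%:R * e <= (c j.+1 i0)%:R * e by rewrite ler_pM2r// ler_nat.
  have h3 : j%:R / (size s)%:R * e < j.+1%:R / (size s)%:R * e.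
    by rewrite !ltr_pM2r ?invr_gt0 ?ltr0n// ltr_nat.
  lra.
- move=> j k jn; rewrite !mxE; have := pert j k jn; set p := _ * (_ * e).
  have h1 : (c j k)%:R * e <= 2 * r.
    rewrite -ler_pdivlMr//; apply: (@le_trans _ _ m%:R).
      by rewrite ler_nat -ltnS.
    by rewrite truncn_le divr_ge0 ?(ltW e0)// mulr_ge0// ltW.
  have h2 : 0 <= (c j k)%:R * e by rewrite mulr_ge0// ltW.
  by rewrite ler_norml; lra.
Qed.

Lemma compact_support_cube (mu : probability E R) : compact (measure_support mu) ->
  exists r0, forall r, r0 <= r -> mu (~` cube r) = 0%E.
Proof.
move=> cS; have [M _ MP] := compact_bounded_fun cS (@norm_continuous _ E).
exists M => r Mr; apply/eqP; rewrite eq_le measure_ge0 andbT.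
have [N [mN N0 sN]] := measure_support_full mu.
rewrite -[leRHS]N0; apply: le_measure; rewrite ?inE//.
  by apply: measurableC; exact: measurable_cube.
move=> x xr; apply: sN => /= Sx; apply: xr => k.
by apply: (le_trans (coord_le_norm x k)); apply: (le_trans _ Mr); have := MP x Sx; rewrite normr_id.
Qed.
End cells.

Lemma sum_scaled_weights n (R : realType) (p : nat -> R) : \sum_(j < n.+1) p j = 1 ->
  forall c, \sum_(j < n.+1) c * p j = c.
Proof. by move=> p1 c; rewrite -mulr_sumr p1 mulr1. Qed.

(** * The coupling bound on W2 and the final choice of constants *)

Section assembly.
Context {R : realType} {d : nat}.
Local Notation E := 'cV[R]_d.

Lemma slabs_disjoint n (l u : nat -> R) : (forall j, (j <= n)%N -> l j < u j) ->
  (forall j, (j < n)%N -> u j < l j.+1) ->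
  forall a b, (a < b)%N -> (b <= n)%N -> u a < l b.
Proof.
move=> lu ul a; elim=> // b IH; rewrite ltnS leq_eqVlt => /predU1P[-> bn|ab bn]; first exact: ul.
by apply: (lt_trans (IH ab (ltnW bn))); apply: (lt_trans (lu b (ltnW bn))); exact: ul.
Qed.

(** Each slab is coupled with its cell at cost [b], and the rest of [mu0], of mass [2 * kap], with
    [muf] itself at cost [D]. The second marginal is right because a slab fills only the fraction
    [1 - 2 * kap] of its cell. Then [Y] is applied to the first component. *)
Lemma W2_slab_coupling (mu0 muf nu : probability E R) (i0 : 'I_d) (Y : E -> E)
    n (C : nat -> set E) (l u : nat -> R) (kap rf b D k : R) :
  measurable_fun setT Y ->
  (forall B, measurable B -> nu B = mu0 (Y @^-1` B)) ->
  (forall j, measurable (C j) /\ ((j <= n)%N -> (0 < muf (C j))%E)) ->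
  (forall B, measurable B -> muf B = (\sum_(j < n.+1) muf (B `&` C j))%E) ->
  (forall j, (j <= n)%N -> l j < u j) -> (forall j, (j < n)%N -> u j < l j.+1) ->
  (forall j, (j <= n)%N -> mu0 [set x : E | l j < x i0 ord0 <= u j] =
    ((1 - 2 * kap) * fine (muf (C j)))%:E) ->
  muf (~` cube rf) = 0%E ->
  0 <= b -> 0 <= D -> 0 <= k -> 0 <= kap -> b + D * (2 * kap) <= k ^+ 2 ->
  (forall j (x y : E), (j <= n)%N -> l j < x i0 ord0 <= u j -> C j y -> enorm (Y x - y) ^+ 2 <= b) ->
  (forall x y : E, cube rf y -> enorm (Y x - y) ^+ 2 <= D) ->
  (W2 nu muf <= k%:E)%E.
Proof.
move=> mY nuY CP Cpart lu ul slab suppf b0 D0 k0 kap0 cost Yb YD.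
pose p j := fine (muf (C j)).
have pE j : muf (C j) = (p j)%:E by rewrite fineK// fin_num_measure//; have [] := CP j.
have p0 j : (j <= n)%N -> 0 < p j by move=> jn; rewrite -lte_fin -pE; have [_] := CP j; exact.
have p1 : \sum_(j < n.+1) p j = 1.
  apply: EFin_inj; rewrite -sumEFin -(probability_setT muf) (Cpart setT measurableT).
  by apply: eq_bigr => j _; rewrite setTI pE.
pose S (j : 'I_n.+1) := [set x : E | l j < x i0 ord0 <= u j].
have mS j : measurable (S j).
  rewrite (_ : S j = (fun x : E => x i0 ord0) @^-1` `]l j, u j]).
    by rewrite -[X in measurable X]setTI; apply: measurable_coord.
  by apply/seteqP; split=> x; rewrite /S /= in_itv.
have tS : trivIset setT S.
  move=> j j' _ _ [x [/= /andP[x1 x2] /andP[x3 x4]]]; apply: val_inj => /=.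
  have sd := slabs_disjoint lu ul.
  have [jj|jj|//] := ltngtP j j'.
    have := sd j j' jj (leq_ord _) => h.
    by move: (lt_trans h x3); rewrite ltNge x2.
  have := sd j' j jj (leq_ord _) => h.
  by move: (lt_trans h x1); rewrite ltNge x4.
pose U := \big[setU/set0]_(j < n.+1) S j.
have mU : measurable U by apply: bigsetU_measurable.
pose G j := if (j <= n)%N then [set x : E | l j < x i0 ord0 <= u j] else ~` U.
(* Index [n.+1] stands for the rest; its target [cube rf] has full mass, whence the weight 1
   below. *)
pose C' j := if (j <= n)%N then C j else cube rf.
have p0' j : 0 <= (if (j <= n)%N then (p j)^-1 else 1).
  by case: ifPn => // jn; rewrite invr_ge0 ltW// p0.
pose w j : {nonneg R} := NngNum (p0' j).
have mG j : measurable (G j).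
  rewrite /G; case: ifPn => jn; last exact: measurableC.
  exact: (mS (Ordinal (jn : (j < n.+1)%N))).
have mC' j : measurable (C' j).
  rewrite /C'; case: ifPn => jn; last exact: measurable_cube.
  by have [] := CP j.
have Glt (j : 'I_n.+1) : G j = S j by rewrite /G leq_ord.
have Gn : G n.+1 = ~` U by rewrite /G ltnn.
have Gpart A : measurable A -> mu0 A = (\sum_(j < n.+2) mu0 (A `&` G j))%E.
  move=> mA; rewrite big_ord_recr/= Gn -[in LHS](setUIDK A U) measureU//; last 3 first.
  - exact: measurableI.
  - exact: measurableD.
  - by rewrite -subset0 => x [[_ ?] [_ ?]].
  rewrite -setDE; congr (_ + _)%E.
  rewrite /U big_distrr/= measure_bigsetU_ord//; last 2 first.
  - by move=> j; exact: measurableI.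
  - by move=> j j' _ _ [x [[_ ax] [_ bx]]]; apply: tS => //; exists x.
  by apply: eq_bigr => j _; rewrite -Glt.
have mu0S (j : 'I_n.+1) : mu0 (G j) = ((1 - 2 * kap) * p j)%:E by rewrite Glt slab// leq_ord.
have mu0U : mu0 (~` U) = (2 * kap)%:E.
  have := Gpart setT measurableT; rewrite probability_setT big_ord_recr/= setTI Gn.
  have -> : (\sum_(j < n.+1) mu0 (setT `&` G j))%E = (1 - 2 * kap)%:E.
    rewrite -(sum_scaled_weights p1 (1 - 2 * kap)) -sumEFin.
    by apply: eq_bigr => j _; rewrite setTI mu0S.
  have fU : mu0 (~` U) = (fine (mu0 (~` U)))%:E.
    by rewrite fineK// fin_num_measure//; exact: measurableC.
  rewrite fU -EFinD => h; have {}h := EFin_inj h; congr EFin; lra.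
have wC j : (j < n.+2)%N -> ((w j)%:num%:E * muf (C' j) = 1)%E.
  move=> jn; rewrite /w/= /C'; case: ifPn => jn'.
    by rewrite pE -EFinM mulVf// gt_eqF// p0.
  have := probability_setC muf (measurableC (@measurable_cube R d rf)).
  by rewrite setCK suppf sube0 mul1e.
have Cpart' B : measurable B ->
    muf B = (\sum_(j < n.+2) (w j)%:num%:E * mu0 (G j) * muf (B `&` C' j))%E.
  move=> mB; rewrite big_ord_recr/= Gn mu0U ltnn mul1e.
  have -> : muf (B `&` C' n.+1) = muf B.
    rewrite /C' ltnn -[in RHS](setUIDK B (cube rf)) measureU//; last 3 first.
    - by apply: measurableI => //; exact: measurable_cube.
    - by apply: measurableD => //; exact: measurable_cube.
    - by rewrite -subset0 => x [[_ ?] [_ ?]].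
    set Z := (X in (_ + X)%E); suff -> : Z = 0%E by rewrite adde0.
    apply/eqP; rewrite /Z eq_le measure_ge0 andbT -[leRHS]suppf.
    apply: le_measure; rewrite ?inE; last by move=> x [].
      by apply: measurableD => //; exact: measurable_cube.
    by apply: measurableC; exact: measurable_cube.
  have -> : (\sum_(j < n.+1) (w j)%:num%:E * mu0 (G j) * muf (B `&` C' j))%E =
      ((1 - 2 * kap)%:E * muf B)%E.
    rewrite [in RHS](Cpart B mB) ge0_sume_distrr//; apply: eq_bigr => j _.
    rewrite mu0S /w/= /C' leq_ord -EFinM; congr (_%:E * _)%E.
    by rewrite mulrCA mulVf ?mulr1// gt_eqF// p0// leq_ord.
  have fB : muf B = (fine (muf B))%:E by rewrite fineK// fin_num_measure.
  rewrite fB -!EFinM -EFinD; congr EFin; ring.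
have [h [h1 h2 h3]] := glue_coupling mG mC' Gpart wC Cpart'.
have mYs : measurable_fun setT (fun z : E * E => (Y z.1, z.2)).
  by apply: measurable_fun_pair => //; exact: measurableT_comp.
apply: (@coupling_W2 _ _ _ _ (law h mYs)) => //.
  split=> A mA; rewrite lawE; last exact: h2.
  rewrite nuY// -h1//; rewrite -[X in measurable X]setTI; exact: mY.
rewrite ge0_integral_law; last 2 first.
- by apply/measurable_EFinP; exact: measurable_cost.
- by move=> y; rewrite lee_fin sqr_ge0.
have mfU : measurable (fst @^-1` (~` U) : set (E * E)).
  by rewrite -[X in measurable X]setTI; apply: measurable_fst => //; exact: measurableC.
apply: (@le_trans _ _ (\int[h]_z (b%:E + D%:E * (\1_(fst @^-1` (~` U)) z)%:E))%E).
  apply: ae_ge0_le_integral => //.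
  - by move=> z _; rewrite lee_fin sqr_ge0.
  - apply/measurable_EFinP; apply: measurable_enorm_sq.
    by apply: measurable_cV_sub => //; exact: measurableT_comp.
  - by move=> z _; rewrite -EFinM -EFinD lee_fin addr_ge0// mulr_ge0.
  - apply: emeasurable_funD => //; apply: measurable_funeM.
    by apply/measurable_EFinP; exact: measurable_indic.
  exists (~` \bigcup_(j < n.+2) (G j `*` C' j)); split=> //.
    apply: measurableC; apply: bigcup_measurable => j _; exact: measurableX.
  move=> [x y] /=; apply: contra_not => -[j /= jn [Gx Cy]] _.
  rewrite -EFinM -EFinD lee_fin; move: Gx Cy; rewrite /G /C'; case: ifPn => jn' Gx Cy.
    by apply: (le_trans (Yb j x y jn' Gx Cy)); rewrite lerDl mulr_ge0.
  apply: (le_trans (YD x y Cy)); rewrite indicE mem_set// mulr1 lerDr//.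
rewrite ge0_integralD//; last 2 first.
- by move=> z _; rewrite -EFinM lee_fin mulr_ge0.
- by apply: measurable_funeM; apply/measurable_EFinP; exact: measurable_indic.
rewrite probability_integral_cst ge0_integralZl//; last first.
  by apply/measurable_EFinP; exact: measurable_indic.
have -> : (\int[h]_z (\1_(fst @^-1` (~` U)) z)%:E = (2 * kap)%:E)%E.
  by rewrite integral_indic// setIT -mu0U; apply: h1; exact: measurableC.
by rewrite -EFinM -EFinD lee_fin.
Qed.

End assembly.

Theorem mainTheorem2 (R : realType) (T : R) (d : nat) (sigma : R -> R)
    (mu0 muf : probability 'cV[R]_d R) :
  0 < T -> (0 < d)%N ->
  lipschitz sigma ->
  dense_on_compacts (@shallow_networks R d sigma) ->
  finite_second_moment mu0 -> finite_second_moment muf ->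
  compact (measure_support mu0) -> compact (measure_support muf) ->
  mu0 `<< lebesgue_cV R d -> muf `<< lebesgue_cV R d ->
  forall eps : R, 0 < eps ->
  exists (A W : R -> 'M[R]_d) (theta : R -> 'cV[R]_d),
    [/\ piecewise_constant T A, piecewise_constant T W,
        piecewise_constant T theta &
        let V t x := A t *m map_mx sigma (W t *m x + theta t) in
        (exists mu, weak_solution T V mu0 mu) /\
        (forall mu, weak_solution T V mu0 mu -> (W2 (mu T) muf <= eps%:E)%E)].
Proof.
move=> T0 d0 lsigma dense _ _ cmu0 cmuf ac0 _ eps eps0.
have [K sK] : exists K, forall s t, `|sigma s - sigma t| <= K * `|s - t|.
  move: lsigma; rewrite /lipschitz_on => /pinfty_ex_gt0[K K0 H].
  by exists K => s t; exact: (H (s, t)).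
pose i0 : 'I_d := Ordinal d0.
have [ra rA] := compact_support_cube cmu0; have [rb rB] := compact_support_cube cmuf.
pose rf := Num.max 1 (Num.max ra rb).
have [rf1 rfa rfb] : [/\ 1 <= rf, ra <= rf & rb <= rf].
  by rewrite !le_max !lexx !orbT.
have rf0 : 0 < rf by apply: lt_le_trans rf1.
have dd0 : 0 < d%:R :> R by rewrite ltr0n.
have dd1 : 1 <= d%:R :> R by rewrite ler1n.
(* In each coordinate a point ends within [eta] of [y j], itself within [2 * eta] of the cell's
   points: the squared cost [d * (3 * eta) ^ 2] is at most [eps ^ 2 / 4]. *)
pose eta := eps / (6 * d%:R).
have eta0 : 0 < eta by rewrite divr_gt0// mulr_gt0.
have [n [C [y [CP Cpart Cy yinc yM]]]] := grid_cells i0 rf0 eta0 (rB _ rfb).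
(* Covers both the ends of the slabs, up to [rf + 1], and the targets, up to [rf + 4 * eta]. *)
pose M := rf + 4 * eta + 1.
pose r := M + 1.
have Mr : M < r by rewrite ltrDl.
have M0 : 0 < M by rewrite /M; lra.
have r0 : 0 < r by rewrite /r; lra.
have rfr : rf <= r by rewrite /r /M; lra.
pose D := d%:R * (r + rf) ^+ 2.
have D0 : 0 <= D by rewrite mulr_ge0// sqr_ge0.
(* The mass outside of the slabs then costs [2 * kap * D <= eps ^ 2 / 2], and [kap] stays below
   1/2. *)
pose kap := Num.min 4^-1 (eps ^+ 2 / (4 * (D + 1))).
have e20 : 0 < eps ^+ 2 by rewrite exprn_gt0.
have D1 : 0 < 4 * (D + 1) by lra.
have kap0 : 0 < kap by rewrite lt_min invr_gt0 ltr0n/= divr_gt0.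
have kap2 : kap < 2^-1.
  by apply: (@le_lt_trans _ _ 4^-1); [rewrite ge_min lexx|lra].
have kapD : kap * (4 * (D + 1)) <= eps ^+ 2.
  by rewrite -ler_pdivlMr// ge_min lexx orbT.
pose p j := fine (muf (C j)).
have pE j : muf (C j) = (p j)%:E by rewrite fineK// fin_num_measure//; have [] := CP j.
have p0 j : (j <= n)%N -> 0 < p j by move=> jn; rewrite -lte_fin -pE; have [_] := CP j; exact.
have p1 : \sum_(j < n.+1) p j = 1.
  apply: EFin_inj; rewrite -sumEFin -(probability_setT muf) (Cpart setT measurableT).
  by apply: eq_bigr => j _; rewrite setTI pE.
have noatom c : mu0 [set x | x i0 ord0 = c] = 0%E by exact: hyperplane_null.
have kap12 : 0 < kap < 2^-1 by rewrite kap0.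
have [l [u [lu ul luM slab]]] := quantile_slabs noatom (rA _ rfa) rf0 p0 p1 kap12.
have luM' j : (j <= n)%N -> - M <= l j /\ u j <= M.
  by move=> /luM[? ?]; rewrite /M; split; lra.
have yM' j k : (j <= n)%N -> `|y j k ord0| <= M.
  by move=> jn; apply: (le_trans (yM j k jn)); rewrite /M; lra.
have [cs csP] := control sK dense eta0 Mr lu ul luM' yM' yinc.
have K00 : `|0 * 0| * K <= 0 by rewrite mul0r normr0 mul0r.
have z2 : 0 <= 2^-1 :> R by [].
(* A command that does nothing, put in front because [network_flow] takes a nonempty list. *)
have [c0 [_ _ c0P]] := @command_exists R d sigma K 0 i0 i0 0 0 0 sK K00 z2.
have c0u s : cu c0 1 s = 0.
  by apply/eqP; rewrite -normr_le0; have := c0P s; rewrite !mul0r subr0.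
have runE x : run (c0 :: cs) x = run cs x.
  by rewrite /run/= {2}/run1 c0u scale0r addr0.
have supp : mu0 (~` cube r) = 0%E by apply: rA; exact: le_trans rfr.
have [A [W [theta [pA pW pth [ex uniq]]]]] := network_flow c0 cs T0 r0 supp.
exists A, W, theta; split=> //; split=> // mu wmu.
have muT := uniq mu wmu.
have mY := measurable_run_retract c0 cs T0 r0.
apply: (W2_slab_coupling (b := d%:R * (3 * eta) ^+ 2) (D := D) (kap := kap) mY muT CP Cpart lu ul slab (rB _ rfb)) => //.
- by rewrite mulr_ge0// sqr_ge0.
- exact: ltW.
- exact: ltW.
- have -> : d%:R * (3 * eta) ^+ 2 = eps ^+ 2 / (4 * d%:R).
    by rewrite /eta; field; rewrite gt_eqF.
  have : eps ^+ 2 / (4 * d%:R) <= eps ^+ 2 / 4.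
    by rewrite ler_pM2l// lef_pV2 ?posrE ?mulr_gt0//; lra.
  lra.
- move=> j x z jn xlu Cz; apply: enorm_sq_le => k.
  have rx : cube r (retract r x).
    by move=> q; apply: (le_trans (coord_le_norm _ _)); exact: retract_norm.
  have [_ H] := csP _ rx.
  have [xl xu] := andP xlu; have [lM uM] := luM' j jn.
  (* The slab lies within the range of the retraction along [i0], so the label survives even if
     other coordinates are clamped. *)
  have xi : retract r x i0 ord0 = x i0 ord0.
    by rewrite mxE clampT_id ?addrK// in_itv/=; apply/andP; split; lra.
  have := H j jn; rewrite xi (ltW xl) xu => /(_ isT k).
  have := Cy j z k jn Cz; rewrite runE !mxE; set v := run _ _ _ _.
  by rewrite !ler_norml; lra.
- move=> x z zr; apply: enorm_sq_le => k.
  have rx : cube r (retract r x).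
    by move=> q; apply: (le_trans (coord_le_norm _ _)); exact: retract_norm.
  have [/(_ k) h1 _] := csP _ rx; have h2 := zr k.
  rewrite runE !mxE; move: h1 h2; set v := run _ _ _ _.
  by rewrite !ler_norml; lra.
Qed.
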